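(* Let $N>4$ be an integer, let $U$ be a binary quantic of order $N$ in the symplectic coordinates $(p,q)$, let $H,S,T$ be its normalized covariants as defined in the context, and put $\Phi=-[N(N-2)]^2H$. Let $\gamma$ be a Hamilton curve of $U$ along which the (necessarily constant) value of $U$ is nonzero. Along $\gamma$, $\Phi$ satisfies the Weierstrass equation $$\overset{\circ}{\Phi}\,^2=4\Phi^3-g_2\Phi-g_3,\qquad g_2=[N^2(N-2)^2U]^2S,\quad g_3=[N^2(N-2)^2U]^3T,$$ where all functions are evaluated along $\gamma$. Then: (i) This Weierstrass equation is proper along $\gamma$ (that is, $g_2$ and $g_3$ are constant along $\gamma$) if and only if the Jacobian covariants $(U,S)$ and $(U,T)$ both vanish along $\gamma$. (ii) Suppose the equation is proper along $\gamma$. If $\Phi$ is nonconstant along $\gamma$, then the constant value of $S$ along $\gamma$ (hence that of $g_2$) is zero; moreover, if $\Phi$ is nonconstant along $\gamma$ and the constant value of $T$ along $\gamma$ is nonzero, then $\Phi$ is a Weierstrass $\wp$ function along $\gamma$.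
   Context: Work over $\mathbb{K}=\mathbb{R}$ or $\mathbb{C}$. A (binary) quantic of order $N$ is a homogeneous polynomial of degree $N$ in $(p,q)$, written $U=\sum_{n=0}^{N}\binom{N}{n}a_n p^{N-n}q^n$ with $a_n\in\mathbb{K}$. Subscripts $p,q$ denote partial derivatives. The Jacobian of two polynomials is $(X,Y)=X_pY_q-X_qY_p$. Normalized Hessian $H$: $U_{pp}U_{qq}-U_{pq}^2 = N^2(N-1)^2 H$. Covariants $S$ and $T$: put $A=U_{pppp}$, $B=U_{pppq}$, $C=U_{ppqq}$, $D=U_{pqqq}$, $E=U_{qqqq}$. Then $S$ and $T$ are defined by $$AE-4BD+3C^2=[N(N-1)(N-2)(N-3)]^2 S,$$ $$ACE+2BCD-AD^2-B^2E-C^3=[N(N-1)(N-2)(N-3)]^3 T.$$ A Hamilton curve of $U$ is a solution curve $\gamma=(p,q)$, defined on a connected time domain (an interval if $\mathbb{K}=\mathbb{R}$, a connected open subset of $\mathbb{C}$ if $\mathbb{K}=\mathbb{C}$), of the system $\overset{\circ}{q}=U_p$, $\overset{\circ}{p}=-U_q$, where $^{\circ}$ denotes the time derivative. A function $V$ of $(p,q)$ evaluated along $\gamma$ means $V\circ\gamma$; its time derivative is $(U,V)\circ\gamma$, and $U$ is constant along $\gamma$. ''$\Phi$ is a Weierstrass $\wp$ function along $\gamma$'' means that there is a constant $c\in\mathbb{C}$ such that $\Phi(\gamma(t))=\wp(t+c)$ for all $t$ in the time domain, where $\wp$ is the Weierstrass elliptic function with invariants $g_2,g_3$ (discriminant $g_2^3-27g_3^2\neq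 0$). *)

(* Defs.v *)
From HB Require Import structures.
From mathcomp Require Import all_boot all_order all_algebra.
From mathcomp Require Import finmap.
From mathcomp Require Import complex.
From mathcomp Require Import boolp classical_sets reals topology normedtype.
From mathcomp Require Import showcase.summability.
(* The notations of mpoly clash with those of the topology libraries. *)
From mathcomp Require Import -(notations) mpoly.

Set Implicit Arguments.
Unset Strict Implicit.
Unset Printing Implicit Defensive.

Import Order.TTheory GRing.Theory Num.Theory numFieldNormedType.Exports.

Local Open Scope ring_scope.
Local Open Scope complex_scope.
Local Open Scope classical_set_scope.

(** * Binary forms and their covariants *)

Notation bipoly K := (mpoly 2 K).

(* In [bipoly K], variable 0 is p and variable 1 is q. *)
Notation "\dp X" := (mderiv (ord0 : 'I_2) X)
  (at level 8, X at level 8, format "\dp  X").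
Notation "\dq X" := (mderiv (ord_max : 'I_2) X)
  (at level 8, X at level 8, format "\dq  X").

Section Covariants.
Variable K : numFieldType.
Implicit Types (N : nat) (U X Y : bipoly K).

(* As usual in the library, the zero polynomial is homogeneous of every
   degree. *)
Definition quantic N U : Prop := U \is ishomog1 N (mdeg (n := 2)).

Definition jacobian X Y : bipoly K := \dp X * \dq Y - \dq X * \dp Y.

Definition hessian N U : bipoly K :=
  (N%:R ^+ 2 * (N%:R - 1) ^+ 2)^-1 *:
  (\dp \dp U * \dq \dq U - (\dq \dp U) ^+ 2).

Definition quartic_factor N : K :=
  N%:R * (N%:R - 1) * (N%:R - 2%:R) * (N%:R - 3%:R).

Definition covS N U : bipoly K :=
  let A := \dp \dp \dp \dp U in
  let B := \dq \dp \dp \dp U in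
  let C := \dq \dq \dp \dp U in
  let D := \dq \dq \dq \dp U in
  let E := \dq \dq \dq \dq U in
  (quartic_factor N ^+ 2)^-1 *: (A * E - B * D *+ 4 + C ^+ 2 *+ 3).

Definition covT N U : bipoly K :=
  let A := \dp \dp \dp \dp U in
  let B := \dq \dp \dp \dp U in
  let C := \dq \dq \dp \dp U in
  let D := \dq \dq \dq \dp U in
  let E := \dq \dq \dq \dq U in
  (quartic_factor N ^+ 3)^-1 *:
  (A * C * E + B * C * D *+ 2 - A * D ^+ 2 - B ^+ 2 * E - C ^+ 3).

Definition Phi N U : bipoly K :=
  - ((N%:R * (N%:R - 2%:R)) ^+ 2 *: hessian N U).

Definition g2 N U : bipoly K :=
  ((N%:R ^+ 2 * (N%:R - 2%:R) ^+ 2) *: U) ^+ 2 * covS N U.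

Definition g3 N U : bipoly K :=
  ((N%:R ^+ 2 * (N%:R - 2%:R) ^+ 2) *: U) ^+ 3 * covT N U.

End Covariants.

(** * The scalar field and the time domains *)

Variant scalars := RealScalars | ComplexScalars.

Definition field_of (R : realType) (k : scalars) : numFieldType :=
  match k with RealScalars => R | ComplexScalars => R[i] end.

Definition to_complex (R : realType) (k : scalars) : field_of R k -> R[i] :=
  match k with
  | RealScalars => fun x : R => x%:C
  | ComplexScalars => fun z : R[i] => z
  end.

(* Real intervals are nondegenerate but need not be open, bounded or closed. *)
Definition time_domain (R : realType) (k : scalars) :
    set (field_of R k) -> Prop :=
  match k with
  | RealScalars => fun D : set R =>
      is_interval D /\ exists s t : R, [/\ D s, D t & s < t]
  | ComplexScalars => fun D : set (R[i] : numFieldType) =>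
      open D /\ connected D
  end.

(** * Functions along a curve t |-> (p t, q t) *)

Section Curves.
Variable K : numFieldType.
Implicit Types (D : set K) (p q f : K -> K) (U V : bipoly K).

(* Derivative over K relative to D: the complex derivative if D is open in the
   complex plane; one-sided at an end point of a real interval. *)
Definition has_derivative D f (t l : K) : Prop :=
  (f s - f t) / (s - t) @[s --> within D t^'] --> l.

Definition along p q V (t : K) : K :=
  meval (tnth [tuple p t; q t]) V.

Definition hamilton_curve D p q U : Prop :=
  forall t, D t ->
    has_derivative D q t (along p q (\dp U) t) /\
    has_derivative D p t (- along p q (\dq U) t).

Definition constant_along D p q V : Prop :=
  exists c : K, forall t, D t -> along p q V t = c.

Definition vanishes_along D p q V : Prop :=
  forall t, D t -> along p q V t = 0.

End Curves.

(** * The Weierstrass elliptic function *)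

Section Weierstrass.
Variable R : realType.
Let C : numFieldType := R[i].
Definition lattice_basis (w1 w2 : C) : Prop :=
  forall x y : R, x%:C * w1 + y%:C * w2 = 0 -> x = 0 /\ y = 0.

Definition lattice_point (w1 w2 : C) (m : int * int) : C :=
  m.1%:~R * w1 + m.2%:~R * w2.

Definition in_lattice (w1 w2 z : C) : Prop := exists m, z = lattice_point w1 w2 m.

(* Unconditional sum of f over the nonzero points of the lattice. *)
Definition lattice_sum (w1 w2 : C) (f : C -> C) : C :=
  lim (partial_sum (fun m : int * int =>
         if m == (0, 0) then 0 else f (lattice_point w1 w2 m)) @ totally).

Definition lattice_g2 (w1 w2 : C) : C :=
  60%:R * lattice_sum w1 w2 (fun w => w ^- 4).

Definition lattice_g3 (w1 w2 : C) : C :=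
  140%:R * lattice_sum w1 w2 (fun w => w ^- 6).

Definition wp (w1 w2 z : C) : C :=
  z ^- 2 + lattice_sum w1 w2 (fun w => (z - w) ^- 2 - w ^- 2).

End Weierstrass.

(* [F] is t |-> wp (t + c), without meeting a pole, where wp has invariants
   [G2] and [G3]. *)
Definition weierstrass_wp_along (R : realType) (k : scalars)
    (D : set (field_of R k)) (p q : field_of R k -> field_of R k)
    (F G2 G3 : bipoly (field_of R k)) : Prop :=
  exists w1 w2 : R[i],
    [/\ lattice_basis w1 w2,
        lattice_g2 w1 w2 ^+ 3 - 27%:R * lattice_g3 w1 w2 ^+ 2 != 0,
        forall t, D t ->
          to_complex (along p q G2 t) = lattice_g2 w1 w2 /\
          to_complex (along p q G3 t) = lattice_g3 w1 w2 &
        exists c : R[i], forall t, D t ->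
          ~ in_lattice w1 w2 (to_complex t + c) /\
          to_complex (along p q F t) = wp w1 w2 (to_complex t + c)].

(* Main.v *)
Require Import Defs.
From HB Require Import structures.
From mathcomp Require Import all_boot all_order all_algebra.
From mathcomp Require Import finmap complex.
From mathcomp Require Import ring lra zify.
From mathcomp Require Import boolp classical_sets reals topology normedtype.
From mathcomp Require Import showcase.summability.
From mathcomp Require derive.
From mathcomp Require Import -(notations) mpoly.

Set Implicit Arguments.
Unset Strict Implicit.
Unset Printing Implicit Defensive.

Import Order.TTheory GRing.Theory Num.Theory numFieldNormedType.Exports.
Local Open Scope ring_scope.
Local Open Scope complex_scope.
Local Open Scope classical_set_scope.
#[local] Existing Instance totally_filter.

(** Along a Hamilton curve of U differentiation is the operator (U, _), so
    everything asserted about time derivatives is an assertion about Jacobians.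
    The Weierstrass equation is then a polynomial identity, the classical syzygy
    between the covariants of a quartic ([weierstrass_syzygy]): by Euler's
    identity U and its derivatives up to order three are written through the
    fourth derivatives exactly as for a quartic ([quartic_normal_form]). Since U
    is a nonzero constant along the curve, g2 and g3 are constant there exactly
    when S and T are, that is, when (U, S) and (U, T) vanish along it.

    A form that vanishes along the curve is zero ([quantic_vanish]): the two
    vectors (p, q) and (-U_q, U_p) are independent where U is nonzero, so both
    partial derivatives of the form vanish along the curve as well, and one
    descends to constants. In the proper case (U, S) and (U, T) are therefore
    zero as polynomials, and [covS_dichotomy] shows that S = 0 or (U, H) = 0: if
    S is nonzero, comparing the orders of vanishing of U(x, 1), S and T at a root
    leaves only the multiplicity N/2, so that U is a power of a form of degree at
    most two, for which H is a function of U. The second case is excluded when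
    Phi is nonconstant.

    It remains to solve Phi'^2 = 4 Phi^3 - g3 with g3 nonzero. A hexagonal
    lattice has g2 = 0 by symmetry, and its g3 takes every nonzero value by
    scaling ([hexagonal_lattice_g3]). Its function wp satisfies the same equation
    and takes every value, by a Liouville theorem for the lattice
    ([lattice_liouville]) proved with the maximum principle on second order
    Taylor expansions instead of complex integration. So some wp (t + c) has the
    same value and derivative as Phi at one time, and it agrees with Phi on the
    whole time domain ([wpz_continuation]): two solutions that agree at a point
    agree near it, by an algebraic first integral related to the addition theorem
    ([weierstrass_system_unique]), and Phi stays bounded where wp would have a
    pole.

    Real intervals and complex domains are treated together, the scalar field
    being embedded in the complex numbers ([good_domain]). *)

(** * Binary forms, the Jacobian and Euler's identity *)

Lemma eq_of_sub (V : zmodType) (a b c d : V) : c = d -> a - b = c - d -> a = b.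
Proof. by move=> -> /eqP; rewrite subrr subr_eq0 => /eqP. Qed.

Lemma mnm_sub1 (i : 'I_2) : mnm_sub (mnm1 i) (mnm1 i) = mnm0.
Proof. by apply/mnmP => j; rewrite mnmBE mnm0E subnn. Qed.

Section Forms.
Variable K : numFieldType.
Implicit Types (U V W : bipoly K) (d N M : nat).

Definition pX : bipoly K := mpolyX K (mnm1 ord0).
Definition qX : bipoly K := mpolyX K (mnm1 ord_max).

Lemma bipoly_ind (P : bipoly K -> Prop) :
  (forall c, P (mpolyC 2 c)) -> P pX -> P qX ->
  (forall V W, P V -> P W -> P (V + W)) ->
  (forall V W, P V -> P W -> P (V * W)) -> forall V, P V.
Proof.
move=> PC Pp Pq PD PM; apply: mpolyind => [|c m V _ _ PV].
  by rewrite -mpolyC0; exact: PC.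
apply: (PD) => //; rewrite -mul_mpolyC; apply: (PM); first exact: PC.
have PXn (X : bipoly K) k : P X -> P (X ^+ k).
  move=> PX; elim: k => [|k IH]; first by rewrite expr0 -mpolyC1.
  by rewrite exprS; apply: PM.
rewrite mpolyXE_id !big_ord_recl big_ord0 mulr1.
have <- : ord_max = lift ord0 ord0 :> 'I_2 by apply: val_inj.
by apply: PM; apply: PXn.
Qed.

Lemma mulX_mderivX (i : 'I_2) (m : multinom 2) :
  mpolyX K (mnm1 i) * mderiv i (mpolyX K m) = mpolyX K m *+ m i.
Proof.
rewrite mderivX -scalerAr -mpolyXD -[RHS]scaler_nat.
have [->|mi0] := eqVneq (m i) 0%N; first by rewrite !scale0r.
congr (_ *: mpolyX K _); rewrite addmC submK //.
apply/mnm_lepP => l; rewrite mnm1E.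
by case: (i =P l) => // <-; rewrite lt0n.
Qed.

Lemma mdeg_quantic d V m : quantic d V -> m \in msupp V -> mdeg m = d.
Proof. by move=> /dhomogP h /h. Qed.

Lemma euler d V : quantic d V -> pX * \dp V + qX * \dq V = V *+ d.
Proof.
move=> hV; rewrite {1 2}(mpolyE V) [in RHS](mpolyE V) !linear_sum.
rewrite !mulr_sumr -big_split /= -sumrMnl big_seq [RHS]big_seq.
apply: eq_bigr => m /(mdeg_quantic hV) hm; rewrite !mderivZ -!scalerAr !mulX_mderivX.
rewrite -scalerDr -mulrnDr -hm mdegE !big_ord_recl big_ord0 addn0 scalerMnr.
by have -> : lift ord0 ord0 = ord_max :> 'I_2 by apply: val_inj.
Qed.

Lemma quantic_mderiv d V (i : 'I_2) : quantic d V -> quantic d.-1 (mderiv i V).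
Proof.
move=> hV; rewrite /quantic (mpolyE V) linear_sum big_seq.
apply: rpred_sum => m /(mdeg_quantic hV) hm /=; rewrite mderivZ mderivX; apply: rpredZ.
have [->|mi0] := eqVneq (m i) 0%N; first by rewrite scale0r rpred0.
apply: rpredZ; rewrite dhomogX -hm; apply/eqP.
change (mdeg (mnm_sub m (mnm1 i)) = (mdeg m).-1).
have {2}-> : m = mnm_add (mnm_sub m (mnm1 i)) (mnm1 i).
  rewrite submK //; apply/mnm_lepP => l; rewrite mnm1E.
  by case: (i =P l) => // <-; rewrite lt0n.
by rewrite mdegD mdeg1 addn1.
Qed.

Lemma quantic0C V : quantic 0 V -> exists c, V = mpolyC 2 c.
Proof.
move=> hV; exists (mcoeff (@mnm0 2) V); apply/mpolyP => m.
rewrite mcoeffC; have [<-|m0] := eqVneq (@mnm0 2) m; first by rewrite mulr1.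
rewrite mulr0; apply/eqP; rewrite mcoeff_eq0; apply/negP => /(mdeg_quantic hV)/eqP.
by rewrite mdeg_eq0 eq_sym (negPf m0).
Qed.

Lemma mpoly_natS_neq0 d : (d.+1%:R : bipoly K) != 0.
Proof. by rewrite -mpolyC_nat mpolyC_eq0 pnatr_eq0. Qed.

(** Differentiation lowers the degree, so a form with a property that is inherited
    by the partial derivatives vanishes once this is known of constants. *)
Lemma quantic_eq0_ind (P : bipoly K -> Prop) :
  (forall c, P (mpolyC 2 c) -> c = 0) ->
  (forall d V, quantic d.+1 V -> P V -> P (\dp V) /\ P (\dq V)) ->
  forall d V, quantic d V -> P V -> V = 0.
Proof.
move=> PC PD; elim=> [|d IH] V hV PV.
  by have [c Vc] := quantic0C hV; move: PV; rewrite Vc => /PC ->; rewrite mpolyC0.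
have [Pp Pq] := PD _ _ hV PV.
have e := euler hV.
have p0 : \dp V = 0 by apply: IH => //; exact: (quantic_mderiv ord0 hV).
have q0 : \dq V = 0 by apply: IH => //; exact: (quantic_mderiv ord_max hV).
move: e; rewrite p0 q0 !mulr0 addr0 => /esym/eqP.
by rewrite -mulr_natr mulf_eq0 (negPf (mpoly_natS_neq0 d)) orbF => /eqP.
Qed.

End Forms.

Section Jacobian.
Variable K : numFieldType.
Implicit Types (U V W : bipoly K).

Lemma jacobianD U V W : jacobian U (V + W) = jacobian U V + jacobian U W.
Proof. by rewrite /jacobian !mderivD; ring. Qed.

Lemma jacobianM U V W : jacobian U (V * W) = jacobian U V * W + V * jacobian U W.
Proof. by rewrite /jacobian !mderivM; ring. Qed.

Lemma jacobianZ U c V : jacobian U (c *: V) = c *: jacobian U V.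
Proof.
by rewrite -!mul_mpolyC jacobianM /jacobian !mderivC !mulr0 subrr mul0r add0r.
Qed.

Lemma jacobian_self U : jacobian U U = 0.
Proof. by rewrite /jacobian mulrC subrr. Qed.

Lemma jacobian_expZ U c n V :
  jacobian U ((c *: U) ^+ n * V) = (c *: U) ^+ n * jacobian U V.
Proof.
rewrite jacobianM; suff -> : jacobian U ((c *: U) ^+ n) = 0 by rewrite mul0r add0r.
elim: n => [|n IH]; first by rewrite expr0 /jacobian !mderivC !mulr0 subrr.
by rewrite exprS jacobianM IH jacobianZ jacobian_self scaler0 mul0r mulr0 addr0.
Qed.

(** Apply (U, _) to the equation and cancel (U, W). *)
Lemma jacobian_weierstrass U W G : jacobian U W ^+ 2 = 4%:R * W ^+ 3 - G ->
  jacobian U G = 0 -> jacobian U W != 0 ->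
  jacobian U (jacobian U W) = 6%:R * W ^+ 2.
Proof.
have [V eV] : exists V, jacobian U W = V by exists (jacobian U W).
rewrite eV => e JG V0.
have n20 : (2%:R : bipoly K) != 0.
  by rewrite -(rmorph_nat (@mpolyC 2 K)) mpolyC_eq0 pnatr_eq0.
apply: (mulfI n20); apply: (mulfI V0).
have JX Z n : jacobian U (Z ^+ n.+1) = n.+1%:R * Z ^+ n * jacobian U Z.
  elim: n => [|n IH]; first by rewrite expr1 mul1r expr0 mul1r.
  by rewrite exprS jacobianM IH exprS -[n.+2%:R]natr1; ring.
have e' : jacobian U (V ^+ 2) = 4%:R * jacobian U (W ^+ 3) - jacobian U G.
  by rewrite e -scaleN1r jacobianD mulr_natl -scaler_nat !jacobianZ scaleN1r scaler_nat mulr_natl.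
by move: e'; rewrite JG !JX eV => e'; apply: (eq_of_sub e'); ring.
Qed.

Variables (p q : K -> K).

Lemma alongD V W t : along p q (V + W) t = along p q V t + along p q W t.
Proof. by rewrite /along mevalD. Qed.

Lemma alongN V t : along p q (- V) t = - along p q V t.
Proof. by rewrite /along mevalN. Qed.

Lemma alongM V W t : along p q (V * W) t = along p q V t * along p q W t.
Proof. by rewrite /along mevalM. Qed.

Lemma alongX V n t : along p q (V ^+ n) t = along p q V t ^+ n.
Proof. by rewrite /along rmorphXn. Qed.

Lemma alongZ c V t : along p q (c *: V) t = c * along p q V t.
Proof. by rewrite /along mevalZ. Qed.

Lemma along0 t : along p q 0 t = 0.
Proof. by rewrite /along meval0. Qed.

Lemma along_nat n t : along p q n%:R t = n%:R.
Proof. by rewrite /along rmorph_nat. Qed.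

Definition alongE := (along_nat, alongX, alongD, alongN, alongM, alongZ).

Lemma along_weierstrass V W G2 G3 t :
  V ^+ 2 = 4%:R * W ^+ 3 - G2 * W - G3 ->
  along p q V t ^+ 2 = 4%:R * along p q W t ^+ 3 - along p q G2 t * along p q W t
                       - along p q G3 t.
Proof.
by move=> e; rewrite -alongX e !alongE.
Qed.

End Jacobian.

(** * The syzygy of the covariants *)

Section Covs.
Variable K : numFieldType.
Implicit Types (U V W : bipoly K) (d N M : nat).

Notation pX := (pX K).
Notation qX := (qX K).
Notation C := (mpolyC 2 (R := K)).

(** The coefficient s is kept apart, as it is a product of falling factors of the
    degree that loses one factor at each integration. *)
Lemma quantic_lift d V (s : K) (x y : bipoly K) : quantic d.+1 V ->
  \dp V = C s * x -> \dq V = C s * y -> V = C (s / d.+1%:R) * (pX * x + qX * y).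
Proof.
move=> hV hp hq; have := euler hV; rewrite hp hq => e.
rewrite rmorphM /= mulrAC mulrDr !(mulrCA (C s)) e -[V *+ _]mulr_natr -mulrA.
by rewrite -mpolyC_nat -rmorphM /= mulfV ?pnatr_eq0 // mpolyC1 mulr1.
Qed.

(** By Euler, a form and its derivatives up to order three are recovered from
    the fourth derivatives as if the form were a binary quartic, with the
    fourth derivatives as coefficients: each of the five levels below follows from
    the next one, integrating by [quantic_lift]. *)
Lemma quartic_normal_form N U : (3 < N)%N -> quantic N U ->
  let n := N%:R : K in
  exists a b c d e : bipoly K,
  [/\ U = pX ^+ 4 * a + 4%:R * pX ^+ 3 * qX * b + 6%:R * pX ^+ 2 * qX ^+ 2 * c
         + 4%:R * pX * qX ^+ 3 * d + qX ^+ 4 * e,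
      [/\ \dp U = C n *
         (pX ^+ 3 * a + 3%:R * pX ^+ 2 * qX * b + 3%:R * pX * qX ^+ 2 * c + qX ^+ 3 * d) &
          \dq U = C n *
         (pX ^+ 3 * b + 3%:R * pX ^+ 2 * qX * c + 3%:R * pX * qX ^+ 2 * d + qX ^+ 3 * e)],
      [/\ \dp \dp U = C (n * (n - 1)) * (pX ^+ 2 * a + 2%:R * pX * qX * b + qX ^+ 2 * c),
          \dq \dp U = C (n * (n - 1)) * (pX ^+ 2 * b + 2%:R * pX * qX * c + qX ^+ 2 * d) &
          \dq \dq U = C (n * (n - 1)) * (pX ^+ 2 * c + 2%:R * pX * qX * d + qX ^+ 2 * e)],
      [/\ \dp \dp \dp U = C (n * (n - 1) * (n - 2%:R)) * (pX * a + qX * b),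
          \dq \dp \dp U = C (n * (n - 1) * (n - 2%:R)) * (pX * b + qX * c),
          \dq \dq \dp U = C (n * (n - 1) * (n - 2%:R)) * (pX * c + qX * d) &
          \dq \dq \dq U = C (n * (n - 1) * (n - 2%:R)) * (pX * d + qX * e)] &
      [/\ \dp \dp \dp \dp U = C (quartic_factor K N) * a,
          \dq \dp \dp \dp U = C (quartic_factor K N) * b,
          \dq \dq \dp \dp U = C (quartic_factor K N) * c,
          \dq \dq \dq \dp U = C (quartic_factor K N) * d &
          \dq \dq \dq \dq U = C (quartic_factor K N) * e]].
Proof.
case: N => [|[|[|[|M]]]] // _ hU n.
have en3 : n - 3%:R = M.+1%:R by rewrite /n -natrB.
have en2 : n - 2%:R = M.+2%:R by rewrite /n -natrB.
have en1 : n - 1 = M.+3%:R by rewrite /n -[1]/1%:R -natrB.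
set f := quartic_factor _ _.
have f0 : f != 0.
  by rewrite /f /quartic_factor -/n en1 en2 en3 !mulf_neq0 ?pnatr_eq0.
have fK V : V = C f * (C f^-1 * V).
  by rewrite mulrA -rmorphM /= mulfV // mpolyC1 mul1r.
have D2 (i j : 'I_2) : quantic M.+2 (mderiv i (mderiv j U)).
  exact: (quantic_mderiv i (quantic_mderiv j hU)).
have D3 (i j k : 'I_2) : quantic M.+1 (mderiv i (mderiv j (mderiv k U))).
  exact: (quantic_mderiv i (D2 j k)).
have D1 (i : 'I_2) : quantic M.+3 (mderiv i U) := quantic_mderiv i hU.
set e3 := n * (n - 1) * (n - 2%:R); set e2 := n * (n - 1).
have ef : f / M.+1%:R = e3.
  by rewrite /f /quartic_factor -/n -/e3 en3 mulfK ?pnatr_eq0.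
have ee3 : e3 / M.+2%:R = e2 by rewrite /e3 en2 mulfK ?pnatr_eq0.
have ee2 : e2 / M.+3%:R = n by rewrite /e2 en1 mulfK ?pnatr_eq0.
have fE V : exists x, V = C f * x by exists (C f^-1 * V).
have [a ea] := fE (\dp \dp \dp \dp U); have [b eb] := fE (\dq \dp \dp \dp U).
have [c ec] := fE (\dq \dq \dp \dp U); have [d ed] := fE (\dq \dq \dq \dp U).
have [e ee] := fE (\dq \dq \dq \dq U); exists a, b, c, d, e.
have lift3 V x y : quantic M.+1 V -> \dp V = C f * x -> \dq V = C f * y ->
    V = C e3 * (pX * x + qX * y).
  by rewrite -ef; exact: quantic_lift.
have t1 : \dp \dp \dp U = C e3 * (pX * a + qX * b).
  exact: lift3 (D3 _ _ _) ea eb.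
have t2 : \dq \dp \dp U = C e3 * (pX * b + qX * c).
  by apply: lift3 (D3 _ _ _) _ ec; rewrite mderiv_comm.
have t3 : \dq \dq \dp U = C e3 * (pX * c + qX * d).
  by apply: lift3 (D3 _ _ _) _ ed; rewrite mderiv_comm (mderiv_comm ord_max ord0 (\dp U)).
have t4 : \dq \dq \dq U = C e3 * (pX * d + qX * e).
  apply: lift3 (D3 _ _ _) _ ee; rewrite mderiv_comm.
  by rewrite (mderiv_comm ord_max ord0 (\dq U)) (mderiv_comm ord_max ord0 U).
have s1 : \dp \dp U = C e2 * (pX ^+ 2 * a + 2%:R * pX * qX * b + qX ^+ 2 * c).
  have := quantic_lift (D2 _ _) t1 t2; rewrite ee3 => ->; congr (_ * _); ring.
have s2 : \dq \dp U = C e2 * (pX ^+ 2 * b + 2%:R * pX * qX * c + qX ^+ 2 * d).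
  have t2' : \dp (\dq \dp U) = C e3 * (pX * b + qX * c) by rewrite mderiv_comm.
  have := quantic_lift (D2 _ _) t2' t3; rewrite ee3 => ->; congr (_ * _); ring.
have s3 : \dq \dq U = C e2 * (pX ^+ 2 * c + 2%:R * pX * qX * d + qX ^+ 2 * e).
  have t3' : \dp (\dq \dq U) = C e3 * (pX * c + qX * d).
    by rewrite mderiv_comm (mderiv_comm ord_max ord0 U).
  have := quantic_lift (D2 _ _) t3' t4; rewrite ee3 => ->; congr (_ * _); ring.
have r1 : \dp U = C n *
   (pX ^+ 3 * a + 3%:R * pX ^+ 2 * qX * b + 3%:R * pX * qX ^+ 2 * c + qX ^+ 3 * d).
  have := quantic_lift (D1 _) s1 s2; rewrite ee2 => ->; congr (_ * _); ring.
have r2 : \dq U = C n *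
   (pX ^+ 3 * b + 3%:R * pX ^+ 2 * qX * c + 3%:R * pX * qX ^+ 2 * d + qX ^+ 3 * e).
  have s2' : \dp (\dq U) = C e2 * (pX ^+ 2 * b + 2%:R * pX * qX * c + qX ^+ 2 * d).
    by rewrite mderiv_comm.
  have := quantic_lift (D1 _) s2' s3; rewrite ee2 => ->; congr (_ * _); ring.
split=> //.
have := quantic_lift hU r1 r2; rewrite /n mulfV ?pnatr_eq0 // mpolyC1 => ->; ring.
Qed.

Lemma mpolyC_mulX1 (x y : K) k : x * y ^+ k = 1 -> C x * C y ^+ k = 1.
Proof.
by move=> /(congr1 (@mpolyC 2 K)); rewrite rmorphM rmorphXn /= mpolyC1.
Qed.

Let eq_mul1 (z x y : bipoly K) : z = 1 -> x = z * y -> x = y.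
Proof. by move=> ->; rewrite mul1r. Qed.

Lemma natr_sub_neq0 N k : (k < N)%N -> (N%:R : K) - k%:R != 0.
Proof. by move=> kN; rewrite -natrB ?(ltnW kN) // pnatr_eq0 subn_eq0 -ltnNge. Qed.

Lemma quartic_factor_neq0 N : (3 < N)%N -> quartic_factor K N != 0.
Proof.
move=> N3; have := natr_sub_neq0 (ltnW (ltnW (ltnW N3))).
have := natr_sub_neq0 (ltnW (ltnW N3)); have := natr_sub_neq0 (ltnW N3).
by have := natr_sub_neq0 N3; rewrite subr0 /quartic_factor => *; rewrite !mulf_neq0.
Qed.

Lemma covSE N U (a b c d e : bipoly K) : (3 < N)%N ->
  [/\ \dp \dp \dp \dp U = C (quartic_factor K N) * a,
      \dq \dp \dp \dp U = C (quartic_factor K N) * b,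
      \dq \dq \dp \dp U = C (quartic_factor K N) * c,
      \dq \dq \dq \dp U = C (quartic_factor K N) * d &
      \dq \dq \dq \dq U = C (quartic_factor K N) * e] ->
  covS N U = a * e - 4%:R * b * d + 3%:R * c ^+ 2 /\
  covT N U = a * c * e + 2%:R * b * c * d - a * d ^+ 2 - b ^+ 2 * e - c ^+ 3.
Proof.
move=> /quartic_factor_neq0 f_neq0 [f0 f1 f2 f3 f4]; split.
  rewrite /covS f0 f1 f2 f3 f4 -mul_mpolyC.
  have e1 : C ((quartic_factor K N ^+ 2)^-1) * C (quartic_factor K N) ^+ 2 = 1.
    by apply: mpolyC_mulX1; field.
  apply: (eq_mul1 e1); ring.
rewrite /covT f0 f1 f2 f3 f4 -mul_mpolyC.
have e1 : C ((quartic_factor K N ^+ 3)^-1) * C (quartic_factor K N) ^+ 3 = 1.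
  by apply: mpolyC_mulX1; field.
apply: (eq_mul1 e1); ring.
Qed.

Lemma hessianE N U (x y z : bipoly K) : (1 < N)%N ->
  let n := N%:R : K in
  [/\ \dp \dp U = C (n * (n - 1)) * x, \dq \dp U = C (n * (n - 1)) * y &
      \dq \dq U = C (n * (n - 1)) * z] -> hessian N U = x * z - y ^+ 2.
Proof.
move=> N1 n [p2 m2 q2]; rewrite /hessian p2 m2 q2 -mul_mpolyC.
have n0 : n != 0 by have := natr_sub_neq0 (ltnW N1); rewrite subr0.
have n1 : n - 1 != 0 := natr_sub_neq0 N1.
have e1 : C ((n ^+ 2 * (n - 1) ^+ 2)^-1) * C (n * (n - 1)) ^+ 2 = 1.
  by apply: mpolyC_mulX1; field; rewrite n1 n0.
apply: (eq_mul1 e1); rewrite -/n; ring.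
Qed.

(** The classical syzygy G^2 = -4 H^3 + U^2 H S - U^3 T of the binary quartic,
    where G is the Jacobian of U and H up to a factor. In the normal form it is a
    polynomial identity in p, q, the five coefficients and two scalars. *)
Lemma weierstrass_syzygy N U : (3 < N)%N -> quantic N U ->
  jacobian U (Phi N U) ^+ 2 =
  4%:R * Phi N U ^+ 3 - g2 N U * Phi N U - g3 N U.
Proof.
move=> N3 hU; have [a [b [c [d [e]]]]] := quartic_normal_form N3 hU.
set n := (N%:R : K).
move=> [eU [p1 q1] [p2 m2 q2] [t0 t1 t2 t3] [f0 f1 f2 f3 f4]].
have n0 : n != 0 by have := natr_sub_neq0 (ltnW (ltnW (ltnW N3))); rewrite subr0.
have n1 : n - 1 != 0 := natr_sub_neq0 (ltnW (ltnW N3)).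
set X2 := (pX ^+ 2 * a + 2%:R * pX * qX * b + qX ^+ 2 * c) in p2.
set Y2 := (pX ^+ 2 * b + 2%:R * pX * qX * c + qX ^+ 2 * d) in m2.
set Z2 := (pX ^+ 2 * c + 2%:R * pX * qX * d + qX ^+ 2 * e) in q2.
have eH : hessian N U = X2 * Z2 - Y2 ^+ 2 by exact: hessianE (ltnW (ltnW N3)) (And3 p2 m2 q2).
have [eS eT] := covSE N3 (And5 f0 f1 f2 f3 f4).
have e23 : C (n * (n - 1) * (n - 2%:R)) = C (n * (n - 1)) * C (n - 2%:R).
  by rewrite -mpolyCM.
have dH (i : 'I_2) : mderiv i (hessian N U) =
   C ((n ^+ 2 * (n - 1) ^+ 2)^-1) *
   (mderiv i (\dp \dp U) * \dq \dq U + \dp \dp U * mderiv i (\dq \dq U)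
      - 2%:R * \dq \dp U * mderiv i (\dq \dp U)).
  by rewrite /hessian mderivZ -mul_mpolyC mderivB expr2 !mderivM; ring.
have cst : C ((n ^+ 2 * (n - 1) ^+ 2)^-1) * C (n * (n - 1)) ^+ 2 = 1.
  by apply: mpolyC_mulX1; field; rewrite n1 n0.
have dpH : \dp (hessian N U) = C (n - 2%:R) *
   ((pX * a + qX * b) * Z2 + X2 * (pX * c + qX * d) - 2%:R * Y2 * (pX * b + qX * c)).
  rewrite dH (mderiv_comm ord_max ord0 (\dp U)) t1 t0.
  rewrite (mderiv_comm ord_max ord0 (\dq U)) (mderiv_comm ord_max ord0 U) t2 p2 q2 m2 e23.
  apply: (eq_mul1 cst); ring.
have dqH : \dq (hessian N U) = C (n - 2%:R) *
   ((pX * b + qX * c) * Z2 + X2 * (pX * d + qX * e) - 2%:R * Y2 * (pX * c + qX * d)).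
  rewrite dH t1 t2 t3 p2 q2 m2 e23.
  apply: (eq_mul1 cst); ring.
rewrite /jacobian /Phi /g2 /g3 -/n !mderivN.
rewrite (mderivZ ord0 _ (hessian N U)) (mderivZ ord_max _ (hessian N U)) dpH dqH eH p1 q1 eS eT eU.
rewrite -!mul_mpolyC !(rmorphM, rmorphXn) /= /X2 /Y2 /Z2.
move: (C n) (C (n - 2%:R)) => x y; clear; ring.
Qed.

End Covs.

(** * Forms whose invariants S and T are functions of the form *)

Section Univariate.
Variable F : numClosedFieldType.
Implicit Types (u v p r : {poly F}) (a c : F).

(** The operator (x - a) d/dx multiplies (x - a)^m by m; this form of the product
    rule makes sense for m = 0. *)
Lemma mulX_derivMXn p a m : let X := 'X - a%:P in
  X * (p * X ^+ m)^`() = (m%:R * p + X * p^`()) * X ^+ m.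
Proof.
move=> X; rewrite derivM deriv_exp derivXsubC.
by case: m => [|m] /=; rewrite ?mulr0n ?exprS; ring.
Qed.

Lemma XsubC_expI (a : F) m : injective (fun p : {poly F} => p * ('X - a%:P) ^+ m).
Proof. by apply: mulIf; rewrite expf_neq0 // polyXsubC_eq0. Qed.

(** Compare the lowest coefficients at a in (x - a) c1 p' r = (x - a) c2 p r', where p
    and r vanish at a to the orders m and k. *)
Lemma order_logder p r v s a m k (c1 c2 : F) : let X := 'X - a%:P in
  p = v * X ^+ m -> r = s * X ^+ k -> ~~ root v a -> ~~ root s a ->
  c1%:P * (p^`() * r) = c2%:P * (p * r^`()) -> c1 * m%:R = c2 * k%:R.
Proof.
move=> X ep er va sa e.
have : c1%:P * ((m%:R * v + X * v^`()) * s) = c2%:P * (v * (k%:R * s + X * s^`())).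
  apply: (@XsubC_expI a (m + k)); rewrite /= exprD -/X.
  have := mulX_derivMXn v a m; have := mulX_derivMXn s a k.
  rewrite /= -/X -er -ep => e2 e1.
  transitivity (X * (c1%:P * (p^`() * r))).
    transitivity (c1%:P * (((m%:R * v + X * v^`()) * X ^+ m) * r)); last first.
      by rewrite -e1; ring.
    by rewrite er; ring.
  rewrite e; transitivity (c2%:P * (p * ((k%:R * s + X * s^`()) * X ^+ k))).
    by rewrite -e2; ring.
  by rewrite ep; ring.
move=> /(congr1 (horner^~ a)); rewrite !hornerE /= !hornerMn /X !hornerE.
rewrite subrr !mul0r !addr0 => h.
apply: (@mulIf _ (v.[a] * s.[a])); first by rewrite mulf_neq0.
by apply: (eq_of_sub h); ring.
Qed.

Lemma hornerXsubCn (a : F) p m : (0 < m)%N -> (p * ('X - a%:P) ^+ m).[a] = 0.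
Proof. by case: m => // m _; rewrite exprS mulrCA !hornerM hornerXsubC subrr !mul0r. Qed.

Lemma derivMXsubC p a : (p * ('X - a%:P) ^+ 1)^`().[a] = p.[a].
Proof.
rewrite expr1 derivM derivXsubC mulr1 hornerD hornerM hornerXsubC subrr.
by rewrite mulr0 add0r.
Qed.

Lemma XsubC_exp_le (a : F) p r m k : ~~ root p a ->
  p * ('X - a%:P) ^+ k = r * ('X - a%:P) ^+ m ->
  (m <= k)%N /\ ((m < k)%N -> r.[a] = 0).
Proof.
move=> pa e; split=> [|mk].
  rewrite leqNgt; apply/negP => km; move/negP: pa; apply; apply/eqP.
  suff -> : p = r * ('X - a%:P) ^+ (m - k) by rewrite hornerXsubCn ?subn_gt0.
  apply: (@XsubC_expI a k) => /=.
  by rewrite e -mulrA -exprD subnK // ltnW.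
suff -> : r = p * ('X - a%:P) ^+ (k - m) by rewrite hornerXsubCn ?subn_gt0.
apply: (@XsubC_expI a m) => /=.
by rewrite -e -mulrA -exprD subnK // ltnW.
Qed.

Lemma poly_natS_neq0 k : (k.+1%:R : {poly F}) != 0.
Proof. by rewrite -polyC_natr polyC_eq0 pnatr_eq0. Qed.

(* Here N = M + 4, and b_k is U(x, 1) differentiated k times and divided by
   N (N - 1) ... (N - k + 1); S, T and H are the covariants in these terms. The
   hypotheses hS and hT say that S^N and T^N are constant multiples of
   b0^(2 N - 8) and b0^(3 N - 12). *)
Variables (M : nat) (b0 b1 b2 b3 b4 : {poly F}).
Hypothesis M0 : (0 < M)%N.
Hypothesis d0 : b0^`() = M.+4%:R * b1.
Hypothesis d1 : b1^`() = M.+3%:R * b2.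
Hypothesis d2 : b2^`() = M.+2%:R * b3.
Hypothesis d3 : b3^`() = M.+1%:R * b4.
Hypothesis size_b0 : (size b0 <= M.+4.+1)%N.

Let S := b0 * b4 - 4%:R * b1 * b3 + 3%:R * b2 ^+ 2.
Let T := b0 * b2 * b4 + 2%:R * b1 * b2 * b3 - b0 * b3 ^+ 2 - b1 ^+ 2 * b4 - b2 ^+ 3.
Let H := b0 * b2 - b1 ^+ 2.
Hypothesis hS : (2 * M)%:R%:P * (b0^`() * S) = (M.+4)%:R%:P * (b0 * S^`()).
Hypothesis hT : (3 * M)%:R%:P * (b0^`() * T) = (M.+4)%:R%:P * (b0 * T^`()).
Hypothesis S0 : S != 0.

(** Differentiation lowers an order of vanishing by at most one. The cofactors z and w
    are related at a as for powers of X, where x and y are multiples of X^(m - j) and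
    X^(m - j - 1). *)
Lemma weight_step k (j : nat) (x y z : {poly F}) a m : let X := 'X - a%:P in
  x^`() = k.+1%:R * y -> x * X ^+ j = z * X ^+ m ->
  exists2 w, y * X ^+ j.+1 = w * X ^+ m &
     w.[a] = (m%:R - j%:R) / k.+1%:R * z.[a].
Proof.
move=> X exy exz.
exists (k.+1%:R^-1%:P * ((m%:R - j%:R) * z + X * z^`())); last first.
  by rewrite !hornerE /= !hornerMn /X !hornerE subrr mul0r addr0; ring.
have h := mulX_derivMXn z a m; have h' := mulX_derivMXn x a j.
rewrite /= -/X exz h in h'.
apply: (mulfI (poly_natS_neq0 k)).
have e1 : k.+1%:R * k.+1%:R^-1%:P = 1 :> {poly F}.
  by rewrite -polyC_natr -rmorphM /= mulfV ?pnatr_eq0.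
transitivity (X * x^`() * X ^+ j); first by rewrite exy exprS; ring.
transitivity ((k.+1%:R * k.+1%:R^-1%:P) * ((m%:R - j%:R) * z + X * z^`()) * X ^+ m).
  rewrite e1 mul1r.
  transitivity ((m%:R * z + X * z^`()) * X ^+ m - j%:R * (z * X ^+ m)); last by ring.
  by rewrite h' -exz; ring.
ring.
Qed.

(** Every root of b0 has multiplicity N / 2. Let m be the multiplicity of a, and s
    the order of S at a, so that N s = (2 N - 8) m. Each (x - a)^k b_k is divisible
    by (x - a)^m, hence (x - a)^4 S by (x - a)^(2 m), which gives m <= N / 2. If m < N / 2,
    then the orders of S and T exceed 2 m - 4 and 3 m - 6, so S and T of the
    quartic with the leading coefficients of the (x - a)^k b_k are zero; by the
    syzygy G^2 = -4 H^3 for these coefficients, m is 1, N - 1 or N, hence 1. Then s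
    is 1 as s = 2 - 8 / N; but S and T vanish at a and b1 does not, and an identity
    between S', S and T at a makes S' vanish there too. *)
Lemma root_multiplicity a : root b0 a -> forall m v, b0 = v * ('X - a%:P) ^+ m ->
  ~~ root v a -> m.*2 = M.+4.
Proof.
move=> ra m v e0 va; set X := 'X - a%:P in e0.
have m0 : (0 < m)%N.
  by case: m e0 => // e0; move: ra; rewrite e0 expr0 mulr1 (negPf va).
have [s [sig]] := multiplicity_XsubC S a; rewrite S0 /= -/X => sa es.
have ns := order_logder e0 es va sa hS.
have {}ns : (2 * M * m = M.+4 * s)%N by apply/eqP; rewrite -(eqr_nat F) !natrM -ns natrM.
have e0' : b0 * X ^+ 0 = v * X ^+ m by rewrite expr0 mulr1.
have [w1 e1 v1] := weight_step d0 e0'.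
have [w2 e2 v2] := weight_step d1 e1.
have [w3 e3 v3] := weight_step d2 e2.
have [w4 e4 v4] := weight_step d3 e3.
rewrite -/X in e1 e2 e3 e4.
have eSw : sig * X ^+ (s + 4) = (v * w4 - 4%:R * w1 * w3 + 3%:R * w2 ^+ 2) * X ^+ (2 * m).
  rewrite exprD mulrA -es /S.
  transitivity ((b0 * X ^+ 0) * (b4 * X ^+ 4) - 4%:R * (b1 * X ^+ 1) * (b3 * X ^+ 3)
     + 3%:R * (b2 * X ^+ 2) ^+ 2); first by ring.
  by rewrite e0' e1 e2 e3 e4 mulnC exprM; ring.
have [le Sw] := XsubC_exp_le sa eSw.
have m2 : (m.*2 <= M.+4)%N by nia.
have [//|m2'] : m.*2 = M.+4 \/ (m.*2 < M.+4)%N by lia.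
have {}Sw : (v * w4 - 4%:R * w1 * w3 + 3%:R * w2 ^+ 2).[a] = 0 by apply: Sw; nia.
have Tw : (v * w2 * w4 + 2%:R * w1 * w2 * w3 - v * w3 ^+ 2 - w1 ^+ 2 * w4 - w2 ^+ 3).[a] = 0
       /\ T.[a] = 0.
  have eTw : T * X ^+ 6 = (v * w2 * w4 + 2%:R * w1 * w2 * w3 - v * w3 ^+ 2
       - w1 ^+ 2 * w4 - w2 ^+ 3) * X ^+ (3 * m).
    rewrite /T.
    transitivity ((b0 * X ^+ 0) * (b2 * X ^+ 2) * (b4 * X ^+ 4)
     + 2%:R * (b1 * X ^+ 1) * (b2 * X ^+ 2) * (b3 * X ^+ 3)
     - (b0 * X ^+ 0) * (b3 * X ^+ 3) ^+ 2 - (b1 * X ^+ 1) ^+ 2 * (b4 * X ^+ 4)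
     - (b2 * X ^+ 2) ^+ 3); first by ring.
    by rewrite e0' e1 e2 e3 e4 mulnC exprM; ring.
  have [T0|T0] := eqVneq T 0.
    split; last by rewrite T0 horner0.
    have -> : v * w2 * w4 + 2%:R * w1 * w2 * w3 - v * w3 ^+ 2 - w1 ^+ 2 * w4 - w2 ^+ 3 = 0.
      by apply: (@XsubC_expI a (3 * m)); rewrite /= -/X -eTw T0 !mul0r.
    by rewrite horner0.
  have [t [tau]] := multiplicity_XsubC T a; rewrite T0 /= -/X => ta et.
  have nt := order_logder e0 et va ta hT.
  have {}nt : (3 * M * m = M.+4 * t)%N by apply/eqP; rewrite -(eqr_nat F) !natrM -nt natrM.
  split; last by rewrite et hornerXsubCn //; nia.
  rewrite et -[_ * _ * X ^+ 6]mulrA -exprD in eTw.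
  by apply: (XsubC_exp_le ta eTw).2; nia.
case: Tw => Tw Ta.
have m1 : m = 1%N.
  have n4 : (M.+4%:R : F) != 0 by rewrite pnatr_eq0.
  have n3 : (M.+3%:R : F) != 0 by rewrite pnatr_eq0.
  have n2 : (M.+2%:R : F) != 0 by rewrite pnatr_eq0.
  have n1 : (M.+1%:R : F) != 0 by rewrite pnatr_eq0.
  have va' : v.[a] != 0 by [].
  set w := v.[a] in va'; set x := (m%:R : F); set y := (M%:R : F).
  have y4 : M.+4%:R = y + 4%:R :> F by rewrite /y; ring.
  have y3 : M.+3%:R = y + 3%:R :> F by rewrite /y; ring.
  have y2 : M.+2%:R = y + 2%:R :> F by rewrite /y; ring.
  have y1 : M.+1%:R = y + 1 :> F by rewrite /y; ring.
  rewrite y4 in n4 v1; rewrite y3 in n3 v2; rewrite y2 in n2 v3; rewrite y1 in n1 v4.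
  pose B2 := x * (x - 1) / ((y + 4%:R) * (y + 3%:R)).
  have c1 : w1.[a] = w * (x / (y + 4%:R)) by rewrite v1 -/w -/x; field.
  have c2 : w2.[a] = w * B2 by rewrite v2 c1 /B2 -/x; field; rewrite n3 n4.
  pose B3 := B2 * (x - 2%:R) / (y + 2%:R).
  have c3 : w3.[a] = w * B3 by rewrite v3 c2 /B3 -/x; field.
  pose B4 := B3 * (x - 3%:R) / (y + 1).
  have c4 : w4.[a] = w * B4 by rewrite v4 c3 /B4 -/x; field.
  set B1 := x / (y + 4%:R) in c1.
  have b1E : B1 = x / (y + 4%:R) by [].
  have S1 : B4 - 4%:R * B1 * B3 + 3%:R * B2 ^+ 2 = 0.
    apply: (@mulfI _ (w ^+ 2)); first by rewrite expf_neq0.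
    clearbody B1 B2 B3 B4; rewrite mulr0 -Sw !hornerE /= c1 c2 c3 c4 -/w; ring.
  have T1 : B2 * B4 + 2%:R * B1 * B2 * B3 - B3 ^+ 2 - B1 ^+ 2 * B4 - B2 ^+ 3 = 0.
    apply: (@mulfI _ (w ^+ 3)); first by rewrite expf_neq0.
    clearbody B1 B2 B3 B4; rewrite mulr0 -Tw !hornerE /= c1 c2 c3 c4 -/w; ring.
  (* The syzygy for a quartic with leading coefficient 1: G^2 + 4 H^3 = H S - T. *)
  have : (B3 - 3%:R * B1 * B2 + 2%:R * B1 ^+ 3) ^+ 2 + 4%:R * (B2 - B1 ^+ 2) ^+ 3 = 0.
    transitivity ((B2 - B1 ^+ 2) * (B4 - 4%:R * B1 * B3 + 3%:R * B2 ^+ 2)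
       - (B2 * B4 + 2%:R * B1 * B2 * B3 - B3 ^+ 2 - B1 ^+ 2 * B4 - B2 ^+ 3)); first by ring.
    by rewrite S1 T1 mulr0 subr0.
  have -> : (B3 - 3%:R * B1 * B2 + 2%:R * B1 ^+ 3) ^+ 2 + 4%:R * (B2 - B1 ^+ 2) ^+ 3 =
     - (4%:R * x ^+ 2 * (y + 4%:R - x) ^+ 2 * (x - 1) * (y + 3%:R - x))
     / ((y + 4%:R) ^+ 4 * (y + 3%:R) ^+ 3 * (y + 2%:R) ^+ 2).
    rewrite /B3 /B2 /B1; field.
    by rewrite n4 n3 n2.
  have nat_eq (p q : nat) : p%:R = q%:R :> F -> p = q by move/eqP; rewrite eqr_nat => /eqP.
  move/eqP; rewrite mulf_eq0 invr_eq0 !(mulf_eq0, expf_eq0, oppr_eq0) /=.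
  rewrite (negPf n4) (negPf n3) (negPf n2) !orbF pnatr_eq0 /= -y4 -y3.
  rewrite /x pnatr_eq0 !subr_eq0 -[1]/1%:R !eqr_nat.
  by clear -m2' m0; lia.
have b0a : b0.[a] = 0 by apply/eqP.
have b1a : b1.[a] != 0.
  apply: contraNneq va => b10; have := congr1 (horner^~ a) d0.
  by rewrite e0 m1 derivMXsubC hornerM b10 mulr0 => /eqP.
have s1 : s = 1%N by nia.
have Sa : S.[a] = 0 by rewrite es s1 hornerXsubCn.
move: sa; rewrite /root => /negP[]; apply/eqP.
have <- : S^`().[a] = sig.[a].
  by rewrite es s1 derivMXsubC.
have dS : S^`().[a] = M%:R * (2%:R * b2.[a] * b3.[a] - 3%:R * b1.[a] * b4.[a]).
  have E4 : (4%:R : {poly F})^`() = 0 by rewrite -polyC_natr derivC.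
  have E3 : (3%:R : {poly F})^`() = 0 by rewrite -polyC_natr derivC.
  rewrite /S !derivE d0 d1 d2 d3 !hornerE /= !hornerMn b0a !hornerE; ring.
apply: (mulfI b1a); rewrite mulr0 dS.
transitivity (M%:R * (3%:R * T.[a] + b2.[a] * S.[a])); last by rewrite Ta Sa; ring.
rewrite /T /S !hornerE b0a /=; ring.
Qed.

(** For b0 = c w^m with w at most quadratic, 2 w w'' - w'^2 is constant, a
    discriminant, and w^2 H is this constant times b0^2 up to a factor; now
    differentiate. *)
Lemma hessian_logder_power (w : {poly F}) (m : nat) (c : F) : m.*2 = M.+4 -> (size w <= 3)%N -> w != 0 ->
  b0 = c%:P * w ^+ m ->
  (2 * M.+2)%:R%:P * (b0^`() * H) = M.+4%:R%:P * (b0 * H^`()).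
Proof.
move=> em sw w0 eb.
have m0 : (0 < m)%N by lia.
have e1 : 2%:R * w * b1 = w^`() * b0.
  apply: (mulfI (poly_natS_neq0 M.+3)).
  transitivity (2%:R * (w * b0^`())); first by rewrite d0; ring.
  rewrite eb derivM derivC mul0r add0r deriv_exp -em -muln2 natrM.
  by case: (m) m0 => // k _; rewrite exprS /=; ring.
have e1' := congr1 (@deriv F) e1.
have e2 : 2%:R * M.+3%:R * w * b2 = w^`()^`() * b0 + M.+2%:R * w^`() * b1.
  apply: (eq_of_sub e1').
  have E2 : (2%:R : {poly F})^`() = 0 by rewrite -polyC_natr derivC.
  rewrite !derivM E2 d0 d1; ring.
set kap := 2%:R * w * w^`()^`() - w^`() ^+ 2.
have dkap : kap^`() = 0.
  have w3 : w^`()^`()^`() = 0.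
    apply/eqP; rewrite -size_poly_eq0 -leqn0.
    have sd (r : {poly F}) k : (size r <= k.+1)%N -> (size r^`() <= k)%N.
      have [->|r0] := eqVneq r 0; first by rewrite deriv0 size_poly0.
      have := lt_size_deriv r0; lia.
    by apply/sd/sd/sd.
  have E2 : (2%:R : {poly F})^`() = 0 by rewrite -polyC_natr derivC.
  rewrite /kap derivD derivN !derivM E2 w3; ring.
have eH : 4%:R * M.+3%:R * w ^+ 2 * H = kap * b0 ^+ 2.
  transitivity (b0 * (2%:R * w) * (2%:R * M.+3%:R * w * b2)
     - M.+3%:R * (2%:R * w * b1) ^+ 2); first by rewrite /H; ring.
  rewrite e2 e1 /kap.
  transitivity (2%:R * w * w^`()^`() * b0 ^+ 2 + b0 * M.+2%:R * w^`() * (2%:R * w * b1)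
     - M.+3%:R * (w^`() * b0) ^+ 2); first by ring.
  rewrite e1; ring.
have dH := congr1 (@deriv F) eH.
have {}dH : 4%:R * M.+3%:R * (2%:R * w * w^`() * H + w ^+ 2 * H^`()) =
    2%:R * M.+4%:R * kap * b0 * b1.
  have En k : (k%:R : {poly F})^`() = 0 by rewrite -polyC_natr derivC.
  move: dH; rewrite !derivM !En dkap d0 => dH; apply: (eq_of_sub dH); ring.
have cn0 : (4%:R * M.+3%:R * w ^+ 3 : {poly F}) != 0.
  by rewrite !mulf_neq0 ?expf_neq0 ?poly_natS_neq0.
apply: (mulfI cn0); rewrite !polyC_natr d0.
transitivity (M.+4%:R * M.+2%:R * (2%:R * w * b1) * (4%:R * M.+3%:R * w ^+ 2 * H)).
  by rewrite natrM; ring.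
transitivity (M.+4%:R * b0 * (w * (4%:R * M.+3%:R * (2%:R * w * w^`() * H + w ^+ 2 * H^`()))
   - 2%:R * w^`() * (4%:R * M.+3%:R * w ^+ 2 * H))); last by ring.
rewrite dH eH e1.
transitivity (M.+4%:R * b0 * (M.+4%:R * kap * b0 * (2%:R * w * b1)
   - 2%:R * w^`() * (kap * b0 ^+ 2))); last by ring.
rewrite e1; ring.
Qed.

(** At most two distinct roots fit into the degree when each has multiplicity N / 2,
    so b0 is a constant times the power N / 2 of a polynomial of degree one or two. *)
Lemma hessian_logder :
  (2 * M.+2)%:R%:P * (b0^`() * H) = M.+4%:R%:P * (b0 * H^`()).
Proof.
have nat0 k (x : {poly F}) : k.+1%:R * x = 0 -> x = 0.
  by move/eqP; rewrite mulf_eq0 (negPf (poly_natS_neq0 k)) => /eqP.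
have b1_neq0 : b1 != 0.
  apply: contra_neq S0 => b10.
  have b20 : b2 = 0 by apply: (@nat0 M.+2); rewrite -d1 b10 deriv0.
  have b30 : b3 = 0 by apply: (@nat0 M.+1); rewrite -d2 b20 deriv0.
  have b40 : b4 = 0 by apply: (@nat0 M); rewrite -d3 b30 deriv0.
  by rewrite /S b10 b20 b40; ring.
have b0_neq0 : b0 != 0.
  by apply: contraNneq b1_neq0 => b00; apply/eqP/(@nat0 M.+3); rewrite -d0 b00 deriv0.
have sb : size b0 != 1%N.
  apply: contraNneq b1_neq0 => /eqP/size_poly1P [c _ bc].
  by apply/eqP/(@nat0 M.+3); rewrite -d0 bc derivC.
have [a ra] := closed_rootP _ sb.
have [m [v]] := multiplicity_XsubC b0 a; rewrite b0_neq0 /= => va e0.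
have em := root_multiplicity ra e0 va.
have v0 : v != 0 by apply: contraNneq va => ->; rewrite root0.
have [/eqP/size_poly1P [c c0 vc]|sv] := eqVneq (size v) 1%N.
  apply: (@hessian_logder_power ('X - a%:P) m c) => //.
  - by rewrite size_XsubC.
  - by rewrite polyXsubC_eq0.
  - by rewrite e0 vc.
have [b rb] := closed_rootP _ sv.
have [k [v' ]] := multiplicity_XsubC v b; rewrite v0 /= => vb ev.
have ab : b != a by apply: contraNneq va => <-.
have kb : k.*2 = M.+4.
  apply: (@root_multiplicity b _ k (v' * ('X - a%:P) ^+ m)).
  - by rewrite e0 rootM rb.
  - by rewrite e0 ev; ring.
  - rewrite rootM negb_or vb /= /root horner_exp hornerXsubC expf_neq0 //.
    by rewrite subr_eq0.
have km : k = m by clear -kb em; lia.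
have v'0 : v' != 0 by apply: contraNneq vb => ->; rewrite root0.
have eb : b0 = v' * (('X - a%:P) * ('X - b%:P)) ^+ m.
  by rewrite e0 ev km exprMn; ring.
have : (size v' <= 1)%N.
  have := size_b0; rewrite eb exprMn size_mul ?mulf_neq0 ?expf_neq0 ?polyXsubC_eq0 //.
  rewrite size_mul ?expf_neq0 ?polyXsubC_eq0 // !size_exp_XsubC.
  have -> : ((size v' + (m.+1 + m.+1).-1).-1 = size v' + m.*2)%N.
    by rewrite addSn /= !addnS /= addnn.
  by rewrite em -[M.+1.+4]add1n leq_add2r.
move=> /size1_polyC vc; apply: (@hessian_logder_power (('X - a%:P) * ('X - b%:P)) m v'`_0) => //.
- by rewrite size_mul ?polyXsubC_eq0 // !size_XsubC.
- by rewrite mulf_neq0 ?polyXsubC_eq0.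
- by rewrite eb {1}vc.
Qed.

End Univariate.

Section Dehomogenise.
Variables (K : numFieldType) (F : numClosedFieldType) (iota : {rmorphism K -> F}).
Implicit Types (U V W : bipoly K) (d N M k : nat).

Notation pX := (pX K).
Notation qX := (qX K).
Notation C := (mpolyC 2 (R := K)).

(** The univariate polynomial V(x, 1) over an algebraically closed extension. *)
Definition dehom : bipoly K -> {poly F} :=
  mmap (polyC \o iota) (fun i : 'I_2 => if i == ord0 then 'X else 1).

HB.instance Definition _ := GRing.RMorphism.copy dehom
  (mmap (polyC \o iota) (fun i : 'I_2 => if i == ord0 then 'X else 1)).

Lemma dehomC c : dehom (C c) = (iota c)%:P.
Proof. exact: mmapC. Qed.

Lemma dehom_pX : dehom pX = 'X.
Proof. by rewrite /dehom mmapX mmap1U eqxx. Qed.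

Lemma dehom_qX : dehom qX = 1.
Proof. by rewrite /dehom mmapX mmap1U. Qed.

Lemma deriv_dehom V : (dehom V)^`() = dehom (\dp V).
Proof.
move: V; apply: bipoly_ind => [c|||V W eV eW|V W eV eW].
- by rewrite mderivC rmorph0 dehomC derivC.
- rewrite dehom_pX derivX /pX mderivX mnm1E eqxx scale1r.
  by rewrite mnm_sub1 mpolyX0 rmorph1.
- by rewrite dehom_qX derivC /qX mderivX mnm1E scale0r rmorph0.
- by rewrite mderivD !rmorphD derivD eV eW.
- by rewrite mderivM rmorphD !rmorphM derivM eV eW.
Qed.

(** Euler's identity with q = 1. *)
Lemma dehom_dq d V : quantic d V ->
  dehom (\dq V) = d%:R * dehom V - 'X * dehom (\dp V).
Proof.
move=> /euler /(congr1 dehom); rewrite rmorphD !rmorphM rmorphMn /=.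
by rewrite dehom_pX dehom_qX mul1r -mulr_natl => <-; rewrite addrC addKr.
Qed.

Lemma dehom_inj d V : quantic d V -> dehom V = 0 -> V = 0.
Proof.
apply: (quantic_eq0_ind (P := fun V => dehom V = 0)) => [c|k W hW W0].
  by rewrite dehomC => /eqP; rewrite polyC_eq0 fmorph_eq0 => /eqP.
have p0 : dehom (\dp W) = 0 by rewrite -deriv_dehom W0 deriv0.
by rewrite (dehom_dq hW) p0 W0 !mulr0 subr0.
Qed.

Lemma size_dehom d V : quantic d V -> (size (dehom V) <= d.+1)%N.
Proof.
move=> hV; rewrite /dehom /mmap big_seq; apply: (leq_trans (size_sum _ _ _)).
apply/bigmax_leqP_seq => m _ /(mdeg_quantic hV) hm; rewrite /= mul_polyC (leq_trans (size_scale_leq _ _)) //.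
rewrite /mmap1 !big_ord_recl big_ord0 mulr1 /= expr1n mulr1 size_polyXn ltnS.
by rewrite -hm mdegE big_ord_recl leq_addr.
Qed.

(** So (V, W) = 0 says that the power k of V(x, 1) and the power d of W(x, 1) are
    proportional. *)
Lemma dehom_jacobian d k V W : quantic d V -> quantic k W ->
  dehom (jacobian V W) =
  k%:R%:P * ((dehom V)^`() * dehom W) - d%:R%:P * (dehom V * (dehom W)^`()).
Proof.
move=> hV hW; rewrite /jacobian rmorphB !rmorphM /= (dehom_dq hV) (dehom_dq hW).
rewrite !deriv_dehom !polyC_natr; ring.
Qed.

Lemma quantic_jacobian d k V W : quantic d V -> quantic k W ->
  quantic (d.-1 + k.-1) (jacobian V W).
Proof.
move=> hV hW; rewrite /quantic /jacobian rpredB //.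
  exact: dhomogM (quantic_mderiv _ hV) (quantic_mderiv _ hW).
exact: dhomogM (quantic_mderiv _ hV) (quantic_mderiv _ hW).
Qed.

Section Covariants.
Variables (N : nat) (U : bipoly K).
Hypothesis hU : quantic N U.

Lemma quantic_hessian : quantic (2 * N.-2) (hessian N U).
Proof.
have h (i j : 'I_2) : quantic N.-2 (mderiv i (mderiv j U)).
  exact: quantic_mderiv (quantic_mderiv _ hU).
apply: rpredZ; rewrite rpredB //; rewrite mul2n -addnn.
  exact: dhomogM (h _ _) (h _ _).
by rewrite expr2; exact: dhomogM (h _ _) (h _ _).
Qed.

Let quantic_mderiv4 (i j k l : 'I_2) :
  quantic (N - 4) (mderiv i (mderiv j (mderiv k (mderiv l U)))).
Proof.
have -> : (N - 4)%N = N.-1.-1.-1.-1 by lia.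
by do 4! apply: quantic_mderiv.
Qed.

Lemma quantic_covS : quantic (2 * (N - 4)) (covS N U).
Proof.
apply: rpredZ; rewrite /= mul2n -addnn.
have h x y : quantic (N - 4) x -> quantic (N - 4) y ->
   quantic (N - 4 + (N - 4)) (x * y) by exact: dhomogM.
rewrite expr2; apply: rpredD; last by apply: rpredMn; apply: h.
by apply: rpredB; [apply: h|apply: rpredMn; apply: h].
Qed.

Lemma quantic_covT : quantic (3 * (N - 4)) (covT N U).
Proof.
have -> : (3 * (N - 4) = (N - 4) + (N - 4) + (N - 4))%N by lia.
have h3 x y z : quantic (N - 4) x -> quantic (N - 4) y -> quantic (N - 4) z ->
   quantic (N - 4 + (N - 4) + (N - 4)) (x * y * z).
  by move=> hx hy hz; apply: dhomogM => //; exact: dhomogM.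
apply: rpredZ; rewrite /= !exprS !expr0 !mulr1 !mulrA.
by do ![apply: rpredB | apply: rpredD | apply: rpredMn | apply: h3].
Qed.

End Covariants.

(** Zero Jacobians become the differential equations for S and T supposed in
    [hessian_logder], whose five polynomials are read off from the normal form at (x, 1). *)
Lemma covS_dichotomy N U : (4 < N)%N -> quantic N U ->
  jacobian U (covS N U) = 0 -> jacobian U (covT N U) = 0 ->
  covS N U = 0 \/ jacobian U (Phi N U) = 0.
Proof.
move=> N4 hU jS jT; have [->|S0] := eqVneq (covS N U) 0; [by left|right].
have := quartic_normal_form (ltnW N4) hU.
move=> [a [b [c [d [e]]]]] [eU [ep eq] [epp eqp eqq] [e1 e2 e3 e4] [f1 f2 f3 f4 f5]].
have [eS eT] := covSE (ltnW N4) (And5 f1 f2 f3 f4 f5).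
have eH := hessianE (ltnW (ltnW (ltnW N4))) (And3 epp eqp eqq).
case: N N4 hU S0 jS jT ep e1 epp f1 eS eT eH {f2 f3 f4 f5 e2 e3 e4 eqp eqq eq}
  => [|[|[|[|M]]]] // M0 hU' S0 jS jT ep e1 epp f1 eS eT eH.
set n := (M.+4%:R : K) in ep e1 epp.
have iC k (x : K) : x = k%:R -> dehom (C x) = k%:R.
  by move=> ->; rewrite dehomC rmorph_nat polyC_natr.
have en1 : n - 1 = M.+3%:R by rewrite /n -[1]/1%:R -natrB.
have en2 : n - 2%:R = M.+2%:R by rewrite /n -natrB.
have en3 : n - 3%:R = M.+1%:R by rewrite /n -natrB.
pose a' := dehom a; pose b' := dehom b; pose c' := dehom c; pose d' := dehom d; pose e' := dehom e.
pose b0 := 'X ^+ 4 * a' + 4%:R * 'X ^+ 3 * b' + 6%:R * 'X ^+ 2 * c' + 4%:R * 'X * d' + e'.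
pose b1 := 'X ^+ 3 * a' + 3%:R * 'X ^+ 2 * b' + 3%:R * 'X * c' + d'.
pose b2 := 'X ^+ 2 * a' + 2%:R * 'X * b' + c'.
pose b3 := 'X * a' + b'.
have E0 : dehom U = b0.
  rewrite eU !(rmorphD, rmorphM, rmorphXn, rmorph_nat) /= dehom_pX dehom_qX /b0.
  by rewrite -/a' -/b' -/c' -/d' -/e'; ring.
have E1 : dehom (\dp U) = M.+4%:R * b1.
  rewrite ep rmorphM /= (iC M.+4) // !(rmorphD, rmorphM, rmorphXn, rmorph_nat) /=.
  rewrite dehom_pX dehom_qX /b1.
  by rewrite -/a' -/b' -/c' -/d'; ring.
have E2 : dehom (\dp \dp U) = M.+4%:R * (M.+3%:R * b2).
  rewrite epp en1 -natrM rmorphM /= (iC (M.+4 * M.+3)%N) //.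
  rewrite !(rmorphD, rmorphM, rmorphXn, rmorph_nat) /= dehom_pX dehom_qX natrM /b2.
  by rewrite -/a' -/b' -/c'; ring.
have E3 : dehom (\dp \dp \dp U) = M.+4%:R * (M.+3%:R * (M.+2%:R * b3)).
  rewrite e1 en1 en2 -!natrM rmorphM /= (iC (M.+4 * M.+3 * M.+2)%N) //.
  rewrite !(rmorphD, rmorphM) /= dehom_pX dehom_qX !natrM /b3.
  by rewrite -/a' -/b'; ring.
have E4 : dehom (\dp \dp \dp \dp U) = M.+4%:R * (M.+3%:R * (M.+2%:R * (M.+1%:R * a'))).
  rewrite f1 /quartic_factor en1 en2 en3 -!natrM rmorphM /=.
  by rewrite (iC (M.+4 * M.+3 * M.+2 * M.+1)%N) // !natrM !mulrA.
have nI k : injective (fun x : {poly F} => k.+1%:R * x) := mulfI (poly_natS_neq0 F k).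
have derM k (x : {poly F}) : (k%:R * x)^`() = k%:R * x^`().
  by rewrite derivM -polyC_natr derivC mul0r add0r.
have D0 : b0^`() = M.+4%:R * b1 by rewrite -E0 deriv_dehom E1.
have D1 : b1^`() = M.+3%:R * b2.
  by apply: (nI M.+3); rewrite -E2 -deriv_dehom E1 derM.
have D2 : b2^`() = M.+2%:R * b3.
  apply: (nI M.+2); apply: (nI M.+3).
  by rewrite -E3 -deriv_dehom E2 !derM.
have D3 : b3^`() = M.+1%:R * a'.
  apply: (nI M.+1); apply: (nI M.+2); apply: (nI M.+3).
  by rewrite -E4 -deriv_dehom E3 !derM.
have sz : (size b0 <= M.+4.+1)%N by rewrite -E0; apply: size_dehom.
have ES : dehom (covS M.+4 U) = b0 * a' - 4%:R * b1 * b3 + 3%:R * b2 ^+ 2.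
  rewrite eS !(rmorphD, rmorphN, rmorphM, rmorphXn, rmorph_nat) /= /b0 /b1 /b2 /b3.
  by rewrite -/a' -/b' -/c' -/d' -/e'; ring.
have ET : dehom (covT M.+4 U) = b0 * b2 * a' + 2%:R * b1 * b2 * b3 - b0 * b3 ^+ 2
    - b1 ^+ 2 * a' - b2 ^+ 3.
  rewrite eT !(rmorphD, rmorphN, rmorphM, rmorphXn, rmorph_nat) /= /b0 /b1 /b2 /b3.
  by rewrite -/a' -/b' -/c' -/d' -/e'; ring.
have EH : dehom (hessian M.+4 U) = b0 * b2 - b1 ^+ 2.
  rewrite eH !(rmorphD, rmorphN, rmorphM, rmorphXn, rmorph_nat) /= dehom_pX dehom_qX.
  by rewrite /b0 /b1 /b2 -/a' -/b' -/c' -/d' -/e'; ring.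
have hS := quantic_covS hU'; have hT := quantic_covT hU'; have hH := quantic_hessian hU'.
have LS := dehom_jacobian hU' hS; have LT := dehom_jacobian hU' hT.
have LH := dehom_jacobian hU' hH.
rewrite jS rmorph0 ES E0 !subSS subn0 in LS; rewrite jT rmorph0 ET E0 !subSS subn0 in LT.
rewrite EH E0 -[M.+4.-2]/M.+2 in LH.
have S0' : b0 * a' - 4%:R * b1 * b3 + 3%:R * b2 ^+ 2 != 0.
  rewrite -ES; apply: contra_neq S0; exact: dehom_inj hS.
have sub0 (x y : {poly F}) : 0 = x - y -> x = y by move/esym/subr0_eq.
have LH' := hessian_logder M0 D0 D1 D2 D3 sz (sub0 _ _ LS) (sub0 _ _ LT) S0'.
have J0 : jacobian U (hessian M.+4 U) = 0.
  by apply: (dehom_inj (quantic_jacobian hU' hH)); rewrite LH LH' subrr.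
rewrite /Phi /jacobian !mderivN (mderivZ ord0 _ (hessian M.+4 U)).
rewrite (mderivZ ord_max _ (hessian M.+4 U)) !mulrN -!scalerAr -opprD -scalerN -scalerDr.
by have := J0; rewrite /jacobian => ->; rewrite scaler0 oppr0.
Qed.

(** The partial derivatives vanish along the curve together with the form: its gradient
    is annihilated by the vectors (p, q) and (-U_q, U_p), whose determinant is N U. So
    [quantic_eq0_ind] applies. *)
Lemma quantic_vanish N U (D : set K) (p q : K -> K) :
  (0 < N)%N -> quantic N U -> (exists t, D t) -> (forall t, D t -> along p q U t <> 0) ->
  (forall V, vanishes_along D p q V -> vanishes_along D p q (jacobian U V)) ->
  forall d V, quantic d V -> vanishes_along D p q V -> V = 0.
Proof.
move=> N0 hU [t0 Dt0] U0 hD.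
apply: quantic_eq0_ind => [c /(_ t0 Dt0)|d V hV V0]; first by rewrite /along mevalC.
have key t : D t -> along p q (\dp V) t = 0 /\ along p q (\dq V) t = 0.
  move=> Dt; have := hD V V0 t Dt; have := V0 t Dt; have := U0 t Dt.
  have := congr1 (along p q ^~ t) (euler hU); have := congr1 (along p q ^~ t) (euler hV).
  rewrite /= /along /jacobian !(mevalD, mevalN, mevalM, mevalMn) !mevalXU.
  rewrite !(tnth_nth 0) /=.
  move: (meval _ (\dp V)) (meval _ (\dq V)) (meval _ (\dp U)) (meval _ (\dq U)).
  move: (meval _ V) (meval _ U) => v u vp vq up uq e1 e2 /eqP u0 v0 e3.
  have nu : u *+ N != 0 by rewrite -mulr_natr mulf_neq0 // pnatr_eq0 -lt0n.
  rewrite v0 mul0rn in e1.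
  split; apply: (mulfI nu); rewrite mulr0 -e2.
    apply: (eq_of_sub (c := up * (p t * vp + q t * vq) - q t * (up * vq - uq * vp)) (d := 0)).
      by rewrite e1 e3; ring.
    ring.
  apply: (eq_of_sub (c := uq * (p t * vp + q t * vq) + p t * (up * vq - uq * vp)) (d := 0)).
    by rewrite e1 e3; ring.
  ring.
by split=> t /key [].
Qed.

End Dehomogenise.

(** * Derivatives along Hamilton curves *)

Section Calculus.
Variable K : numFieldType.
Implicit Types (D : set K) (f g : K -> K) (t l m : K).

(** The quotient-free form, in which s may equal t. *)
Lemma has_derivativeP D f t l : D t -> has_derivative D f t l <->
  forall e, 0 < e -> exists2 d, 0 < d &
    forall s, D s -> `|s - t| < d -> `|f s - f t - l * (s - t)| <= e * `|s - t|.
Proof.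
move=> Dt; split=> [h e e0|h].
  have /cvgrPdist_lt/(_ e e0) h1 := h.
  have : nbhs t (fun s => s != t -> D s -> `|l - (f s - f t) / (s - t)| < e) by exact: h1.
  move=> /nbhs_ballP [d /= d0 hd]; exists d => // s Ds sd.
  have [->|st] := eqVneq s t; first by rewrite !subrr mulr0 subrr normr0 mulr0.
  have := hd s; rewrite /ball /= distrC => /(_ sd st Ds) /ltW.
  have st0 : s - t != 0 by rewrite subr_eq0.
  rewrite distrC -(ler_pM2r (x := `|s - t|)) ?normr_gt0 //.
  by rewrite -normrM mulrBl divfK.
apply/cvgrPdist_le => e e0; have [d d0 hd] := h e e0.
change (nbhs t (fun s => s != t -> D s -> `|l - (f s - f t) / (s - t)| <= e)).
apply/nbhs_ballP; exists d => //= s; rewrite /ball /=.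
rewrite distrC => sd st Ds; have st0 : s - t != 0 by rewrite subr_eq0.
rewrite -(ler_pM2r (x := `|s - t|)) ?normr_gt0 // -normrM mulrBl divfK // distrC.
exact: hd.
Qed.

Lemma has_derivative_cvg D f t l : has_derivative D f t l ->
  f s @[s --> within D t^'] --> f t.
Proof.
move=> h; have idc : (s - t) @[s --> within D t^'] --> (0 : K).
  rewrite -(subrr t); apply: cvgB; last exact: cvg_cst.
  apply: cvg_within_filter; exact: cvg_within.
have : ((f s - f t) / (s - t) * (s - t) + f t) @[s --> within D t^'] --> l * 0 + f t.
  by apply: cvgD; [exact: cvgM|exact: cvg_cst].
rewrite mulr0 add0r; apply: cvg_trans; apply: near_eq_cvg.
change (nbhs t (fun s => s != t -> D s -> (f s - f t) / (s - t) * (s - t) + f t = f s)).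
by apply: (filterE (F := nbhs t)) => s st _; rewrite divfK ?subr_eq0 // subrK.
Qed.

Lemma has_derivative_ext D f g t l : D t -> (forall s, D s -> f s = g s) ->
  has_derivative D f t l -> has_derivative D g t l.
Proof.
move=> Dt fg; apply: cvg_trans; apply: near_eq_cvg.
change (nbhs t (fun s => s != t -> D s -> (f s - f t) / (s - t) = (g s - g t) / (s - t))).
by apply: (filterE (F := nbhs t)) => s st Ds; rewrite !fg.
Qed.

Lemma has_derivative_cst D c t : has_derivative D (fun=> c) t 0.
Proof.
by rewrite /has_derivative; under eq_fun do rewrite subrr mul0r; exact: cvg_cst.
Qed.

Lemma has_derivativeD D f g t l m : has_derivative D f t l -> has_derivative D g t m ->
  has_derivative D (fun s => f s + g s) t (l + m).
Proof.
move=> hf hg; rewrite /has_derivative.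
under eq_fun do rewrite opprD addrACA mulrDl; exact: cvgD.
Qed.

Lemma has_derivativeM D f g t l m : has_derivative D f t l -> has_derivative D g t m ->
  has_derivative D (fun s => f s * g s) t (l * g t + f t * m).
Proof.
move=> hf hg; rewrite /has_derivative.
have e s : (f s * g s - f t * g t) / (s - t) =
   (f s - f t) / (s - t) * g t + f s * ((g s - g t) / (s - t)) by ring.
under eq_fun do rewrite e.
apply: cvgD; first by apply: cvgM => //; exact: cvg_cst.
apply: cvgM => //; exact: has_derivative_cvg hf.
Qed.

Lemma has_derivativeV D f t l : D t -> (forall s, D s -> f s != 0) ->
  has_derivative D f t l ->
  has_derivative D (fun s => (f s)^-1) t (- l / f t ^+ 2).
Proof.
move=> Dt f0 hf.
have h : (- ((f s - f t) / (s - t)) * ((f s)^-1 * (f t)^-1)) @[s --> within D t^']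
   --> - l * ((f t)^-1 * (f t)^-1).
  apply: cvgM; first exact: cvgN.
  apply: cvgM; last exact: cvg_cst.
  apply: cvgV; [exact: f0|exact: has_derivative_cvg hf].
rewrite expr2 invfM; move: h; apply: cvg_trans; apply: near_eq_cvg.
change (nbhs t (fun s => s != t -> D s ->
  - ((f s - f t) / (s - t)) * ((f s)^-1 * (f t)^-1) = ((f s)^-1 - (f t)^-1) / (s - t))).
apply: (filterE (F := nbhs t)) => s st Ds; have := f0 s Ds; have := f0 t Dt => ft fs.
by field; rewrite ft fs subr_eq0 st.
Qed.

(** Makes derivatives relative to D unique. *)
Definition accumulating D := forall t d, D t -> 0 < d -> exists s, [/\ D s, s != t & `|s - t| < d].

Lemma has_derivative_unique D f t l m : accumulating D -> D t ->
  has_derivative D f t l -> has_derivative D f t m -> l = m.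
Proof.
move=> acc Dt; have FF : ProperFilter (within D t^').
  apply: Build_ProperFilter_ex => // P.
  change (nbhs t (fun s => s != t -> D s -> P s) -> exists x, P x); move=> /nbhs_ballP [d /= d0 hd].
  have [s [Ds st sd]] := acc t d Dt d0; exists s; apply: hd => //.
  by rewrite /ball /= distrC.
by move=> h1 h2; apply: (cvg_unique _ h1 h2).
Qed.

(** By induction on V: the equations of motion for the two variables, then the sum and
    product rules. *)
Lemma has_derivative_along D p q (U V : bipoly K) t : hamilton_curve D p q U -> D t ->
  has_derivative D (along p q V) t (along p q (jacobian U V) t).
Proof.
move=> hpq Dt; have [hq hp] := hpq t Dt.
move: V; apply: bipoly_ind => [c|||V W hV hW|V W hV hW].
- rewrite /jacobian !mderivC !mulr0 subrr /along meval0.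
  apply: (has_derivative_ext (f := fun=> c)) => [//|s _|]; last exact: has_derivative_cst.
  by rewrite mevalC.
- have -> : jacobian U (pX K) = - \dq U.
    rewrite /jacobian /pX !mderivX !mnm1E /= scale0r mulr0 add0r scale1r mnm_sub1.
    by rewrite mpolyX0 mulr1.
  rewrite /along mevalN; apply: (has_derivative_ext (f := p)) => // s _.
  by rewrite /along mevalXU.
- have -> : jacobian U (qX K) = \dp U.
    rewrite /jacobian /qX !mderivX !mnm1E /= scale0r mulr0 subr0 scale1r mnm_sub1.
    by rewrite mpolyX0 mulr1.
  apply: (has_derivative_ext (f := q)) => // s _.
  by rewrite /along mevalXU.
- rewrite jacobianD alongD.
  by apply: (has_derivative_ext Dt _ (has_derivativeD hV hW)) => s _; rewrite alongD.
- rewrite jacobianM alongD !alongM.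
  by apply: (has_derivative_ext Dt _ (has_derivativeM hV hW)) => s _; rewrite alongM.
Qed.

End Calculus.

(** * Functions with vanishing derivative *)

(** Connectedness as an induction principle. *)
Lemma connected_ind (K : numFieldType) (D : set K) (P : K -> Prop) :
  connected D ->
  (forall z, D z -> P z ->
     exists2 d, 0 < d & forall w, D w -> `|w - z| < d -> P w) ->
  (forall z, D z -> (forall d, 0 < d -> exists w, [/\ D w, `|w - z| < d & P w]) -> P z) ->
  (exists2 z, D z & P z) -> forall z, D z -> P z.
Proof.
move=> cD oP cP [z0 Dz0 Pz0].
suff e : D `&` [set z | P z] = D by move=> z; rewrite -e => -[].
apply: cD; first by exists z0.
- exists (\bigcup_(x in [set x : K * K | 0 < x.2 /\
     forall w, D w -> `|w - x.1| < x.2 -> P w]) ball x.1 x.2).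
    by apply: bigcup_open => x [x0 _]; exact: ball_open.
  apply/seteqP; split=> w /= [Dw].
    move=> Pw; split=> //; have [d d0 hd] := oP w Dw Pw.
    by exists (w, d) => //=; exact: ballxx.
  by move=> [[x d] /= [d0 hd]]; rewrite /ball /= distrC => xw; split=> //; exact: hd.
- exists (closure (D `&` [set z | P z])); first exact: closed_closure.
  apply/seteqP; split=> w /= [Dw].
    by move=> Pw; split=> //; apply: subset_closure.
  move=> cw; split=> //; apply: cP => // d d0.
  have [x [[Dx Px]]] := cw (ball w d) (nbhsx_ballx w d d0).
  by rewrite /ball /= distrC => xw; exists x.
Qed.

(** Consider the supremum of the r such that P holds on [0, r]. *)
Lemma real_induction (R : realType) (P : R -> Prop) : P 0 ->
  (forall r, 0 <= r < 1 -> (forall x, 0 <= x <= r -> P x) ->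
     exists2 d, 0 < d & forall x, r < x < r + d -> x <= 1 -> P x) ->
  (forall r, 0 < r <= 1 -> (forall x, 0 <= x < r -> P x) -> P r) -> P 1.
Proof.
move=> P0 H1 H2; pose S := [set r : R | 0 <= r <= 1 /\ forall x, 0 <= x <= r -> P x].
have S0 : S 0.
  by split=> [|x]; rewrite ?lexx ?ler01 // -eq_le => /eqP <-.
have hS : has_sup S by split; [exists 0 | exists 1 => r [/andP[]]].
have s0 : 0 <= sup S by apply: ub_le_sup => //; exact: hS.2.
have s1 : sup S <= 1 by apply: ge_sup; [exists 0|move=> r [/andP[]]].
have Plt x : 0 <= x < sup S -> P x.
  move=> /andP[x0 xs]; have [r Sr xr] := sup_gt (ex_intro _ 0 S0) xs.
  by apply: Sr.2; rewrite x0 ltW.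
have Ps : P (sup S).
  have [<-//|s00] := eqVneq 0 (sup S).
  by apply: H2 => //; rewrite lt_def eq_sym s00 s0.
have Ss : S (sup S).
  split=> [|x /andP[x0]]; first by rewrite s0.
  by rewrite le_eqVlt => /orP[/eqP->//|xs]; apply: Plt; rewrite x0.
have [s1'|] := ltP (sup S) 1; last by move=> s1'; have <- : sup S = 1 by apply/eqP; rewrite eq_le s1 s1'.
have [|d d0 hd] := H1 (sup S) _ Ss.2; first by rewrite s0.
pose e := Num.min (d / 2%:R) (1 - sup S).
have e0 : 0 < e by rewrite lt_min subr_gt0 s1' divr_gt0.
have ed : e < d.
  by rewrite gt_min ltr_pdivrMr // mulr_natr mulr2n ltrDl d0.
have e1 : sup S + e <= 1 by rewrite -lerBrDl ge_min lexx orbT.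
suff : S (sup S + e).
  move=> /(ub_le_sup hS.2); rewrite gerDl leNgt => /negP[] //.
split=> [|x /andP[x0 xe]]; first by rewrite e1 addr_ge0 // ltW.
have [xs|xs] := leP x (sup S); first by apply: Ss.2; rewrite x0.
apply: hd; first by rewrite xs (le_lt_trans xe) // ltrD2l.
exact: le_trans xe e1.
Qed.

Section ComplexDomains.
Variable R : realType.
Local Notation C := (R[i] : numFieldType).
Implicit Types (D : set C) (f : C -> C) (z w : C).

Lemma posC (e : C) : 0 < e -> exists2 r : R, 0 < r & e = r%:C.
Proof. by case: e => a b; rewrite ltcE /= => /andP[/eqP -> a0]; exists a. Qed.

Lemma normC (z : C) : exists2 r : R, 0 <= r & `|z| = r%:C.
Proof.
by have := normr_ge0 z; case: `|z| => a b; rewrite lecE /= => /andP[/eqP -> a0]; exists a.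
Qed.

Definition segment_in D z w := forall r : R, 0 <= r <= 1 -> D (z + r%:C * (w - z)).

(** Mean value inequality by real induction along the segment: with slope tolerance
    e, the increment of f up to the parameter r is at most e r |w - z|. *)
Lemma segment_cst D f z w : segment_in D z w ->
  (forall x, D x -> has_derivative D f x 0) -> f w = f z.
Proof.
move=> hs df; have [n n0 en] := normC (w - z).
have [->//|wz] := eqVneq w z.
have {n0} n0 : 0 < n by rewrite -ltcR -en normr_gt0 subr_eq0.
pose c r := z + r%:C * (w - z).
have cB (x r : R) : `|c x - c r| = (`|x - r| * n)%:C.
  rewrite /c opprD addrACA subrr add0r -mulrBl -rmorphB normrM en rmorphM /=.
  by rewrite normc_def /= expr0n addr0 sqrtr_sqr.
suff main (e : R) : 0 < e -> `|f w - f z| <= (e * n)%:C.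
  apply/eqP; rewrite -subr_eq0 -normr_eq0; have [m m0 em] := normC (f w - f z).
  rewrite em -[0]/(0%:C) (inj_eq (@complexI _)) eq_le m0 andbT leNgt; apply/negP => m1.
  have := main (m / 2%:R / n); rewrite !divr_gt0 // em divfK ?gt_eqF // lecR => /(_ isT).
  by rewrite ler_pdivlMr // mulr_natr mulr2n gerDl leNgt m1.
move=> e0.
have loc (r : R) : 0 <= r <= 1 -> exists2 d : R, 0 < d & forall x : R,
    0 <= x <= 1 -> `|x - r| < d -> `|f (c x) - f (c r)| <= (e * (`|x - r| * n))%:C.
  move=> r01; have /has_derivativeP := df _ (hs r r01).
  move=> /(_ (hs r r01) e%:C); rewrite ltcR => /(_ e0) [d /posC [d' d0 ->] hd].
  exists (d' / n); first by rewrite divr_gt0.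
  move=> x x01 xr; have := hd _ (hs x x01); rewrite mul0r subr0 cB -rmorphM /=.
  by apply; rewrite ltcR -ltr_pdivlMr.
have c0 : c 0 = z by rewrite /c mul0r addr0.
have c1 : c 1 = w by rewrite /c mul1r addrC subrK.
pose P x := `|f (c x) - f z| <= (e * (x * n))%:C.
have tri x r (g : R) : P r -> `|f (c x) - f (c r)| <= (e * (g * n))%:C ->
    `|f (c x) - f z| <= (e * ((r + g) * n))%:C.
  move=> Pr xr; have -> : f (c x) - f z = (f (c x) - f (c r)) + (f (c r) - f z) by ring.
  apply: le_trans (ler_normD _ _) _.
  have -> : e * ((r + g) * n) = e * (g * n) + e * (r * n) by ring.
  by rewrite rmorphD lerD.
suff : P 1 by rewrite /P c1 mul1r.
apply: (@real_induction R P).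
- by rewrite /P c0 subrr normr0 mul0r mulr0.
- move=> r /andP[r0 r1] Pr; have [|d d0 hd] := loc r; first by rewrite r0 ltW.
  exists d => // x /andP[rx xd] x1.
  have := @tri x r (x - r); rewrite [r + _]addrC subrK; apply.
    by apply: Pr; rewrite lexx r0.
  have := hd x; rewrite ger0_norm ?subr_ge0 ?(ltW rx) //.
  by apply; rewrite ?ltrBlDl // x1 (le_trans r0 (ltW rx)).
- move=> r /andP[r0 r1] Pr; have [|d d0 hd] := loc r; first by rewrite (ltW r0) r1.
  pose x := Num.max 0 (r - d / 2%:R).
  have d2 : 0 < d / 2%:R by rewrite divr_gt0.
  have xr : x < r by rewrite gt_max r0 ltrBlDr ltrDl.
  have x0 : 0 <= x by rewrite le_max lexx.
  have Px : P x by apply: Pr; rewrite x0.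
  have nx : `|x - r| = r - x by rewrite distrC ger0_norm ?subr_ge0 ?(ltW xr).
  have xd : `|x - r| < d.
    rewrite nx ltrBlDr -ltrBlDl lt_max ltrD2l ltrN2 ltr_pdivrMr //.
    by rewrite mulr_natr mulr2n ltrDl d0 orbT.
  have := @tri r x (r - x); rewrite [x + _]addrC subrK; apply=> //.
  rewrite distrC; have := hd x; rewrite nx; apply; last by rewrite -nx.
  by rewrite x0 (le_trans (ltW xr)).
Qed.

(** What the time domains, real intervals and connected open sets alike, have in
    common as subsets of the complex plane: induction along a connected set, local
    segments, and no isolated points. *)
Definition good_domain D :=
  [/\ forall P : C -> Prop,
       (forall z, D z -> P z ->
          exists2 d, 0 < d & forall w, D w -> `|w - z| < d -> P w) ->
       (forall z, D z ->
          (forall d, 0 < d -> exists w, [/\ D w, `|w - z| < d & P w]) -> P z) ->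
       (exists2 z, D z & P z) -> forall z, D z -> P z,
      forall z, D z -> exists2 d, 0 < d &
        forall w, D w -> `|w - z| < d -> segment_in D z w &
      accumulating D].

Lemma has_derivative0_local_cst D f z : good_domain D -> D z ->
  (forall x, D x -> has_derivative D f x 0) ->
  exists2 d, 0 < d & forall w, D w -> `|w - z| < d -> f w = f z.
Proof.
move=> [_ sD _] Dz df; have [d d0 hd] := sD z Dz.
by exists d => // w Dw wz; apply: (@segment_cst D) => //; exact: hd.
Qed.

Lemma has_derivative0_cst D f : good_domain D ->
  (forall x, D x -> has_derivative D f x 0) ->
  forall z w, D z -> D w -> f w = f z.
Proof.
move=> gD df z w Dz; case: (gD) => cD _ _.
apply: (cD (fun x => f x = f z)) => [x Dx fx|x Dx hx|]; last by exists z.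
  have [d d0 hd] := has_derivative0_local_cst gD Dx df; exists d => // y Dy yx.
  by rewrite -fx; exact: hd.
have [d d0 hd] := has_derivative0_local_cst gD Dx df.
by have [y [Dy yx <-]] := hx d d0; rewrite (hd y).
Qed.

(* The embedding iota of the scalar field, with partial inverse kappa; every positive
   complex number being real, it has a positive preimage. *)
Section Transfer.
Variables (K : numFieldType) (iota : {rmorphism K -> C}) (kappa : C -> K).
Hypothesis iotaK : cancel iota kappa.
Hypothesis iota_norm : forall x, `|iota x| = iota `|x|.
Hypothesis iota_lt : forall x y, (iota x < iota y) = (x < y).
Hypothesis iota_pos : forall e : C, 0 < e -> exists2 e', 0 < e' & e = iota e'.

Lemma iota_le x y : (iota x <= iota y) = (x <= y).
Proof. by rewrite !le_eqVlt iota_lt (inj_eq (can_inj iotaK)). Qed.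

Lemma has_derivative_transfer (D : set K) (f : K -> K) t l : D t ->
  has_derivative D f t l ->
  has_derivative [set iota s | s in D] (fun z => iota (f (kappa z))) (iota t) (iota l).
Proof.
move=> Dt /has_derivativeP h; apply/has_derivativeP; first by exists t.
move=> e /iota_pos [e' e0 ->]; have [d d0 hd] := h Dt e' e0.
exists (iota d); first by rewrite -(rmorph0 iota) iota_lt.
move=> _ [s Ds <-]; rewrite !iotaK -rmorphB iota_norm iota_lt => sd.
by rewrite -rmorphB -rmorphM -rmorphB iota_norm -rmorphM iota_le; exact: hd.
Qed.

Lemma good_domain_image (D : set K) : connected D ->
  (forall t, D t -> exists2 d, 0 < d & forall s, D s -> `|s - t| < d ->
     segment_in [set iota s | s in D] (iota t) (iota s)) ->
  accumulating D -> good_domain [set iota s | s in D].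
Proof.
move=> cD sD aD; split.
- move=> P oP cP [_ [t0 Dt0 <-] Pt0] _ [t Dt <-].
  apply: (@connected_ind K D (P \o iota) cD) => //=; last by exists t0.
  + move=> z Dz Pz; have [|d /iota_pos [d' d0 ->] hd] := oP _ _ Pz; first by exists z.
    exists d' => // w Dw wz; apply: hd; first by exists w.
    by rewrite -rmorphB iota_norm iota_lt.
  + move=> z Dz hz; apply: cP => [|d /iota_pos [d' d0 ->]]; first by exists z.
    have [w [Dw wz Pw]] := hz d' d0; exists (iota w); split => //; first by exists w.
    by rewrite -rmorphB iota_norm iota_lt.
- move=> _ [t Dt <-]; have [d d0 hd] := sD t Dt.
  exists (iota d); first by rewrite -(rmorph0 iota) iota_lt.
  by move=> _ [s Ds <-]; rewrite -rmorphB iota_norm iota_lt => /(hd s Ds).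
- move=> _ d [t Dt <-] /iota_pos [d' d0 ->]; have [s [Ds st sd]] := aD t d' Dt d0.
  exists (iota s); split; first by exists s.
    by rewrite (inj_eq (can_inj iotaK)).
  by rewrite -rmorphB iota_norm iota_lt.
Qed.

End Transfer.

End ComplexDomains.

Section TimeDomains.
Variable R : realType.
Local Notation C := (R[i] : numFieldType).

Lemma good_domain_open (D : set C) : open D -> connected D ->
  good_domain D.
Proof.
move=> oD cD.
have hD t : D t -> exists2 d : C, 0 < d & forall s, `|s - t| < d -> D s.
  move=> Dt; have /nbhs_ballP [d /= d0 hd] : nbhs t D by apply: open_nbhs_nbhs.
  by exists d => // s; rewrite distrC => /hd.
have n01 (r : R) (w : C) : 0 <= r <= 1 -> `|r%:C * w| <= `|w|.
  move=> /andP[r0 r1]; rewrite normrM ler_piMl // normc_def /= expr0n addr0 sqrtr_sqr.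
  by rewrite ger0_norm // lecR.
split=> [P oP cP|t /hD [d d0 hd]|t e /hD [d d0 hd] e0].
- exact: connected_ind.
- exists d => // s Ds sd r r01; apply: hd; rewrite addrC addKr.
  exact: le_lt_trans (n01 _ _ r01) sd.
- have [d' d0' ed] := posC d0; have [e' e0' ee] := posC e0.
  pose m := Num.min d' e' / 2%:R.
  have m0 : 0 < m by rewrite divr_gt0 // lt_min d0'.
  have md : m < Num.min d' e' by rewrite ltr_pdivrMr // mulr_natr mulr2n ltrDl lt_min d0'.
  have nm : `|t + m%:C - t| = m%:C.
    by rewrite addrC addKr normc_def /= expr0n addr0 sqrtr_sqr gtr0_norm.
  exists (t + m%:C); split.
  + by apply: hd; rewrite nm ed ltcR (lt_le_trans md) // ge_min lexx.
  + by rewrite -subr_eq0 -normr_eq0 nm gt_eqF // ltcR.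
  + by rewrite nm ee ltcR (lt_le_trans md) // ge_min lexx orbT.
Qed.

Lemma good_domain_interval (D : set R) : is_interval D ->
  (exists s t : R, [/\ D s, D t & s < t]) ->
  good_domain [set (r%:C : C) | r in D].
Proof.
move=> iD [a [b [Da Db ab]]].
have convD t s r : D t -> D s -> 0 <= r -> r <= 1 -> D (t + r * (s - t)).
  move=> Dt Ds r0 r1; have [st|ts] := leP t s.
    by apply: (iD t s) => //; apply/andP; split; nra.
  by apply: (iD s t) => //; apply/andP; split; nra.
apply: (@good_domain_image R _ (real_complex R : {rmorphism R -> C}) (@complex.Re R)).
- by [].
- by move=> x; rewrite normc_def /= expr0n addr0 sqrtr_sqr.
- exact: ltcR.
- exact: posC.
- exact/connected_intervalP.
- move=> t Dt; exists 1 => // s Ds _ r /andP[r0 r1].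
  exists (t + r * (s - t)); last by rewrite rmorphD rmorphM rmorphB.
  exact: convD.
- move=> t d Dt d0; have [u Du ut] : exists2 u, D u & u != t.
    by have [<-|at_] := eqVneq a t; [exists b; rewrite ?gt_eqF|exists a].
  have n0 : 0 < `|u - t| by rewrite normr_gt0 subr_eq0.
  pose m := Num.min 1 (d / 2%:R / `|u - t|).
  have m0 : 0 < m by rewrite lt_min ltr01 !divr_gt0.
  exists (t + m * (u - t)); split.
  + by apply: convD => //; rewrite ?(ltW m0) // ge_min lexx.
  + by rewrite -subr_eq0 addrC addKr mulf_neq0 ?subr_eq0 // gt_eqF.
  + rewrite addrC addKr normrM gtr0_norm // -ltr_pdivlMr // gt_min; apply/orP; right.
    by rewrite ltr_pM2r ?invr_gt0 // ltr_pdivrMr // mulr_natr mulr2n ltrDl.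
Qed.

End TimeDomains.

(** * Unconditional sums over the plane lattice *)

Section Sums.
Variable I : choiceType.
Implicit Types (A B : {fset I}).

Lemma fset_sum_split (V : nmodType) (A B : {fset I}) (f : I -> V) :
  (A `<=` B)%fset ->
  \sum_(i <- B) f i = \sum_(i <- A) f i + \sum_(i <- (B `\` A)%fset) f i.
Proof.
move=> AB; rewrite (big_fsetID _ (mem A) B) /=; congr (_ + _).
  congr (\sum_(i <- _) _); congr enum_fset.
  apply/fsetP => x; rewrite !inE /= andbC.
  by have [xA|//] := boolP (x \in A); rewrite (fsubsetP AB).
congr (\sum_(i <- _) _); congr enum_fset.
by apply/fsetP => x; rewrite !inE /= andbC.
Qed.

Lemma fset_sum_le (R : numDomainType) (A B : {fset I}) (f : I -> R) :
  (A `<=` B)%fset -> (forall i, 0 <= f i) ->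
  \sum_(i <- A) f i <= \sum_(i <- B) f i.
Proof.
move=> AB f0; rewrite (fset_sum_split _ AB).
by rewrite lerDl sumr_ge0.
Qed.

Lemma partial_sumE (V : zmodType) (f : I -> V) A :
  partial_sum f A = \sum_(i <- A) f i.
Proof. by rewrite /partial_sum big_seq_fsetE. Qed.

Section Has_sum.
Variable K : numFieldType.
Implicit Types (f g : I -> K) (s t : K).

Definition has_sum f s := partial_sum f @ totally --> s.

Lemma has_sumP f s : has_sum f s <-> forall e : K, 0 < e ->
  exists A, forall B, (A `<=` B)%fset -> `|s - \sum_(i <- B) f i| <= e.
Proof.
split=> [/cvgrPdist_le h e e0|h].
  have [A _ hA] := h e e0; exists A => B AB; rewrite -partial_sumE; exact: hA.
apply/cvgrPdist_le => e e0; have [A hA] := h e e0; exists A => // B AB.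
by rewrite partial_sumE; exact: hA.
Qed.

Lemma has_sum_unique f s t : has_sum f s -> has_sum f t -> s = t.
Proof. by move=> h1 h2; exact: (cvg_unique _ h1 h2). Qed.

Lemma has_sum_lim f s : has_sum f s -> lim (partial_sum f @ totally) = s.
Proof. by move=> h; exact/cvg_lim. Qed.

Lemma has_sum_ext f g s : f =1 g -> has_sum f s -> has_sum g s.
Proof. by move=> /funext ->. Qed.

Lemma has_sumD f g s t : has_sum f s -> has_sum g t -> has_sum (fun i => f i + g i) (s + t).
Proof.
move=> hf hg; rewrite /has_sum.
have -> : partial_sum (fun i => f i + g i) = partial_sum f \+ partial_sum g.
  by apply/funext => A; rewrite /= !partial_sumE big_split.
exact: cvgD.
Qed.

Lemma has_sumZ c f s : has_sum f s -> has_sum (fun i => c * f i) (c * s).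
Proof.
move=> hf; rewrite /has_sum.
have -> : partial_sum (fun i => c * f i) = (fun=> c) \* partial_sum f.
  by apply/funext => A; rewrite /= !partial_sumE mulr_sumr.
by apply: cvgM => //; exact: cvg_cst.
Qed.

Lemma has_sumN f s : has_sum f s -> has_sum (fun i => - f i) (- s).
Proof.
move=> /(has_sumZ (c := -1)); rewrite mulN1r; apply: has_sum_ext => i.
by rewrite mulN1r.
Qed.

Lemma has_sumB f g s t : has_sum f s -> has_sum g t -> has_sum (fun i => f i - g i) (s - t).
Proof. by move=> hf /has_sumN; exact: has_sumD. Qed.

Lemma has_sum_finite A f : (forall i, i \notin A -> f i = 0) ->
  has_sum f (\sum_(i <- A) f i).
Proof.
move=> f0; apply/has_sumP => e e0; exists A => B AB.
rewrite -(big_fset_incl _ AB); first by rewrite subrr normr0 ltW.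
by move=> x _ /f0.
Qed.

Lemma has_sum_reindex (h h' : I -> I) f s : cancel h h' -> cancel h' h ->
  has_sum f s -> has_sum (f \o h) s.
Proof.
move=> hK h'K /has_sumP H; apply/has_sumP => e e0; have [A hA] := H e e0.
exists [fset h' i | i in A]%fset => B AB.
have -> : \sum_(i <- B) (f \o h) i = \sum_(i <- [fset h i | i in B]%fset) f i.
  by rewrite big_imfset //= => x y _ _; exact: (can_inj hK).
apply: hA; apply/fsubsetP => x xA; apply/imfsetP; exists (h' x); rewrite ?h'K //.
by apply: (fsubsetP AB); apply/imfsetP; exists x.
Qed.

(** The slack e allows a proof without passing to the limit in the inequality. *)
Lemma has_sum_norm f s M : (forall A, \sum_(i <- A) `|f i| <= M) ->
  has_sum f s -> forall e, 0 < e -> `|s| <= M + e.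
Proof.
move=> hM /has_sumP H e e0; have [A /(_ A (fsubset_refl _)) hA] := H e e0.
rewrite -[s](subrK (\sum_(i <- A) f i)) addrC.
apply: le_trans (ler_normD _ _) _; rewrite lerD //.
exact: le_trans (ler_norm_sum _ _ _) (hM A).
Qed.

End Has_sum.

Section Summable.
Variable R : realType.

(** The sum is the supremum of the finite partial sums. *)
Lemma nneg_summable (g : I -> R) M : (forall i, 0 <= g i) ->
  (forall A, \sum_(i <- A) g i <= M) -> exists s, has_sum g s.
Proof.
move=> g0 hM; pose S := [set x | exists A, x = \sum_(i <- A) g i].
have S0 : S !=set0 by exists (\sum_(i <- fset0) g i), fset0.
have hS : has_sup S by split=> //; exists M => _ [A ->].
exists (sup S); apply/has_sumP => e e0.
have [_ [A ->] hA] := sup_adherent e0 hS; exists A => B AB.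
have le1 : \sum_(i <- B) g i <= sup S by apply: ub_le_sup; [exact: hS.2|exists B].
rewrite ger0_norm ?subr_ge0 // lerBlDr -lerBlDl.
by rewrite (le_trans (ltW hA)) // fset_sum_le.
Qed.

Lemma real_summable (g : I -> R) M :
  (forall A, \sum_(i <- A) `|g i| <= M) -> exists s, has_sum g s.
Proof.
move=> hM.
have [s hs] := @nneg_summable (fun i => `|g i|) M (fun i => normr_ge0 _) hM.
have [|A|t ht] := @nneg_summable (fun i => `|g i| + g i) (M + M).
- by move=> i; rewrite -lerBlDr sub0r -normrN ler_norm.
- rewrite big_split /= lerD // (le_trans _ (hM A)) // ler_sum // => i _.
  exact: ler_norm.
- exists (t - s); move: (has_sumB ht hs); apply: has_sum_ext => i.
  by rewrite addrC addKr.
Qed.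

Lemma complex_summable (f : I -> R[i]) (M : R) :
  (forall A, \sum_(i <- A) `|f i| <= M%:C) -> exists s, has_sum (f : I -> (R[i] : numFieldType)) s.
Proof.
move=> hM.
have nRe (z : R[i]) : `|complex.Re z|%:C <= `|z|.
  by rewrite normc_def lecR -sqrtr_sqr ler_wsqrtr // lerDl sqr_ge0.
have nIm (z : R[i]) : `|complex.Im z|%:C <= `|z|.
  by rewrite normc_def lecR -sqrtr_sqr ler_wsqrtr // lerDr sqr_ge0.
have [A|a ha] := @real_summable (fun i => complex.Re (f i)) M.
  by rewrite -lecR (le_trans _ (hM A)) // rmorph_sum ler_sum // => i _; exact: nRe.
have [A|b hb] := @real_summable (fun i => complex.Im (f i)) M.
  by rewrite -lecR (le_trans _ (hM A)) // rmorph_sum ler_sum // => i _; exact: nIm.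
have lift (g : I -> R) u : has_sum g u -> has_sum (fun i => (g i)%:C : (R[i] : numFieldType)) u%:C.
  move=> /has_sumP h; apply/has_sumP => e /posC [e' e0 ->].
  have [A hA] := h e' e0; exists A => B AB.
  rewrite -rmorph_sum -rmorphB normc_def /= expr0n addr0 sqrtr_sqr lecR.
  exact: hA.
exists (a%:C + 'i * b%:C); have := has_sumD (lift _ _ ha) (has_sumZ (c := 'i) (lift _ _ hb)).
by apply: has_sum_ext => i; rewrite [RHS]complexE.
Qed.

End Summable.
End Sums.

Arguments has_sumZ {I K} c {f s} _.
Arguments has_sum_unique {I K f s t} _ _.

Section Weights.
Variable R : realType.
Local Notation I := (int * int)%type.

Definition height (m : I) : nat := maxn `|m.1|%N `|m.2|%N.
(** The inverse cube of the height, set to 1 at the origin so that it can be summed over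
    the whole plane lattice. *)
Definition weight (m : I) : R := ((maxn 1 (height m))%:R ^+ 3)^-1.

Definition int_range (n : nat) : seq int := [seq (i%:Z - n%:Z) | i <- iota 0 n.*2.+1].

Lemma mem_int_range n (x : int) : (x \in int_range n) = (`|x| <= n)%N.
Proof.
apply/mapP/idP => [[j]|xn]; first by rewrite mem_iota add0n => /andP[_ j2] ->; lia.
by exists (absz (x + n%:Z)); rewrite ?mem_iota; lia.
Qed.

Definition box (n : nat) : {fset I} :=
  [fset m in [seq (x, y) | x <- int_range n, y <- int_range n]]%fset.

Lemma in_box n m : (m \in box n) = (height m <= n)%N.
Proof.
rewrite /height geq_max -!mem_int_range [LHS]in_fset; apply/allpairsP/andP => [[[x y] /= [h1 h2 ->]]|[h1 h2]] //.
by exists m; split=> //; case: m {h1 h2}.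
Qed.

Lemma card_box n : #|` box n|%fset = (n.*2.+1 * n.*2.+1)%N.
Proof.
rewrite card_fseq undup_id ?size_allpairs ?size_map ?size_iota //.
have u : uniq (int_range n).
  by rewrite map_inj_uniq ?iota_uniq // => i j /eqP; lia.
by apply: allpairs_uniq => // -[x y] [x' y'] _ _.
Qed.

Lemma weight_ge0 m : 0 <= weight m.
Proof. by rewrite invr_ge0 exprn_ge0. Qed.

(** There are 8 k points of height k, so the sum is at most 1 + 8 (1 + 1/2^2 + 1/3^2 + ...);
    the bound telescopes 1 / (k + 1)^2 <= 1 / k - 1 / (k + 1). *)
Lemma sum_weight_box n : \sum_(m <- box n.+1) weight m <= 17%:R - 8%:R / n.+1%:R.
Proof.
have step k : \sum_(m <- box k.+1) weight m =
    \sum_(m <- box k) weight m + (8 * k.+1)%:R / k.+1%:R ^+ 3.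
  have sub : (box k `<=` box k.+1)%fset.
    by apply/fsubsetP => m; rewrite !in_box => /leqW.
  rewrite (fset_sum_split _ sub); congr (_ + _).
  rewrite big_seq (eq_bigr (fun=> (k.+1%:R ^+ 3)^-1)); last first.
    move=> m; rewrite in_fsetD !in_box -ltnNge => /andP[h1 h2]; rewrite /weight.
    by have -> : maxn 1 (height m) = k.+1 by lia.
  rewrite -big_seq big_const_seq count_predT iter_addr_0 -[LHS]mulr_natl.
  congr (_%:R * _); have := cardfsDS sub; rewrite !card_box => ->.
  nia.
elim: n => [|n IH].
  rewrite step; have -> : \sum_(m <- box 0) weight m = 1.
    have -> : box 0 = [fset (0, 0)]%fset.
      apply/fsetP => m; rewrite in_box inE /height.
      by apply/idP/eqP => [|->//]; case: m => x y /= h; congr pair; lia.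
    by rewrite big_seq_fset1 /weight /= expr1n invr1.
  by rewrite expr1n muln1 !divr1; lra.
rewrite step (le_trans (lerD IH (lexx _))) //.
have n0 : (n.+1%:R : R) != 0 by rewrite pnatr_eq0.
have n1 : (n.+2%:R : R) != 0 by rewrite pnatr_eq0.
have -> : (8 * n.+2)%:R / n.+2%:R ^+ 3 = 8%:R / n.+2%:R ^+ 2 :> R.
  by rewrite natrM exprS invfM mulrA mulfK.
rewrite -lerBrDl.
have -> : 17%:R - 8%:R / n.+2%:R - (17%:R - 8%:R / n.+1%:R) = 8%:R / (n.+1%:R * n.+2%:R) :> R.
  move: n0 n1; rewrite -[n.+2%:R]natr1; move: (n.+1%:R : R) => y y0 y1.
  by field; rewrite y0 y1.
rewrite ler_pM2l // lef_pV2 ?posrE ?mulr_gt0 ?exprn_gt0 // expr2 ler_pM2r //.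
by rewrite ler_nat.
Qed.

Lemma sum_weight (A : {fset I}) : \sum_(m <- A) weight m <= 17%:R.
Proof.
pose n := \max_(m <- A) height m.
have sub : (A `<=` box n.+1)%fset.
  apply/fsubsetP => m mA; rewrite in_box leqW //.
  by rewrite /n; apply: (@leq_bigmax_seq _ (enum_fset A) xpredT height m).
rewrite (le_trans (fset_sum_le sub weight_ge0)) // (le_trans (sum_weight_box n)) //.
by rewrite gerBl divr_ge0.
Qed.

(** The criterion of convergence for all the lattice series below. *)
Lemma weight_summable (f : I -> R[i]) (M : R) :
  (forall m, `|f m| <= (M * weight m)%:C) ->
  (exists s, has_sum (f : I -> (R[i] : numFieldType)) s) /\
  forall s, has_sum (f : I -> (R[i] : numFieldType)) s -> `|s| <= (17%:R * M)%:C.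
Proof.
move=> hf; have M0 : 0 <= M.
  have := le_trans (normr_ge0 _) (hf (0, 0)); rewrite lecR /weight /= expr1n invr1.
  by rewrite mulr1.
have b (A : {fset I}) : \sum_(m <- A) `|f m| <= (17%:R * M)%:C.
  apply: (@le_trans _ _ (\sum_(m <- A) (M * weight m)%:C)); first exact: ler_sum.
  rewrite -rmorph_sum lecR -mulr_sumr mulrC; apply: ler_wpM2r => //; exact: sum_weight.
split; first exact: complex_summable b.
move=> s hs; have [r r0 er] := normC s; rewrite er lecR leNgt; apply/negP => lt.
have := has_sum_norm (K := R[i]) b hs (e := ((r - 17%:R * M) / 2%:R)%:C).
rewrite ltcR divr_gt0 ?subr_gt0 // er -rmorphD lecR => /(_ isT); lra.
Qed.

End Weights.

(** * Second order Taylor expansions *)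

Section RealNorm.
Variable R : realType.
Local Notation C := (R[i] : numFieldType).
Implicit Types (x y z h : C).

(** The norm of R[i] takes its values in R[i]; this is its real value. *)
Definition nm z : R := complex.Re `|z|.

Lemma nmE z : `|z| = (nm z)%:C.
Proof. by rewrite /nm; have [r _ ->] := normC z. Qed.

Lemma nm_ge0 z : 0 <= nm z.
Proof. by rewrite -lecR -nmE normr_ge0. Qed.

Lemma nmM x y : nm (x * y) = nm x * nm y.
Proof. by apply: (@complexI R); rewrite rmorphM -!nmE normrM. Qed.

Lemma nmX x n : nm (x ^+ n) = nm x ^+ n.
Proof. by apply: (@complexI R); rewrite rmorphXn -!nmE normrX. Qed.

Lemma nmV x : nm x^-1 = (nm x)^-1.
Proof. by apply: (@complexI R); rewrite fmorphV -!nmE normfV. Qed.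

Lemma nmN x : nm (- x) = nm x.
Proof. by rewrite /nm normrN. Qed.

Lemma nm_distC x y : nm (x - y) = nm (y - x).
Proof. by rewrite /nm distrC. Qed.

Lemma nmD x y : nm (x + y) <= nm x + nm y.
Proof. by rewrite -lecR rmorphD -!nmE ler_normD. Qed.

Lemma nm_sub x y : nm x - nm y <= nm (x - y).
Proof. by rewrite lerBlDr (le_trans _ (nmD _ _)) // subrK. Qed.

Lemma nm0 : nm 0 = 0.
Proof. by rewrite /nm normr0. Qed.

Lemma nm1 : nm 1 = 1.
Proof. by rewrite /nm normr1. Qed.

Lemma nm_eq0 x : (nm x == 0) = (x == 0).
Proof. by rewrite -(inj_eq (@complexI R)) -nmE normr_eq0. Qed.

Lemma nm_gt0 x : (0 < nm x) = (x != 0).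
Proof. by rewrite lt_def nm_eq0 nm_ge0 andbT. Qed.

Lemma nm_real (r : R) : nm r%:C = `|r|.
Proof. by rewrite /nm normc_def /= expr0n addr0 sqrtr_sqr. Qed.

Lemma nm_nat n : nm n%:R = n%:R.
Proof. by rewrite -(rmorph_nat (real_complex R)) nm_real ger0_norm. Qed.

(** Second order expansions suffice for the maximum principle, and for series of
    functions they follow from termwise estimates. *)
Definition taylor2 (f : C -> C) z (a1 a2 : C) := exists B d : R,
  [/\ 0 < d, 0 <= B & forall h, nm h < d ->
    nm (f (z + h) - (f z + a1 * h + a2 * h ^+ 2)) <= B * nm h ^+ 3].

Lemma taylor2_cst c z : taylor2 (fun=> c) z 0 0.
Proof. by exists 0, 1; split=> // h _; rewrite !mul0r !addr0 subrr nm0. Qed.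

Lemma taylor2_id z : taylor2 id z 1 0.
Proof. by exists 0, 1; split=> // h _; rewrite !mul0r !addr0 mul1r subrr nm0. Qed.

Lemma taylor2_ext f g z a1 a2 : f =1 g -> taylor2 f z a1 a2 -> taylor2 g z a1 a2.
Proof. by move=> /funext ->. Qed.

Lemma taylor2D f g z a1 a2 b1 b2 : taylor2 f z a1 a2 -> taylor2 g z b1 b2 ->
  taylor2 (fun x => f x + g x) z (a1 + b1) (a2 + b2).
Proof.
move=> [B [d [d0 B0 hf]]] [B' [d' [d0' B0' hg]]].
exists (B + B'), (Num.min d d'); split=> [||h]; rewrite ?lt_min ?d0 ?addr_ge0 //.
move=> /andP[/hf h1 /hg h2].
have -> : f (z + h) + g (z + h) - (f z + g z + (a1 + b1) * h + (a2 + b2) * h ^+ 2) =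
  (f (z + h) - (f z + a1 * h + a2 * h ^+ 2)) + (g (z + h) - (g z + b1 * h + b2 * h ^+ 2)) by ring.
by apply: le_trans (nmD _ _) _; rewrite mulrDl lerD.
Qed.

Lemma quad_le (a0 a1 a2 h : C) : nm h <= 1 ->
  nm (a0 + a1 * h + a2 * h ^+ 2) <= nm a0 + nm a1 + nm a2.
Proof.
move=> h1; apply: le_trans (nmD _ _) _; apply: lerD.
  by apply: le_trans (nmD _ _) _; rewrite lerD // nmM ler_piMr ?nm_ge0.
by rewrite nmM nmX ler_piMr ?nm_ge0 // exprn_ile1 ?nm_ge0.
Qed.

Lemma taylor2M f g z a1 a2 b1 b2 : taylor2 f z a1 a2 -> taylor2 g z b1 b2 ->
  taylor2 (fun x => f x * g x) z (a1 * g z + f z * b1) (a2 * g z + a1 * b1 + f z * b2).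
Proof.
move=> [B [d [d0 B0 hf]]] [B' [d' [d0' B0' hg]]].
pose M := nm (f z) + nm a1 + nm a2; pose M' := nm (g z) + nm b1 + nm b2.
have M0 : 0 <= M by rewrite !addr_ge0 ?nm_ge0.
have M'0 : 0 <= M' by rewrite !addr_ge0 ?nm_ge0.
pose e := nm (a1 * b2 + a2 * b1) + nm (a2 * b2).
have e0 : 0 <= e by rewrite addr_ge0 ?nm_ge0.
have G0 : 0 <= M * B' + B * (M' + B') + e.
  by apply: addr_ge0 => //; apply: addr_ge0; apply: mulr_ge0 => //; exact: addr_ge0.
exists (M * B' + B * (M' + B') + e), (Num.min 1 (Num.min d d')).
split=> [|//|h]; rewrite ?lt_min ?ltr01 ?d0 //.
move=> /and3P[/ltW h1 /hf hr /hg hs].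
set p := f z + a1 * h + a2 * h ^+ 2 in hr; set q := g z + b1 * h + b2 * h ^+ 2 in hs.
have -> : f (z + h) * g (z + h) - (f z * g z + (a1 * g z + f z * b1) * h +
    (a2 * g z + a1 * b1 + f z * b2) * h ^+ 2) =
  p * (g (z + h) - q) + (f (z + h) - p) * (q + (g (z + h) - q)) +
  h ^+ 3 * (a1 * b2 + a2 * b1 + a2 * b2 * h) by rewrite /p /q; ring.
have h3 : nm h ^+ 3 <= 1 by rewrite exprn_ile1 ?nm_ge0.
have hp : nm p <= M by exact: quad_le.
have hq : nm q <= M' by exact: quad_le.
have he : nm (a1 * b2 + a2 * b1 + a2 * b2 * h) <= e.
  by apply: le_trans (nmD _ _) _; rewrite lerD // nmM ler_piMr ?nm_ge0.
apply: le_trans (nmD _ _) _; rewrite [leRHS]mulrDl; apply: lerD; last first.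
  by rewrite nmM nmX mulrC ler_wpM2r // exprn_ge0 ?nm_ge0.
have k0 : 0 <= nm h ^+ 3 by rewrite exprn_ge0 ?nm_ge0.
apply: le_trans (nmD _ _) _; rewrite [leRHS]mulrDl !nmM; apply: lerD.
  by rewrite -mulrA; apply: ler_pM => //; exact: nm_ge0.
have hs' : nm (g (z + h) - q) <= B' by rewrite (le_trans hs) // ler_piMr.
rewrite [leRHS]mulrAC; apply: ler_pM; rewrite ?nm_ge0 //.
by apply: le_trans (nmD _ _) _; exact: lerD.
Qed.

Lemma taylor2_lip f z a1 a2 : taylor2 f z a1 a2 ->
  exists B d : R, [/\ 0 < d, 0 <= B & forall h, nm h < d ->
    nm (f (z + h) - f z) <= B * nm h].
Proof.
move=> [B [d [d0 B0 hf]]]; exists (nm a1 + nm a2 + B), (Num.min 1 d).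
split=> [||h]; rewrite ?lt_min ?ltr01 ?d0 ?addr_ge0 ?nm_ge0 //.
move=> /andP[/ltW h1 /hf hr].
have -> : f (z + h) - f z =
  (a1 * h + a2 * h ^+ 2) + (f (z + h) - (f z + a1 * h + a2 * h ^+ 2)) by ring.
apply: le_trans (nmD _ _) _; rewrite [leRHS]mulrDl; apply: lerD; last first.
  by rewrite (le_trans hr) // ler_wpM2l // exprS ler_piMr ?nm_ge0 // exprn_ile1 ?nm_ge0.
apply: le_trans (nmD _ _) _; rewrite [leRHS]mulrDl; apply: lerD; first by rewrite nmM.
by rewrite nmM nmX ler_wpM2l ?nm_ge0 // exprS ler_piMr ?nm_ge0 // expr1.
Qed.

(** With q the expected expansion of 1 / f and p that of f, the product p q is 1 up to
    third order, and 1 / f - q = (1 - f q) / f. *)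
Lemma taylor2V f z a1 a2 : f z != 0 -> taylor2 f z a1 a2 ->
  taylor2 (fun x => (f x)^-1) z (- a1 / f z ^+ 2) ((a1 ^+ 2 - a2 * f z) / f z ^+ 3).
Proof.
move=> fz0 hf; have [L [d [d0 L0 hL]]] := taylor2_lip hf.
set b1 := - a1 / _; set b2 := (_ - _) / _.
have [B [e [e0 B0 hB]]] := hf.
pose q h := (f z)^-1 + b1 * h + b2 * h ^+ 2.
pose M := nm (f z)^-1 + nm b1 + nm b2.
have M0 : 0 <= M by rewrite !addr_ge0 ?nm_ge0.
pose k h := a1 * b2 + a2 * b1 + a2 * b2 * h.
pose E := nm (a1 * b2 + a2 * b1) + nm (a2 * b2).
have E0 : 0 <= E by rewrite addr_ge0 ?nm_ge0.
have nf : 0 < nm (f z) by rewrite nm_gt0.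
pose d' := nm (f z) / (2%:R * (L + 1)).
have L1 : 0 < L + 1 by rewrite ltr_pwDr.
have d'0 : 0 < d' by rewrite divr_gt0 // mulr_gt0.
have G0 : 0 <= 2%:R / nm (f z) * (B * M + E).
  apply: mulr_ge0; first by rewrite divr_ge0 ?nm_ge0.
  by apply: addr_ge0 => //; exact: mulr_ge0.
exists (2%:R / nm (f z) * (B * M + E)), (Num.min 1 (Num.min d (Num.min e d'))).
split=> [|//|h]; rewrite ?lt_min ?ltr01 ?d0 ?e0 //.
move=> /and4P[/ltW h1 /hL hl /hB hb hd'].
have fl : nm (f z) / 2%:R <= nm (f (z + h)).
  have l2 : nm (f (z + h) - f z) <= nm (f z) / 2%:R.
    apply: le_trans hl _; apply: (@le_trans _ _ ((L + 1) * d')).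
      by apply: ler_pM; rewrite ?nm_ge0 ?lerDl // ltW.
    by rewrite /d'; move: (nm (f z)) L1 => x; move: (L + 1) => y y0;
      rewrite le_eqVlt; apply/orP; left; apply/eqP; field; rewrite gt_eqF.
  have := nm_sub (f z) (f (z + h)); rewrite nm_distC => l3; lra.
have fz1 : f (z + h) != 0 by rewrite -nm_gt0 (lt_le_trans _ fl) // divr_gt0.
rewrite -/b1 -/b2 -/(q h).
have -> : (f (z + h))^-1 - q h = (f (z + h))^-1 *
   (- ((f (z + h) - (f z + a1 * h + a2 * h ^+ 2)) * q h) - h ^+ 3 * k h).
  apply: (mulfI fz1); rewrite mulrBr mulfV // mulrA mulfV // mul1r.
  by rewrite /q /k /b1 /b2; field.
rewrite nmM nmV -[X in _ <= X]mulrA; apply: ler_pM; rewrite ?nm_ge0 ?invr_ge0 ?nm_ge0 //.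
  by rewrite -[2%:R / _]invrK invf_div lef_pV2 ?posrE ?divr_gt0 // (lt_le_trans _ fl) ?divr_gt0.
apply: le_trans (nmD _ _) _; rewrite !nmN [leRHS]mulrDl; apply: lerD.
  by rewrite nmM [leRHS]mulrAC; apply: ler_pM; rewrite ?nm_ge0 //; exact: quad_le.
rewrite nmM nmX mulrC ler_wpM2r ?exprn_ge0 ?nm_ge0 //.
by apply: le_trans (nmD _ _) _; rewrite lerD // nmM ler_piMr ?nm_ge0.
Qed.

Lemma taylor2_has_derivative (D : set C) f z a1 a2 : D z -> taylor2 f z a1 a2 ->
  has_derivative D f z a1.
Proof.
move=> Dz [B [d [d0 B0 hf]]]; apply/has_derivativeP => // e /posC [r r0 ->].
pose K := nm a2 + B + 1; have K0 : 0 < K by rewrite ltr_pwDr // addr_ge0 ?nm_ge0.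
exists (Num.min 1 (Num.min d (r / K)))%:C; first by rewrite ltcR !lt_min ltr01 d0 divr_gt0.
move=> s Ds; rewrite !nmE ltcR !lt_min => /and3P[/ltW h1 hd hr].
have := hf _ hd; rewrite [z + _]addrC subrK => hh; rewrite -rmorphM lecR.
have -> : f s - f z - a1 * (s - z) = (f s - (f z + a1 * (s - z) + a2 * (s - z) ^+ 2))
   + a2 * (s - z) ^+ 2 by ring.
apply: le_trans (nmD _ _) _; rewrite nmM nmX.
have n0 := nm_ge0 (s - z); have n2 := nm_ge0 a2.
have : nm (s - z) * K <= r by rewrite -ler_pdivlMr // ltW.
move: hh h1 n0; rewrite /K; move: (nm (s - z)) (nm (f s - _)) (nm a2) n2 => u v w w0 hh h1 u0 hk.
apply: (@le_trans _ _ (u * ((w + B + 1) * u))); last by rewrite mulrA ler_wpM2r.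
apply: (@le_trans _ _ (B * u ^+ 3 + w * u ^+ 2)); first by rewrite lerD2r.
have : B * u ^+ 3 <= B * u ^+ 2.
  by rewrite ler_wpM2l // exprSr ler_piMr // exprn_ge0.
by move=> h3; have := sqr_ge0 u; lra.
Qed.

End RealNorm.

Section Remainders.
Variable R : realType.
Local Notation C := (R[i] : numFieldType).
Implicit Types (x y z h a : C).

Lemma cubic_le (a0 a1 a2 a3 : nat) y : nm y <= 2^-1 ->
  nm (a0%:R + a1%:R * y + a2%:R * y ^+ 2 + a3%:R * y ^+ 3) <= (a0 + a1 + a2 + a3)%:R.
Proof.
move=> y2; have y1 : nm y <= 1 by rewrite (le_trans y2) // invf_le1 ?ler1n.
have e k (b : nat) : nm (b%:R * y ^+ k) <= b%:R.
  by rewrite nmM nm_nat nmX ler_piMr // exprn_ile1 ?nm_ge0.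
rewrite !natrD.
apply: le_trans (nmD _ _) _; apply: lerD (e _ _).
apply: le_trans (nmD _ _) _; apply: lerD (e _ _).
apply: le_trans (nmD _ _) _; apply: lerD; last by have := e 1%N a1; rewrite expr1.
by rewrite nm_nat.
Qed.

Lemma half_unit y : nm y <= 2^-1 -> 1 + y != 0 /\ nm (1 + y)^-1 <= 2%:R.
Proof.
move=> y2; have h : 2^-1 <= nm (1 + y).
  by have := nm_sub 1 (- y); rewrite opprK nmN nm1; lra.
have n0 : 1 + y != 0 by rewrite -nm_gt0 (lt_le_trans _ h) // invr_gt0.
by split=> //; rewrite nmV -[2%:R]invrK lef_pV2 ?posrE ?invr_gt0 // nm_gt0.
Qed.

(** With y = h / a and |y| <= 1/2, the expansion of (1 + y)^-k to order n is a
    polynomial, and the remainder is y^n times a cubic over (1 + y)^k; the cubic is at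
    most the sum of its coefficients a0, ..., a3 and |1 + y|^-k at most 2^k. The
    sign s only serves to have natural coefficients. *)
Lemma binomial_remainder (k n a0 a1 a2 a3 : nat) (s P : C) a h :
  a != 0 -> nm h <= nm a / 2%:R -> nm s = 1 ->
  (forall y, 1 + y != 0 -> h = a * y ->
     a ^- k * (1 + y) ^- k - P = a ^- k * (s * y ^+ n *
      (a0%:R + a1%:R * y + a2%:R * y ^+ 2 + a3%:R * y ^+ 3) * (1 + y) ^- k)) ->
  nm ((a + h) ^- k - P) <=
  2%:R ^+ k * (a0 + a1 + a2 + a3)%:R * (nm h ^+ n / nm a ^+ (n + k)).
Proof.
move=> an0 ha s1 hP; have na : 0 < nm a by rewrite nm_gt0.
set y := h / a; have hy : h = a * y by rewrite mulrC divfK.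
have y2 : nm y <= 2^-1 by rewrite nmM nmV ler_pdivrMr // mulrC.
have [y0 y1] := half_unit y2.
have -> : (a + h) ^- k = a ^- k * (1 + y) ^- k.
  by rewrite hy -exprVn -exprVn -exprVn -exprMn -invfM; congr (_^-1 ^+ _); ring.
rewrite (hP y y0 hy) !nmM s1 mul1r nmV !nmX.
have -> : nm ((1 + y) ^- k) = nm (1 + y)^-1 ^+ k by rewrite -exprVn nmX.
have -> : nm h ^+ n / nm a ^+ (n + k) = (nm a ^+ k)^-1 * nm y ^+ n.
  by rewrite [nm y]nmM nmV exprMn exprVn exprD invfM; ring.
have -> : 2%:R ^+ k * (a0 + a1 + a2 + a3)%:R * ((nm a ^+ k)^-1 * nm y ^+ n) =
  (nm a ^+ k)^-1 * (nm y ^+ n * ((a0 + a1 + a2 + a3)%:R * 2%:R ^+ k)) by ring.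
rewrite -!mulrA; apply: ler_wpM2l; first by rewrite invr_ge0 exprn_ge0 ?nm_ge0.
apply: ler_wpM2l; first by rewrite exprn_ge0 ?nm_ge0.
by apply: ler_pM; rewrite ?nm_ge0 ?exprn_ge0 ?nm_ge0 // ?cubic_le // lerXn2r ?nnegrE ?nm_ge0.
Qed.

Lemma remainder_2_3 a h : a != 0 -> nm h <= nm a / 2%:R ->
  nm ((a + h) ^- 2 - (a ^- 2 - 2%:R * a ^- 3 * h + 3%:R * a ^- 4 * h ^+ 2)) <=
  28%:R * (nm h ^+ 3 / nm a ^+ 5).
Proof.
move=> a0 ha; have := @binomial_remainder 2 3 4 3 0 0 (-1)
  (a ^- 2 - 2%:R * a ^- 3 * h + 3%:R * a ^- 4 * h ^+ 2) a h a0 ha.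
rewrite nmN nm1 -natrX -natrM; apply=> // y y0 ->; field.
by rewrite y0 a0.
Qed.

Lemma remainder_3_3 a h : a != 0 -> nm h <= nm a / 2%:R ->
  nm ((a + h) ^- 3 - (a ^- 3 - 3%:R * a ^- 4 * h + 6%:R * a ^- 5 * h ^+ 2)) <=
  248%:R * (nm h ^+ 3 / nm a ^+ 6).
Proof.
move=> a0 ha; have := @binomial_remainder 3 3 10 15 6 0 (-1)
  (a ^- 3 - 3%:R * a ^- 4 * h + 6%:R * a ^- 5 * h ^+ 2) a h a0 ha.
rewrite nmN nm1 -natrX -natrM; apply=> // y y0 ->; field.
by rewrite y0 a0.
Qed.

Lemma remainder_4_3 a h : a != 0 -> nm h <= nm a / 2%:R ->
  nm ((a + h) ^- 4 - (a ^- 4 - 4%:R * a ^- 5 * h + 10%:R * a ^- 6 * h ^+ 2)) <=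
  1776%:R * (nm h ^+ 3 / nm a ^+ 7).
Proof.
move=> a0 ha; have := @binomial_remainder 4 3 20 45 36 10 (-1)
  (a ^- 4 - 4%:R * a ^- 5 * h + 10%:R * a ^- 6 * h ^+ 2) a h a0 ha.
rewrite nmN nm1 -natrX -natrM; apply=> // y y0 ->; field.
by rewrite y0 a0.
Qed.

Lemma remainder_2_6 a h : a != 0 -> nm h <= nm a / 2%:R ->
  nm ((a + h) ^- 2 - (a ^- 2 - 2%:R * a ^- 3 * h + 3%:R * a ^- 4 * h ^+ 2
    - 4%:R * a ^- 5 * h ^+ 3 + 5%:R * a ^- 6 * h ^+ 4 - 6%:R * a ^- 7 * h ^+ 5)) <=
  52%:R * (nm h ^+ 6 / nm a ^+ 8).
Proof.
move=> a0 ha; have := @binomial_remainder 2 6 7 6 0 0 1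
  (a ^- 2 - 2%:R * a ^- 3 * h + 3%:R * a ^- 4 * h ^+ 2
    - 4%:R * a ^- 5 * h ^+ 3 + 5%:R * a ^- 6 * h ^+ 4 - 6%:R * a ^- 7 * h ^+ 5) a h a0 ha.
rewrite nm1 -natrX -natrM; apply=> // y y0 ->; field.
by rewrite y0 a0.
Qed.

Lemma remainder_3_5 a h : a != 0 -> nm h <= nm a / 2%:R ->
  nm ((a + h) ^- 3 - (a ^- 3 - 3%:R * a ^- 4 * h + 6%:R * a ^- 5 * h ^+ 2
    - 10%:R * a ^- 6 * h ^+ 3 + 15%:R * a ^- 7 * h ^+ 4)) <=
  568%:R * (nm h ^+ 5 / nm a ^+ 8).
Proof.
move=> a0 ha; have := @binomial_remainder 3 5 21 35 15 0 (-1)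
  (a ^- 3 - 3%:R * a ^- 4 * h + 6%:R * a ^- 5 * h ^+ 2
    - 10%:R * a ^- 6 * h ^+ 3 + 15%:R * a ^- 7 * h ^+ 4) a h a0 ha.
rewrite nmN nm1 -natrX -natrM; apply=> // y y0 ->; field.
by rewrite y0 a0.
Qed.

Lemma remainder_4_2 a h : a != 0 -> nm h <= nm a / 2%:R ->
  nm ((a + h) ^- 4 - (a ^- 4 - 4%:R * a ^- 5 * h)) <=
  784%:R * (nm h ^+ 2 / nm a ^+ 6).
Proof.
move=> a0 ha; have := @binomial_remainder 4 2 10 20 15 4 1
  (a ^- 4 - 4%:R * a ^- 5 * h) a h a0 ha.
rewrite nm1 -natrX -natrM; apply=> // y y0 ->; field.
by rewrite y0 a0.
Qed.

End Remainders.

(** * The hexagonal lattice *)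

Section Hexagonal.
Variable R : realType.
Local Notation C := (R[i] : numFieldType).
Local Notation I := (int * int)%type.
Implicit Types (x y z h : C) (m : I).

(** A primitive sixth root of unity. *)
Definition rho : C := (2^-1 +i* (Num.sqrt 3%:R / 2%:R))%C.

Lemma sqrt3 : Num.sqrt 3%:R ^+ 2 = 3%:R :> R.
Proof. by rewrite sqr_sqrtr. Qed.

Lemma rho_sqr : rho ^+ 2 = rho - 1.
Proof.
have s3 := sqrt3; apply/eqP; rewrite /rho expr2 eq_complex /=; apply/andP; split; apply/eqP.
  by move: s3; move: (Num.sqrt _) => s s3; nra.
by field.
Qed.

Lemma nm_sqr z : nm z ^+ 2 = complex.Re z ^+ 2 + complex.Im z ^+ 2.
Proof. by rewrite /nm normc_def /= sqr_sqrtr // addr_ge0 ?sqr_ge0. Qed.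

Definition hex m : C := m.1%:~R + m.2%:~R * rho.
(** The norm form of the Eisenstein integers. *)
Definition hexnorm m : R := m.1%:~R ^+ 2 + m.1%:~R * m.2%:~R + m.2%:~R ^+ 2.

Lemma nm_hex m : nm (hex m) ^+ 2 = hexnorm m.
Proof.
have e (n : int) : (n%:~R : C) = (n%:~R : R)%:C by rewrite rmorph_int.
rewrite nm_sqr /hex /hexnorm !e /rho /=.
have s3 := sqrt3; move: s3; move: (Num.sqrt _) (m.1%:~R) (m.2%:~R) => s a b s3.
transitivity ((a + b / 2%:R) ^+ 2 + b ^+ 2 * s ^+ 2 / 4%:R).
  by field.
by rewrite s3; field.
Qed.

Lemma hexnorm_int m : hexnorm m = (m.1 ^+ 2 + m.1 * m.2 + m.2 ^+ 2)%:~R.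
Proof. by rewrite /hexnorm !rmorphD /= !rmorphXn /= rmorphM. Qed.

(** Complete the square in the coordinate of smaller absolute value. *)
Lemma hexnorm_height m : 3%:R * (height m)%:R ^+ 2 <= 4%:R * hexnorm m.
Proof.
have : 3%:Z * (height m)%:Z ^+ 2 <= 4%:Z * (m.1 ^+ 2 + m.1 * m.2 + m.2 ^+ 2).
  have sq (x : int) : (`|x|%N)%:Z ^+ 2 = x ^+ 2 by rewrite abszE real_normK ?num_real.
  rewrite -subr_ge0 /height /maxn; case: ifP => _; rewrite sq.
    have -> : 4%:Z * (m.1 ^+ 2 + m.1 * m.2 + m.2 ^+ 2) - 3%:Z * m.2 ^+ 2
      = (2%:Z * m.1 + m.2) ^+ 2 by ring.
    exact: sqr_ge0.
  have -> : 4%:Z * (m.1 ^+ 2 + m.1 * m.2 + m.2 ^+ 2) - 3%:Z * m.1 ^+ 2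
    = (2%:Z * m.2 + m.1) ^+ 2 by ring.
  exact: sqr_ge0.
by rewrite -(ler_int R) rmorphM /= (rmorphM _ 4%:Z) /= -hexnorm_int rmorphXn.
Qed.

Lemma hexnorm_ge1 m : m != (0, 0) -> 1 <= hexnorm m.
Proof.
move=> m0; rewrite hexnorm_int -[1]/(1%:~R) ler_int.
case: m m0 => a b /=; rewrite xpair_eqE; nia.
Qed.

Variable Om : C.
Hypothesis Om0 : Om != 0.

Definition om m : C := lattice_point Om (Om * rho) m.

Lemma omE m : om m = Om * hex m.
Proof. by rewrite /om /lattice_point /hex; ring. Qed.

Lemma omD m n : om (m.1 + n.1, m.2 + n.2) = om m + om n.
Proof. by rewrite !omE /hex /= !rmorphD; ring. Qed.

Lemma omN m : om (- m.1, - m.2) = - om m.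
Proof. by rewrite !omE /hex /= !rmorphN; ring. Qed.

(** The symmetry of order six: rho (m + n rho) = - n + (m + n) rho. *)
Lemma om_rho m : om (- m.2, m.1 + m.2) = rho * om m.
Proof.
rewrite !omE /hex /= rmorphN rmorphD /=.
apply: (eq_of_sub (c := Om * m.2%:~R * (rho - 1)) (d := Om * m.2%:~R * rho ^+ 2)).
  by rewrite rho_sqr.
ring.
Qed.

Lemma om0 : om (0, 0) = 0.
Proof. by rewrite omE /hex /= !mul0r addr0 mulr0. Qed.

Let o := nm Om.
Let o0 : 0 < o. Proof. by rewrite nm_gt0. Qed.

Lemma om_height m : (height m)%:R <= 2%:R / o * nm (om m).
Proof.
rewrite omE nmM -/o; set t := nm (hex m).
have -> : 2%:R / o * (o * t) = 2%:R * t by field; rewrite gt_eqF.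
have := hexnorm_height m; rewrite -nm_hex -/t => e.
have t0 : 0 <= t := nm_ge0 _.
rewrite -(ler_sqr (x := (height m)%:R)) ?nnegrE ?mulr_ge0 // exprMn.
by have := sqr_ge0 ((height m)%:R : R); move: e; move: ((height m)%:R : R) => u; nra.
Qed.

Lemma om_ge m : m != (0, 0) -> o <= nm (om m).
Proof.
move=> /hexnorm_ge1; rewrite -nm_hex omE nmM -/o; set t := nm (hex m) => t2.
have t0 : 0 <= t := nm_ge0 _.
by rewrite ler_peMr ?(ltW o0) //; nra.
Qed.

Lemma om_eq0 m : (om m == 0) = (m == (0, 0)).
Proof.
apply/eqP/eqP => [e|->]; last exact: om0.
apply/eqP; apply/negPn/negP => /om_ge; rewrite e nm0 leNgt => /negP[]; exact: o0.
Qed.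

Definition lattice : set C := [set z | in_lattice Om (Om * rho) z].

Lemma lattice_om m : lattice (om m).
Proof. by exists m. Qed.

Lemma lattice_sub z m : lattice (z - om m) -> lattice z.
Proof.
move=> [n e]; exists (n.1 + m.1, n.2 + m.2).
by rewrite -/(om _) omD /om -e subrK.
Qed.

Lemma lattice_add z m : lattice (z + om m) -> lattice z.
Proof. by rewrite -[om m]opprK -omN; exact: lattice_sub. Qed.

Lemma lattice_opp z : lattice (- z) -> lattice z.
Proof. by move=> [n e]; exists (- n.1, - n.2); rewrite -/(om _) omN /om -e opprK. Qed.

(** Two lattice points are at least |Om| apart, so at most one of them is closer to z
    than |Om| / 2. *)
Lemma lattice_dist z : ~ lattice z -> exists2 d : R, 0 < d & forall m, d <= nm (z - om m).
Proof.
move=> zL.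
have [[m0 hm]|h] := pselect (exists m, nm (z - om m) < o / 2%:R); last first.
  exists (o / 2%:R); rewrite ?divr_gt0 // => m; rewrite leNgt; apply/negP => lt.
  by apply: h; exists m.
have n0 : 0 < nm (z - om m0).
  by rewrite nm_gt0 subr_eq0; apply/eqP => e; apply: zL; rewrite e; exact: lattice_om.
exists (Num.min (nm (z - om m0)) (o / 2%:R)); first by rewrite lt_min n0 divr_gt0.
move=> m; rewrite ge_min; have [->|mm] := eqVneq m m0; first by rewrite lexx.
apply/orP; right.
have := @om_ge (m.1 - m0.1, m.2 - m0.2).
have -> : om (m.1 - m0.1, m.2 - m0.2) = om m - om m0 by rewrite -omN -omD.
move=> /(_ _)/le_trans; have -> : om m - om m0 = (z - om m0) - (z - om m) by ring.
move=> h; have := h _ _ (nmD _ _); rewrite nmN => {}h.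
have : o <= nm (z - om m0) + nm (z - om m).
  apply: h; rewrite -[(0, 0)]/((0 : int), (0 : int)); apply: contraNneq mm => -[/eqP e1 /eqP e2].
  by move: e1 e2; rewrite !subr_eq0 => /eqP e1 /eqP e2; rewrite [m]surjective_pairing e1 e2 -surjective_pairing.
lra.
Qed.

Lemma off_lattice_height z : ~ lattice z -> exists2 c : R, 0 <= c &
  forall m, (maxn 1 (height m))%:R <= c * nm (z - om m).
Proof.
move=> /lattice_dist [d d0 hd].
exists (d^-1 + 2%:R / o * (1 + nm z / d)).
  apply: addr_ge0; first by rewrite invr_ge0 ltW.
  apply: mulr_ge0; first by rewrite divr_ge0 // ltW.
  by apply: addr_ge0 => //; rewrite divr_ge0 ?nm_ge0 // ltW.
move=> m; have h1 : 1 <= d^-1 * nm (z - om m) by rewrite mulrC ler_pdivlMr // mul1r.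
have h2 : (height m)%:R <= 2%:R / o * (1 + nm z / d) * nm (z - om m).
  apply: le_trans (om_height m) _; rewrite -[leRHS]mulrA; apply: ler_wpM2l; first by rewrite divr_ge0 ?(ltW o0).
  have := nm_sub (om m) z; rewrite lerBlDr nm_distC => /le_trans; apply.
  by rewrite mulrDl mul1r lerD2l -mulrA ler_peMr ?nm_ge0.
have h3 : 0 <= d^-1 * nm (z - om m) by apply: le_trans h1.
have h4 : 0 <= 2%:R / o * (1 + nm z / d) * nm (z - om m) by apply: le_trans h2.
rewrite mulrDl /maxn; case: ifP => _; [apply: le_trans h2 _|apply: le_trans h1 _]; lra.
Qed.

Lemma weight_ge (c r : R) m : 0 <= c -> (maxn 1 (height m))%:R <= c * r ->
  (r ^+ 3)^-1 <= c ^+ 3 * weight R m.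
Proof.
move=> c0 h; have M1 : 1 <= (maxn 1 (height m))%:R :> R by rewrite ler1n leq_max.
have cr : 0 < c * r by apply: lt_le_trans h; apply: lt_le_trans M1.
have c1 : 0 < c.
  by rewrite lt_def c0 andbT; apply: contraTneq cr => ->; rewrite mul0r ltxx.
have r1 : 0 < r by rewrite -(pmulr_rgt0 _ c1).
rewrite /weight; set u := (maxn 1 _)%:R in h M1 *.
have u0 : 0 < u by apply: lt_le_trans M1.
rewrite -ler_pdivrMl ?exprn_gt0 // -invfM -exprMn lef_pV2 ?posrE ?exprn_gt0 //.
by rewrite lerXn2r ?nnegrE ?(ltW u0) ?(ltW cr).
Qed.

Lemma nm_summable (f : I -> C) (M : R) : (forall m, nm (f m) <= M * weight R m) ->
  (exists s, has_sum f s) /\ forall s, has_sum f s -> nm s <= 17%:R * M.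
Proof.
move=> hf; have [|h1 h2] := @weight_summable R f M.
  by move=> m; rewrite nmE lecR.
by split=> // s /h2; rewrite nmE lecR.
Qed.

End Hexagonal.

(** * Lattice sums *)

Section Series.
Variable R : realType.
Local Notation C := (R[i] : numFieldType).
Local Notation I := (int * int)%type.
Implicit Types (x y z h : C) (m : I).

Variable Om : C.
Hypothesis Om0 : Om != 0.
Local Notation om := (om Om).
Local Notation lattice := (lattice Om).
Local Notation weight := (weight R).
Let o := nm Om.
Let o0 : 0 < o. Proof. by rewrite nm_gt0. Qed.

(** The Weierstrass function of a hexagonal lattice. *)
Definition wpz z : C := wp Om (Om * rho R) z.
(** The series over all lattice points w of (z - w)^-k; up to a factor, a derivative of wp
    for k >= 3. *)
Definition eisen (k : nat) z : C := lim (partial_sum (fun m => (z - om m) ^- k) @ totally).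
(** The origin contributes nothing, as 0^-1 = 0. *)
Definition eisen0 (k : nat) : C := lim (partial_sum (fun m => om m ^- k) @ totally).

Lemma inv_pow_le (r d : R) j : 0 < d -> d <= r ->
  (r ^+ (3 + j))^-1 <= (d ^+ j)^-1 * (r ^+ 3)^-1.
Proof.
move=> d0 dr; have r0 : 0 < r by apply: lt_le_trans dr.
rewrite exprD invfM mulrC ler_wpM2r ?invr_ge0 ?exprn_ge0 ?(ltW r0) //.
by rewrite lef_pV2 ?posrE ?exprn_gt0 // lerXn2r ?nnegrE ?(ltW r0) ?(ltW d0).
Qed.

Lemma off_lattice_weight z j : ~ lattice z -> exists2 M : R, 0 <= M & forall m,
  (nm (z - om m) ^+ (3 + j))^-1 <= M * weight m.
Proof.
move=> zL; have [d d0 hd] := lattice_dist Om0 zL; have [c c0 hc] := off_lattice_height Om0 zL.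
exists ((d ^+ j)^-1 * c ^+ 3).
  by rewrite mulr_ge0 ?invr_ge0 ?exprn_ge0 // ltW.
move=> m; apply: le_trans (inv_pow_le j d0 (hd m)) _.
rewrite -mulrA ler_wpM2l ?invr_ge0 ?exprn_ge0 ?(ltW d0) //.
exact: weight_ge.
Qed.

Lemma lattice_height m : m != (0, 0) -> (maxn 1 (height m))%:R <= 2%:R / o * nm (om m).
Proof.
move=> m0; have := om_height Om0 m.
have -> : maxn 1 (height m) = height m.
  by apply/maxn_idPr; rewrite /height; case: m m0 => a b /=; rewrite xpair_eqE; lia.
by [].
Qed.

Lemma lattice_weight j : exists2 M : R, 0 <= M & forall m, m != (0, 0) ->
  (nm (om m) ^+ (3 + j))^-1 <= M * weight m.
Proof.
have c0 : 0 <= 2%:R / o by rewrite divr_ge0 // ltW.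
exists ((o ^+ j)^-1 * (2%:R / o) ^+ 3).
  by rewrite mulr_ge0 ?invr_ge0 ?exprn_ge0 // ltW.
move=> m m0; apply: le_trans (inv_pow_le j o0 (om_ge Om0 m0)) _.
rewrite -mulrA ler_wpM2l ?invr_ge0 ?exprn_ge0 ?(ltW o0) //.
by apply: weight_ge => //; exact: lattice_height.
Qed.

Lemma eisen_sum j z : ~ lattice z ->
  has_sum (fun m => (z - om m) ^- (3 + j)) (eisen (3 + j) z).
Proof.
move=> zL; have [M M0 hM] := off_lattice_weight j zL.
have [|[s hs] _] := @nm_summable R (fun m => (z - om m) ^- (3 + j)) M.
  by move=> m; rewrite nmV nmX.
by rewrite /eisen (has_sum_lim hs).
Qed.

Lemma eisen0_sum j : has_sum (fun m => om m ^- (3 + j)) (eisen0 (3 + j)).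
Proof.
have [M M0 hM] := lattice_weight j.
have [|[s hs] _] := @nm_summable R (fun m => om m ^- (3 + j)) M.
  move=> m; have [->|m0] := eqVneq m (0, 0); last by rewrite nmV nmX hM.
  by rewrite om0 exprS mul0r invr0 nm0 mulr_ge0 ?weight_ge0.
by rewrite /eisen0 (has_sum_lim hs).
Qed.

Arguments eisen_sum j [z] _.
Arguments eisen0_sum j : clear implicits.

Lemma has_sum_delta (c : C) : has_sum (fun m : I => if m == (0, 0) then c else 0) c.
Proof.
have := @has_sum_finite I C [fset ((0, 0) : I)]%fset (fun m => if m == (0, 0) then c else 0).
rewrite big_seq_fset1 eqxx; apply=> m.
by rewrite inE => /negPf ->.
Qed.

(** The term of the origin is z^-2 since 0^-2 = 0, which puts the term outside the
    sum in the definition of wp into the series. The other terms are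
    z ((z - w)^-2 w^-1 - (z - w)^-1 w^-2), of the order of |w|^-3. *)
Lemma wpz_sum z : ~ lattice z ->
  has_sum (fun m => (z - om m) ^- 2 - om m ^- 2) (wpz z).
Proof.
move=> zL; have [c c0 hc] := off_lattice_height Om0 zL.
pose c' := 2%:R / o; have c'0 : 0 <= c' by rewrite divr_ge0 // ltW.
pose M := nm (z ^- 2) + nm z * (c ^+ 2 * c' + c * c' ^+ 2).
have [|[s hs] _] := @nm_summable R (fun m => (z - om m) ^- 2 - om m ^- 2) M.
  move=> m; have Mw : nm z * (c ^+ 2 * c' + c * c' ^+ 2) * weight m <= M * weight m.
    by rewrite ler_wpM2r ?weight_ge0 // lerDr nm_ge0.
  have [->|m0] := eqVneq m (0, 0).
    rewrite om0 expr0n invr0 !subr0 /weight /= expr1n invr1 mulr1 lerDl.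
    by rewrite mulr_ge0 ?nm_ge0 // addr_ge0 // mulr_ge0 ?exprn_ge0.
  apply: le_trans Mw.
  have a0 : z - om m != 0.
    by apply/eqP => /eqP; rewrite subr_eq0 => /eqP e; apply: zL; rewrite e; exact: lattice_om.
  have w0 : om m != 0 by rewrite om_eq0.
  have -> : (z - om m) ^- 2 - om m ^- 2 =
     z * ((z - om m)^-1 ^+ 2 * (om m)^-1 - (z - om m)^-1 * (om m)^-1 ^+ 2).
    by field; rewrite a0 w0.
  rewrite nmM -mulrA ler_wpM2l ?nm_ge0 //; apply: le_trans (nmD _ _) _.
  rewrite nmN [nm (_ ^+ 2 * _)]nmM [nm (_ * _ ^+ 2)]nmM !nmX mulrDl.
  have := hc m; have := lattice_height m0; rewrite -/c' /weight.
  have : 0 < (maxn 1 (height m))%:R :> R by rewrite ltr0n leq_max.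
  move: (maxn 1 (height m))%:R => u u0 hw ha.
  have na : 0 < nm (z - om m) by rewrite nm_gt0.
  have nw : 0 < nm (om m) by rewrite nm_gt0.
  have ia : nm (z - om m)^-1 <= c / u.
    by rewrite nmV -(ler_pM2r na) mulVf ?gt_eqF // mulrAC ler_pdivlMr // mul1r.
  have iw : nm (om m)^-1 <= c' / u.
    by rewrite nmV -(ler_pM2r nw) mulVf ?gt_eqF // mulrAC ler_pdivlMr // mul1r.
  have ia2 : nm (z - om m)^-1 ^+ 2 <= (c / u) ^+ 2.
    by rewrite lerXn2r ?nnegrE ?nm_ge0 // (le_trans _ ia) ?nm_ge0.
  have iw2 : nm (om m)^-1 ^+ 2 <= (c' / u) ^+ 2.
    by rewrite lerXn2r ?nnegrE ?nm_ge0 // (le_trans _ iw) ?nm_ge0.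
  apply: lerD.
    apply: (@le_trans _ _ ((c / u) ^+ 2 * (c' / u))).
      by apply: ler_pM; rewrite ?exprn_ge0 ?nm_ge0.
    by rewrite le_eqVlt; apply/orP; left; apply/eqP; field; rewrite gt_eqF.
  apply: (@le_trans _ _ ((c / u) * (c' / u) ^+ 2)).
    by apply: ler_pM; rewrite ?exprn_ge0 ?nm_ge0.
  by rewrite le_eqVlt; apply/orP; left; apply/eqP; field; rewrite gt_eqF.
suff -> : wpz z = s by [].
have h := has_sumB hs (has_sum_delta (c := z ^- 2)).
rewrite /wpz /wp /lattice_sum.
have -> : (fun m : I => if m == (0, 0) then 0 else
     (z - lattice_point Om (Om * rho R) m) ^- 2 - lattice_point Om (Om * rho R) m ^- 2) =
   (fun m => (z - om m) ^- 2 - om m ^- 2 - (if m == (0, 0) then z ^- 2 else 0)).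
  apply/funext => m; case: eqVneq => [->|_]; last by rewrite subr0.
  by rewrite om0 expr0n invr0 !subr0 subrr.
by rewrite (has_sum_lim h) addrC subrK.
Qed.

Lemma lattice_g2E : lattice_g2 Om (Om * rho R) = 60%:R * eisen0 4.
Proof.
rewrite /lattice_g2 /lattice_sum /eisen0.
have -> // : (fun m : I => if m == (0, 0) then 0 else
  lattice_point Om (Om * rho R) m ^- 4) = (fun m => om m ^- 4).
by apply/funext => m; case: eqVneq => [->|//]; rewrite om0 expr0n invr0.
Qed.

Lemma lattice_g3E : lattice_g3 Om (Om * rho R) = 140%:R * eisen0 6.
Proof.
rewrite /lattice_g3 /lattice_sum /eisen0.
have -> // : (fun m : I => if m == (0, 0) then 0 else
  lattice_point Om (Om * rho R) m ^- 6) = (fun m => om m ^- 6).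
by apply/funext => m; case: eqVneq => [->|//]; rewrite om0 expr0n invr0.
Qed.

Let trans (n m : I) : I := (m.1 + n.1, m.2 + n.2).
Let opp m : I := (- m.1, - m.2).
Let transK n : cancel (trans n) (trans (opp n)).
Proof. by case: n => a b [c d]; rewrite /trans /opp /= !addrK. Qed.
Let transVK n : cancel (trans (opp n)) (trans n).
Proof. by case: n => a b [c d]; rewrite /trans /opp /= !subrK. Qed.
Let oppK : involutive opp.
Proof. by case=> a b; rewrite /opp /= !opprK. Qed.
Let om_trans n m : om (trans n m) = om m + om n. Proof. exact: omD. Qed.
Let om_opp m : om (opp m) = - om m. Proof. exact: omN. Qed.

Lemma off_latticeD z n : ~ lattice z -> ~ lattice (z + om n).
Proof. by move=> zL /lattice_add. Qed.

Lemma off_latticeN z : ~ lattice z -> ~ lattice (- z).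
Proof. by move=> zL /lattice_opp. Qed.

Lemma eisen_periodic j z n : ~ lattice z -> eisen (3 + j) (z + om n) = eisen (3 + j) z.
Proof.
move=> zL; apply: has_sum_unique _ (eisen_sum j zL).
have := has_sum_reindex (transK n) (transVK n) (eisen_sum j (off_latticeD (n := n) zL)).
by apply: has_sum_ext => m /=; rewrite om_trans; congr (_ ^- _); ring.
Qed.

Lemma eisen_opp j z : ~ lattice z -> eisen (3 + j) (- z) = (-1) ^+ (3 + j) * eisen (3 + j) z.
Proof.
move=> zL; have zL' := off_latticeN zL.
apply: has_sum_unique _ (has_sumZ ((-1) ^+ (3 + j)) (eisen_sum j zL)).
have := has_sum_reindex oppK oppK (eisen_sum j zL').
apply: has_sum_ext => m /=; rewrite om_opp.
have -> : - z - - om m = -1 * (z - om m) by ring.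
by rewrite exprMn invfM -exprVn invrN1.
Qed.

Lemma wpz_opp z : ~ lattice z -> wpz (- z) = wpz z.
Proof.
move=> zL; have zL' := off_latticeN zL.
apply: has_sum_unique _ (wpz_sum zL).
have := has_sum_reindex oppK oppK (wpz_sum zL').
apply: has_sum_ext => m /=; rewrite om_opp sqrrN.
have -> : - z - - om m = - (z - om m) by ring.
by rewrite sqrrN.
Qed.

(** The difference wp (z + v) - wp (z) is the sum of w^-2 - (w + v)^-2 over the lattice
    points w; the involution w -> - w - v changes its sign. *)
Lemma wpz_periodic z n : ~ lattice z -> wpz (z + om n) = wpz z.
Proof.
move=> zL; have zL' := off_latticeD (n := n) zL.
have h1 := has_sum_reindex (transK n) (transVK n) (wpz_sum zL').
have h2 := has_sumB h1 (wpz_sum zL).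
have h3 : has_sum (fun m => om m ^- 2 - (om m + om n) ^- 2) (wpz (z + om n) - wpz z).
  apply: has_sum_ext h2 => m /=; rewrite om_trans.
  have -> : z + om n - (om m + om n) = z - om m by ring.
  by ring.
have K : involutive (fun m => opp (trans n m)).
  by case: (n) => a b [c d]; rewrite /opp /trans /= !opprD !opprK !addrK.
have h4 := has_sumN (has_sum_reindex K K h3).
have := has_sum_unique h3 (has_sum_ext _ h4) => e.
apply/eqP; rewrite -subr_eq0.
have : wpz (z + om n) - wpz z = - (wpz (z + om n) - wpz z).
  apply: e => m /=; rewrite om_opp om_trans sqrrN.
  have -> : - (om m + om n) + om n = - om m by ring.
  by rewrite sqrrN opprB.
by move/eqP; rewrite -subr_eq0 opprK -mulr2n mulrn_eq0.
Qed.

Lemma eisen0_opp j : has_sum (fun m => (- om m) ^- (3 + j)) (eisen0 (3 + j)).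
Proof.
have := has_sum_reindex oppK oppK (eisen0_sum j).
by apply: has_sum_ext => m /=; rewrite om_opp.
Qed.

Arguments eisen0_opp j : clear implicits.

Lemma eisen0_odd j : odd (3 + j) -> eisen0 (3 + j) = 0.
Proof.
move=> oj; have h := has_sumN (eisen0_opp j).
have /eqP : eisen0 (3 + j) = - eisen0 (3 + j).
  apply: has_sum_unique (eisen0_sum j) _; apply: has_sum_ext h => m.
  by rewrite exprNn -signr_odd oj expr1 mulN1r invrN opprK.
by rewrite -subr_eq0 opprK -mulr2n mulrn_eq0 => /eqP.
Qed.

(** The hexagonal lattice is stable under the sixth root of unity rho, so this sum is
    multiplied by rho^-4, which is not 1. *)
Lemma eisen0_4 : eisen0 4 = 0.
Proof.
pose r m : I := (- m.2, m.1 + m.2); pose r' m : I := (m.1 + m.2, - m.1).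
have rK : cancel r r' by case=> a b; rewrite /r /r' /=; congr pair; ring.
have r'K : cancel r' r by case=> a b; rewrite /r /r' /=; congr pair; ring.
have h := has_sum_reindex rK r'K (eisen0_sum 1).
have h' := has_sumZ (rho R ^- 4) (eisen0_sum 1).
have e4 : rho R ^+ 4 = - rho R.
  by rewrite (exprM _ 2 2) rho_sqr sqrrB1 rho_sqr; ring.
have e : eisen0 4 = rho R ^- 4 * eisen0 4.
  apply: has_sum_unique h _; apply: has_sum_ext h' => m /=.
  by rewrite [om (r m)]om_rho exprMn [RHS]invfM.
have r0 : rho R != 0.
  apply/eqP => r0; have := rho_sqr R; rewrite r0 expr0n /= sub0r => /eqP.
  by rewrite eq_sym oppr_eq0 oner_eq0.
have : (rho R + 1) * eisen0 4 = 0.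
  apply: (eq_of_sub (c := rho R * eisen0 4) (d := rho R * (rho R ^- 4 * eisen0 4))).
    by rewrite -e.
  by rewrite e4; move: (eisen0 4) (rho R) r0 => u v v0; field.
move/eqP; rewrite mulf_eq0 => /orP[|/eqP//].
rewrite addr_eq0 => /eqP r1; have := rho_sqr R; rewrite r1 sqrrN expr1n => /eqP.
have e3 : 1 - (-1 - 1) = 3%:R :> C by ring.
by rewrite -subr_eq0 e3 pnatr_eq0.
Qed.

End Series.

Arguments eisen_sum {R Om} Om0 j {z} _.
Arguments eisen0_sum {R Om} Om0 j.
Arguments eisen0_opp {R Om} Om0 j.
Arguments eisen_periodic {R Om} Om0 j {z} n _.
Arguments wpz_periodic {R Om} Om0 {z} n _.
Arguments eisen_opp {R Om} Om0 j {z} _.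

(** * Expansions of the lattice sums *)

Section Expansions.
Variable R : realType.
Local Notation C := (R[i] : numFieldType).
Local Notation I := (int * int)%type.
Implicit Types (x y z h : C) (m : I).

Variable Om : C.
Hypothesis Om0 : Om != 0.
Local Notation om := (om Om).
Local Notation lattice := (lattice Om).
Local Notation weight := (weight R).
Local Notation wpz := (wpz Om).
Local Notation eisen := (eisen Om).
Local Notation eisen0 := (eisen0 Om).
Let o := nm Om.
Let o0 : 0 < o. Proof. by rewrite nm_gt0. Qed.

Lemma lattice_neq z m : ~ lattice z -> z - om m != 0.
Proof.
move=> zL; apply/eqP => /eqP; rewrite subr_eq0 => /eqP e.
by apply: zL; rewrite e; exact: lattice_om.
Qed.

Lemma lattice_ball z : ~ lattice z -> exists2 d : R, 0 < d & forall h, nm h < d ->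
  ~ lattice (z + h) /\ forall m, nm h <= nm (z - om m) / 2%:R.
Proof.
move=> /(lattice_dist Om0) [d d0 hd]; exists (d / 2%:R); first by rewrite divr_gt0.
move=> h hh; split=> [[m e]|m]; last by have := hd m; lra.
have := hd m; rewrite [om m](esym e) opprD addrA subrr sub0r nmN.
by have := nm_ge0 h; lra.
Qed.

(** Termwise expansion: remainders of order |h|^3 |z - w|^-(3 + j) add up to a remainder of
    order |h|^3. *)
Lemma sum_remainder z h j (B : R) (f : I -> C) s : 0 <= B ->
  (forall m, nm (f m) <= B * (nm h ^+ 3 / nm (z - om m) ^+ (3 + j))) ->
  forall M : R, (forall m, (nm (z - om m) ^+ (3 + j))^-1 <= M * weight m) ->
  has_sum f s -> nm s <= (17%:R * B * M) * nm h ^+ 3.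
Proof.
move=> B0 hf M hM hs; have n3 : 0 <= nm h ^+ 3 by rewrite exprn_ge0 ?nm_ge0.
have [|_ /(_ s hs)] := @nm_summable R f (B * M * nm h ^+ 3).
  move=> m; apply: le_trans (hf m) _; move: (nm h ^+ 3) n3 => t t0.
  by rewrite -!mulrA ler_wpM2l // [leRHS]mulrCA ler_wpM2l // hM.
by move/le_trans; apply; rewrite le_eqVlt; apply/orP; left; apply/eqP; ring.
Qed.

Lemma wpz_taylor z : ~ lattice z -> taylor2 wpz z (- 2%:R * eisen 3 z) (3%:R * eisen 4 z).
Proof.
move=> zL; have [d d0 hd] := lattice_ball zL.
have [M M0 hM] := off_lattice_weight Om0 2 zL.
exists (17%:R * 28%:R * M), d; split=> [||h /hd [zhL hh]] //; first by rewrite !mulr_ge0.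
have h1 := has_sumB (wpz_sum Om0 zhL) (wpz_sum Om0 zL).
have h2 := has_sumZ (2%:R * h) (eisen_sum Om0 0 zL).
have h3 := has_sumZ (- 3%:R * h ^+ 2) (eisen_sum Om0 1 zL).
pose f := fun m => (z - om m + h) ^- 2 -
  ((z - om m) ^- 2 - 2%:R * (z - om m) ^- 3 * h + 3%:R * (z - om m) ^- 4 * h ^+ 2).
have rem m : nm (f m) <= 28%:R * (nm h ^+ 3 / nm (z - om m) ^+ (3 + 2)).
  exact: remainder_2_3 (lattice_neq _ zL) (hh m).
suff hs : has_sum f (wpz (z + h) - (wpz z + - 2%:R * eisen 3 z * h + 3%:R * eisen 4 z * h ^+ 2)).
  exact: (@sum_remainder z h _ _ f _ (ler0n _ _) rem M hM hs).
have -> : wpz (z + h) - (wpz z + - 2%:R * eisen 3 z * h + 3%:R * eisen 4 z * h ^+ 2) =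
  wpz (z + h) - wpz z + 2%:R * h * eisen 3 z + - 3%:R * h ^+ 2 * eisen 4 z.
  by move: (wpz (z + h)) (wpz z) (eisen 3 z) (eisen 4 z) => a b c e; ring.
rewrite /f; apply: has_sum_ext (has_sumD (has_sumD h1 h2) h3) => m.
have -> : z + h - om m = z - om m + h by ring.
rewrite -[(3 + 0)%N]/3%N -[(3 + 1)%N]/4%N; ring.
Qed.

Lemma eisen3_taylor z : ~ lattice z -> taylor2 (eisen 3) z (- 3%:R * eisen 4 z) (6%:R * eisen 5 z).
Proof.
move=> zL; have [d d0 hd] := lattice_ball zL.
have [M M0 hM] := off_lattice_weight Om0 3 zL.
exists (17%:R * 248%:R * M), d; split=> [||h /hd [zhL hh]] //; first by rewrite !mulr_ge0.
have h1 := has_sumB (eisen_sum Om0 0 zhL) (eisen_sum Om0 0 zL).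
have h2 := has_sumZ (3%:R * h) (eisen_sum Om0 1 zL).
have h3 := has_sumZ (- 6%:R * h ^+ 2) (eisen_sum Om0 2 zL).
pose f := fun m => (z - om m + h) ^- 3 -
  ((z - om m) ^- 3 - 3%:R * (z - om m) ^- 4 * h + 6%:R * (z - om m) ^- 5 * h ^+ 2).
have rem m : nm (f m) <= 248%:R * (nm h ^+ 3 / nm (z - om m) ^+ (3 + 3)).
  exact: remainder_3_3 (lattice_neq _ zL) (hh m).
suff hs : has_sum f (eisen 3 (z + h) - (eisen 3 z + - 3%:R * eisen 4 z * h + 6%:R * eisen 5 z * h ^+ 2)).
  exact: (@sum_remainder z h _ _ f _ (ler0n _ _) rem M hM hs).
have -> : eisen 3 (z + h) - (eisen 3 z + - 3%:R * eisen 4 z * h + 6%:R * eisen 5 z * h ^+ 2) =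
  eisen 3 (z + h) - eisen 3 z + 3%:R * h * eisen 4 z + - 6%:R * h ^+ 2 * eisen 5 z by ring.
rewrite /f; apply: has_sum_ext (has_sumD (has_sumD h1 h2) h3) => m.
have -> : z + h - om m = z - om m + h by ring.
rewrite -[(3 + 0)%N]/3%N -[(3 + 1)%N]/4%N -[(3 + 2)%N]/5%N; ring.
Qed.

Lemma eisen4_taylor z : ~ lattice z -> taylor2 (eisen 4) z (- 4%:R * eisen 5 z) (10%:R * eisen 6 z).
Proof.
move=> zL; have [d d0 hd] := lattice_ball zL.
have [M M0 hM] := off_lattice_weight Om0 4 zL.
exists (17%:R * 1776%:R * M), d; split=> [||h /hd [zhL hh]] //; first by rewrite !mulr_ge0.
have h1 := has_sumB (eisen_sum Om0 1 zhL) (eisen_sum Om0 1 zL).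
have h2 := has_sumZ (4%:R * h) (eisen_sum Om0 2 zL).
have h3 := has_sumZ (- 10%:R * h ^+ 2) (eisen_sum Om0 3 zL).
pose f := fun m => (z - om m + h) ^- 4 -
  ((z - om m) ^- 4 - 4%:R * (z - om m) ^- 5 * h + 10%:R * (z - om m) ^- 6 * h ^+ 2).
have rem m : nm (f m) <= 1776%:R * (nm h ^+ 3 / nm (z - om m) ^+ (3 + 4)).
  exact: remainder_4_3 (lattice_neq _ zL) (hh m).
suff hs : has_sum f (eisen 4 (z + h) - (eisen 4 z + - 4%:R * eisen 5 z * h + 10%:R * eisen 6 z * h ^+ 2)).
  exact: (@sum_remainder z h _ _ f _ (ler0n _ _) rem M hM hs).
have -> : eisen 4 (z + h) - (eisen 4 z + - 4%:R * eisen 5 z * h + 10%:R * eisen 6 z * h ^+ 2) =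
  eisen 4 (z + h) - eisen 4 z + 4%:R * h * eisen 5 z + - 10%:R * h ^+ 2 * eisen 6 z by ring.
rewrite /f; apply: has_sum_ext (has_sumD (has_sumD h1 h2) h3) => m.
have -> : z + h - om m = z - om m + h by ring.
rewrite -[(3 + 1)%N]/4%N -[(3 + 2)%N]/5%N -[(3 + 3)%N]/6%N; ring.
Qed.

Lemma near0_off_lattice z : z != 0 -> nm z < o -> ~ lattice z.
Proof.
move=> z0 zo [m e]; have [m0|m0] := eqVneq m (0, 0).
  by move: z0; rewrite e m0 -/(om (0, 0)) om0 eqxx.
by have := om_ge Om0 m0; rewrite /om -e leNgt zo.
Qed.

(** The same near the origin, whose own term is expanded exactly and contributes
    nothing to f. *)
Lemma laurent_remainder z j n (B : R) (f : I -> C) s : 0 <= B ->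
  f (0, 0) = 0 -> (forall m, m != (0, 0) ->
    nm (f m) <= B * (nm z ^+ n / nm (- om m) ^+ (3 + j))) ->
  forall M : R, 0 <= M -> (forall m, m != (0, 0) -> (nm (om m) ^+ (3 + j))^-1 <= M * weight m) ->
  has_sum f s -> nm s <= (17%:R * B * M) * nm z ^+ n.
Proof.
move=> B0 f0 hf M M0 hM hs; have n3 : 0 <= nm z ^+ n by rewrite exprn_ge0 ?nm_ge0.
have [|_ /(_ s hs)] := @nm_summable R f (B * M * nm z ^+ n).
  move=> m; have [->|m0] := eqVneq m (0, 0).
    by rewrite f0 nm0 !mulr_ge0 ?weight_ge0.
  apply: le_trans (hf m m0) _; rewrite nmN; move: (nm z ^+ n) n3 => t t0.
  by rewrite -!mulrA ler_wpM2l // [leRHS]mulrCA ler_wpM2l // hM.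
by move/le_trans; apply; rewrite le_eqVlt; apply/orP; left; apply/eqP; ring.
Qed.

Let odd3 : eisen0 3 = 0. Proof. exact: (@eisen0_odd R Om Om0 0). Qed.
Let odd5 : eisen0 5 = 0. Proof. exact: (@eisen0_odd R Om Om0 2). Qed.
Let odd7 : eisen0 7 = 0. Proof. exact: (@eisen0_odd R Om Om0 4). Qed.
Let four : eisen0 4 = 0. Proof. exact: eisen0_4. Qed.

Let inv0 k : (0 < k)%N -> (- om (0, 0)) ^- k = 0.
Proof. by move=> k0; rewrite om0 oppr0 expr0n gtn_eqF // invr0. Qed.

Let half_om z m : nm z < o / 2%:R -> m != (0, 0) -> nm z <= nm (- om m) / 2%:R.
Proof. by move=> zo /(om_ge Om0); rewrite nmN -/o; lra. Qed.

(** Of the terms up to order z^5 only those in z^-2 and z^4 survive: the odd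
    Eisenstein sums and the one of weight 4 are zero. *)
Lemma wpz_laurent : exists2 B : R, 0 <= B & forall z, z != 0 -> nm z < o / 2%:R ->
  nm (wpz z - (z ^- 2 + 5%:R * eisen0 6 * z ^+ 4)) <= B * nm z ^+ 6.
Proof.
have [M M0 hM] := lattice_weight Om0 5.
exists (17%:R * 52%:R * M); first by rewrite !mulr_ge0.
move=> z z0 zo; have zL : ~ lattice z.
  by apply: near0_off_lattice => //; move: o0; lra.
pose P m := (- om m) ^- 2 - 2%:R * (- om m) ^- 3 * z + 3%:R * (- om m) ^- 4 * z ^+ 2
    - 4%:R * (- om m) ^- 5 * z ^+ 3 + 5%:R * (- om m) ^- 6 * z ^+ 4 - 6%:R * (- om m) ^- 7 * z ^+ 5.
pose f := fun m => (- om m + z) ^- 2 - P m - (if m == (0, 0) then z ^- 2 else 0).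
have f0 : f (0, 0) = 0 by rewrite /f /P !inv0 // om0 oppr0 add0r /=; ring.
have rem m : m != (0, 0) -> nm (f m) <= 52%:R * (nm z ^+ 6 / nm (- om m) ^+ (3 + 5)).
  move=> m0; rewrite /f (negPf m0) subr0; apply: remainder_2_6; last exact: half_om.
  by rewrite oppr_eq0 om_eq0.
suff hs : has_sum f (wpz z - (z ^- 2 + 5%:R * eisen0 6 * z ^+ 4)).
  exact: (@laurent_remainder z _ _ _ f _ (ler0n _ _) f0 rem M M0 hM hs).
have h1 := has_sumB (wpz_sum Om0 zL) (has_sum_delta (c := z ^- 2)).
have h3 := has_sumZ (2%:R * z) (eisen0_opp Om0 0).
have h4 := has_sumZ (- 3%:R * z ^+ 2) (eisen0_opp Om0 1).
have h5 := has_sumZ (4%:R * z ^+ 3) (eisen0_opp Om0 2).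
have h6 := has_sumZ (- 5%:R * z ^+ 4) (eisen0_opp Om0 3).
have h7 := has_sumZ (6%:R * z ^+ 5) (eisen0_opp Om0 4).
have := has_sumD (has_sumD (has_sumD (has_sumD (has_sumD h1 h3) h4) h5) h6) h7.
rewrite -[(3 + 0)%N]/3%N -[(3 + 1)%N]/4%N -[(3 + 2)%N]/5%N -[(3 + 3)%N]/6%N -[(3 + 4)%N]/7%N.
rewrite odd3 odd5 odd7 four.
have -> : wpz z - z ^- 2 + 2%:R * z * 0 + - 3%:R * z ^+ 2 * 0 + 4%:R * z ^+ 3 * 0 +
  - 5%:R * z ^+ 4 * eisen0 6 + 6%:R * z ^+ 5 * 0 = wpz z - (z ^- 2 + 5%:R * eisen0 6 * z ^+ 4).
  by ring.
apply: has_sum_ext => m; rewrite /f /P [- om m + z]addrC.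
have -> : om m ^- 2 = (- om m) ^- 2 by rewrite sqrrN.
rewrite -!exprVn; move: (- om m)^-1 (z - om m)^-1 (if _ then _ else _) => u v b; ring.
Qed.

Lemma eisen3_laurent : exists2 B : R, 0 <= B & forall z, z != 0 -> nm z < o / 2%:R ->
  nm (eisen 3 z - (z ^- 3 - 10%:R * eisen0 6 * z ^+ 3)) <= B * nm z ^+ 5.
Proof.
have [M M0 hM] := lattice_weight Om0 5.
exists (17%:R * 568%:R * M); first by rewrite !mulr_ge0.
move=> z z0 zo; have zL : ~ lattice z.
  by apply: near0_off_lattice => //; move: o0; lra.
pose P m := (- om m) ^- 3 - 3%:R * (- om m) ^- 4 * z + 6%:R * (- om m) ^- 5 * z ^+ 2
    - 10%:R * (- om m) ^- 6 * z ^+ 3 + 15%:R * (- om m) ^- 7 * z ^+ 4.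
pose f := fun m => (- om m + z) ^- 3 - P m - (if m == (0, 0) then z ^- 3 else 0).
have f0 : f (0, 0) = 0 by rewrite /f /P !inv0 // om0 oppr0 add0r /=; ring.
have rem m : m != (0, 0) -> nm (f m) <= 568%:R * (nm z ^+ 5 / nm (- om m) ^+ (3 + 5)).
  move=> m0; rewrite /f (negPf m0) subr0; apply: remainder_3_5; last exact: half_om.
  by rewrite oppr_eq0 om_eq0.
suff hs : has_sum f (eisen 3 z - (z ^- 3 - 10%:R * eisen0 6 * z ^+ 3)).
  exact: (@laurent_remainder z _ _ _ f _ (ler0n _ _) f0 rem M M0 hM hs).
have h1 := has_sumB (eisen_sum Om0 0 zL) (has_sum_delta (c := z ^- 3)).
have h3 := has_sumZ (- 1) (eisen0_opp Om0 0).
have h4 := has_sumZ (3%:R * z) (eisen0_opp Om0 1).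
have h5 := has_sumZ (- 6%:R * z ^+ 2) (eisen0_opp Om0 2).
have h6 := has_sumZ (10%:R * z ^+ 3) (eisen0_opp Om0 3).
have h7 := has_sumZ (- 15%:R * z ^+ 4) (eisen0_opp Om0 4).
have := has_sumD (has_sumD (has_sumD (has_sumD (has_sumD h1 h3) h4) h5) h6) h7.
rewrite -[(3 + 0)%N]/3%N -[(3 + 1)%N]/4%N -[(3 + 2)%N]/5%N -[(3 + 3)%N]/6%N -[(3 + 4)%N]/7%N.
rewrite odd3 odd5 odd7 four.
have -> : eisen 3 z - z ^- 3 + - 1 * 0 + 3%:R * z * 0 + - 6%:R * z ^+ 2 * 0 +
  10%:R * z ^+ 3 * eisen0 6 + - 15%:R * z ^+ 4 * 0 = eisen 3 z - (z ^- 3 - 10%:R * eisen0 6 * z ^+ 3).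
  by ring.
apply: has_sum_ext => m; rewrite /f /P [- om m + z]addrC.
rewrite -!exprVn; move: (- om m)^-1 (z - om m)^-1 (if _ then _ else _) => u v b; ring.
Qed.

Lemma eisen4_laurent : exists2 B : R, 0 <= B & forall z, z != 0 -> nm z < o / 2%:R ->
  nm (eisen 4 z - z ^- 4) <= B * nm z ^+ 2.
Proof.
have [M M0 hM] := lattice_weight Om0 3.
exists (17%:R * 784%:R * M); first by rewrite !mulr_ge0.
move=> z z0 zo; have zL : ~ lattice z.
  by apply: near0_off_lattice => //; move: o0; lra.
pose P m := (- om m) ^- 4 - 4%:R * (- om m) ^- 5 * z.
pose f := fun m => (- om m + z) ^- 4 - P m - (if m == (0, 0) then z ^- 4 else 0).
have f0 : f (0, 0) = 0 by rewrite /f /P !inv0 // om0 oppr0 add0r /=; ring.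
have rem m : m != (0, 0) -> nm (f m) <= 784%:R * (nm z ^+ 2 / nm (- om m) ^+ (3 + 3)).
  move=> m0; rewrite /f (negPf m0) subr0; apply: remainder_4_2; last exact: half_om.
  by rewrite oppr_eq0 om_eq0.
suff hs : has_sum f (eisen 4 z - z ^- 4).
  exact: (@laurent_remainder z _ _ _ f _ (ler0n _ _) f0 rem M M0 hM hs).
have h1 := has_sumB (eisen_sum Om0 1 zL) (has_sum_delta (c := z ^- 4)).
have h4 := has_sumZ (- 1) (eisen0_opp Om0 1).
have h5 := has_sumZ (4%:R * z) (eisen0_opp Om0 2).
have := has_sumD (has_sumD h1 h4) h5.
rewrite -[(3 + 1)%N]/4%N -[(3 + 2)%N]/5%N odd5 four.
have -> : eisen 4 z - z ^- 4 + - 1 * 0 + 4%:R * z * 0 = eisen 4 z - z ^- 4 by ring.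
apply: has_sum_ext => m; rewrite /f /P [- om m + z]addrC.
rewrite -!exprVn; move: (- om m)^-1 (z - om m)^-1 (if _ then _ else _) => u v b; ring.
Qed.

End Expansions.

(** * Hexagonal lattices with a prescribed invariant *)

Section Nonzero.
Variable R : realType.
Local Notation C := (R[i] : numFieldType).
Local Notation I := (int * int)%type.
Implicit Types (m : I).
Local Notation hex := (@hex R).
Local Notation hexnorm := (@hexnorm R).

Definition units : {fset I} :=
  [fset m in [:: (1, 0); (0, 1); (-1, 1); (-1, 0); (0, -1); (1, -1)]]%fset.

(** The norm form m^2 + m n + n^2 does not represent 2. *)
Lemma hexnorm_trichotomy m : [\/ m = (0, 0), m \in units | 3%:R <= hexnorm m].
Proof.
have [h2|h2] := leqP 2 (height m).
  apply: Or33; have := @hexnorm_height R m.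
  have : 2%:R ^+ 2 <= (height m)%:R ^+ 2 :> R by rewrite lerXn2r ?nnegrE ?ler_nat.
  by lra.
case: m h2 => a b; rewrite /height /= => h2.
have {}h2 : (`|a| <= 1)%N /\ (`|b| <= 1)%N by lia.
have [ha hb] := h2.
have a3 : [\/ a = -1, a = 0 | a = 1].
  by move: ha {h2}; case: a => [[|[|n]]|[|n]] // _; [apply: Or32|apply: Or33|apply: Or31].
have b3 : [\/ b = -1, b = 0 | b = 1].
  by move: hb {h2}; case: b => [[|[|n]]|[|n]] // _; [apply: Or32|apply: Or33|apply: Or31].
have n3 (c d : int) : c = d -> c * c + c * d + d * d = 3%:Z -> 3%:R <= hexnorm (c, d).
  by move=> _ e; rewrite hexnorm_int /= !expr2 e.
case: a3 b3 => -> [] ->; try by [apply: Or31]; try by [apply: Or33; apply: n3];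
  by apply: Or32; rewrite in_fset.
Qed.

Lemma hex_unit m : m \in units -> hex m ^+ 6 = 1.
Proof.
have r2 := rho_sqr R.
have r3 : rho R ^+ 3 = -1 by rewrite exprS r2 mulrBr mulr1 -expr2 r2; ring.
have r6 : rho R ^+ 6 = 1 by rewrite (exprM _ 3 2) r3 sqrrN expr1n.
have e6 : (rho R - 1) ^+ 6 = 1 by rewrite -r2 -exprM (exprM _ 6 2) r6 expr1n.
have n6 (x : C) : (- x) ^+ 6 = x ^+ 6 by ring.
rewrite in_fset /hex !in_cons in_nil orbF => /orP[|/orP[|/orP[|/orP[|/orP[]]]]] /eqP -> /=.
- by rewrite mul0r addr0 expr1n.
- by rewrite add0r mul1r r6.
- by rewrite mul1r addrC rmorphN1 e6.
- by rewrite mul0r addr0 rmorphN1 n6 expr1n.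
- by rewrite add0r rmorphN1 mulN1r n6 r6.
- by rewrite rmorphN1 mulN1r -opprB n6 e6.
Qed.

Lemma card_units : #|` units|%fset = 6.
Proof. by rewrite /units card_fseq. Qed.

(** The six units contribute 1 each. Elsewhere the norm form Q satisfies Q >= 3 and
    4 Q >= 3 h^2 with h the height, so Q >= 3 h / 2 and the remaining terms are at
    most 8/27 times the weights; as 17 * 8/27 < 6 they cannot cancel the units. *)
Lemma eisen0_6_unit : eisen0 (1 : C) 6 != 0.
Proof.
have h := eisen0_sum (oner_neq0 C) 3.
have hu := @has_sum_finite I C units (fun m => if m \in units then 1 else 0).
have {}hu : has_sum (fun m => if m \in units then 1 else 0 : C) 6%:R.
  have <- : \sum_(m <- units) (if m \in units then 1 else 0 : C) = 6%:R.
    rewrite big_seq (eq_bigr (fun=> 1)) => [|m ->//].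
    by rewrite -big_seq big_const_seq count_predT iter_addr_0 -/(#|` units|%fset) card_units.
  by apply: hu => m /negPf ->.
have [|_ /(_ _ (has_sumB h hu))] := @nm_summable R (fun m => om 1 m ^- 6 -
   (if m \in units then 1 else 0)) (8%:R / 27%:R).
  move=> m; rewrite omE mul1r; case: (hexnorm_trichotomy m) => [->|mu|h3].
  - have /negPf -> : (0, 0) \notin units by rewrite in_fset.
    rewrite /hex !mul0r addr0 expr0n invr0 subr0 nm0.
    by rewrite mulr_ge0 ?weight_ge0 // divr_ge0.
  - by rewrite mu hex_unit // invr1 subrr nm0 mulr_ge0 ?weight_ge0 // divr_ge0.
  case: ifPn => [mu|mu].
    by rewrite hex_unit // invr1 subrr nm0 mulr_ge0 ?weight_ge0 // divr_ge0.
  rewrite subr0 nmV nmX (exprM _ 2 3) nm_hex /weight.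
  have := hexnorm_height R m.
  have -> : maxn 1 (height m) = height m.
    apply/maxn_idPr; rewrite lt0n; apply: contraTneq h3 => h0.
    have -> : m = (0, 0).
      by case: m {mu} h0 => a b; rewrite /height /= => h0; congr pair; lia.
    by rewrite /hexnorm /= expr0n mulr0 !addr0 -ltNge.
  have : (height m)%:R != 0 :> R.
    rewrite pnatr_eq0; apply: contraTneq h3 => h0.
    have -> : m = (0, 0).
      by case: m {mu} h0 => a b; rewrite /height /= => h0; congr pair; lia.
    by rewrite /hexnorm /= expr0n mulr0 !addr0 -ltNge.
  have : 0 <= (height m)%:R :> R by [].
  move: (height m)%:R (hexnorm m) h3 => u Q Q3 u0 un0 Qu.
  have {}u0 : 0 < u by rewrite lt_def un0.
  have q0 : 0 < 3%:R / 2%:R * u by rewrite mulr_gt0 ?divr_gt0.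
  have Q0 : 0 <= Q by apply: le_trans Q3.
  have Qu' : 3%:R / 2%:R * u <= Q.
    by rewrite -(ler_sqr (x := 3%:R / 2%:R * u)) ?nnegrE ?(ltW q0) //; nra.
  apply: (@le_trans _ _ ((3%:R / 2%:R * u) ^+ 3)^-1).
    by rewrite lef_pV2 ?posrE ?exprn_gt0 ?(lt_le_trans q0) // lerXn2r ?nnegrE ?(ltW q0) // (le_trans (ltW q0)).
  by rewrite le_eqVlt; apply/orP; left; apply/eqP; field; rewrite gt_eqF.
move=> hn; apply/eqP => e; move: hn; rewrite -[eisen0 1 (3 + 3)]/(eisen0 1 6) e sub0r nmN nm_nat.
lra.
Qed.

(** Scaling a lattice by Om divides the invariant by Om^6, and complex numbers have
    sixth roots. *)
Lemma hexagonal_lattice_g3 (g : C) : g != 0 ->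
  exists2 Om : C, Om != 0 & 140%:R * eisen0 Om 6 = g.
Proof.
move=> g0; set S := eisen0 (1 : C) 6; have S0 : S != 0 := eisen0_6_unit.
pose x : R[i] := 140%:R * S / g.
have x0 : x != 0 by rewrite !mulf_neq0 ?invr_eq0 // pnatr_eq0.
pose Om : C := 6.-root x.
have O6 : Om ^+ 6 = x by rewrite /Om rootCK.
have Om0 : Om != 0 by apply: contraNneq x0 => O0; rewrite -O6 O0 expr0n.
exists Om => //.
have -> : eisen0 Om 6 = Om ^- 6 * S.
  apply: has_sum_unique (eisen0_sum Om0 3) _.
  apply: has_sum_ext (has_sumZ (Om ^- 6) (eisen0_sum (oner_neq0 C) 3)) => m.
  by rewrite !omE mul1r exprMn [RHS]invfM.
rewrite O6 /x; clear Om O6 Om0 x0 x; move: S S0 => s s0.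
by field; rewrite s0 g0.
Qed.

End Nonzero.

(** * Liouville's theorem for the lattice *)

Section Liouville.
Variable R : realType.
Local Notation C := (R[i] : numFieldType).
Implicit Types (x y z h w : C).

Definition cts (phi : C -> R) := forall z e, 0 < e ->
  exists2 d : R, 0 < d & forall h, nm h < d -> `|phi (z + h) - phi z| <= e.

(** Compactness of a square, mapped onto the parallelogram. *)
Lemma cts_max (phi : C -> R) (al be : C) (a b : R) : a <= b -> cts phi ->
  exists x0 y0 : R, [/\ a <= x0 <= b, a <= y0 <= b &
    forall x y : R, a <= x <= b -> a <= y <= b ->
      phi (x%:C * al + y%:C * be) <= phi (x0%:C * al + y0%:C * be)].
Proof.
move=> ab cphi; pose psi (v : R * R) := phi (v.1%:C * al + v.2%:C * be).
pose A : set (R * R) := `[a, b] `*` `[a, b].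
have cA : compact A by apply: compact_setX; exact: segment_compact.
have A0 : A !=set0 by exists (a, a); split; rewrite /= in_itv /= lexx ab.
have cpsi : {within A, continuous psi}.
  apply: continuous_subspaceT => v; apply/cvgrPdist_le => e e0.
  have [d d0 hd] := cphi (v.1%:C * al + v.2%:C * be) e e0.
  pose K := nm al + nm be + 1; have K0 : 0 < K by rewrite ltr_pwDr // addr_ge0 ?nm_ge0.
  suff : nbhs v [set t | `|psi v - psi t| <= e] by [].
  apply/(@nbhs_ballP R (R * R)%type); exists (d / K) => /=; first by rewrite divr_gt0.
  move=> v' [/=]; rewrite /ball /= => h1 h2; rewrite distrC.
  have := hd ((v'.1 - v.1)%:C * al + (v'.2 - v.2)%:C * be).
  have -> : v.1%:C * al + v.2%:C * be + ((v'.1 - v.1)%:C * al + (v'.2 - v.2)%:C * be)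
    = v'.1%:C * al + v'.2%:C * be by rewrite !rmorphB; ring.
  apply; apply: le_lt_trans (nmD _ _) _; rewrite !nmM !nm_real.
  rewrite distrC in h1; rewrite distrC in h2.
  apply: (@le_lt_trans _ _ (d / K * (nm al + nm be))).
    by rewrite mulrDr lerD // ler_wpM2r ?nm_ge0 // ltW.
  by rewrite mulrAC ltr_pdivrMr // ltr_pM2l // ltrDl.
have [[x0 y0] /= Av hmax] := derive.compact_EVT_max A0 cA cpsi.
move: Av; rewrite inE /A /= !in_itv /= => -[hx hy]; exists x0, y0; split=> // x y xab yab.
by have := hmax (x, y); apply; rewrite inE /A /= !in_itv.
Qed.

Lemma taylor2_local_ext (f g : C -> C) z a1 a2 : (exists2 d : R, 0 < d & forall h, nm h < d -> f (z + h) = g (z + h)) ->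
  taylor2 f z a1 a2 -> taylor2 g z a1 a2.
Proof.
move=> [e e0 he] [B [d [d0 B0 hd]]]; exists B, (Num.min d e); split=> //.
  by rewrite lt_min d0.
have ez : f z = g z by have := he 0; rewrite nm0 addr0; apply.
by move=> h; rewrite lt_min => /andP[/hd + /he <-]; rewrite -ez.
Qed.

(** Averaging over the four displacements i^k eta kills the first two Taylor coefficients,
    so adding a multiple of the squared modulus, whose mean exceeds its value at z by
    e eta^2, excludes interior maxima. *)
Lemma no_local_max (g : C -> C) z a1 a2 (e : R) : 0 < e -> taylor2 g z a1 a2 ->
  forall d : R, 0 < d -> ~ (forall h, nm h < d ->
     nm (g (z + h)) + e * nm (z + h) ^+ 2 <= nm (g z) + e * nm z ^+ 2).
Proof.
move=> e0 [B [d1 [d10 B0 hB]]] d d0 hmax.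
pose eta := Num.min (d1 / 2%:R) (Num.min (d / 2%:R) (e / (B + 1) / 2%:R)).
have B1 : 0 < B + 1 by rewrite ltr_pwDr.
have eta0 : 0 < eta by rewrite !lt_min !divr_gt0.
have half (t : R) : 0 < t -> t / 2%:R < t by move=> ?; lra.
have etad1 : eta < d1 by rewrite gt_min half.
have etad : eta < d by rewrite !gt_min (half d) ?orbT.
have etae : eta * (B + 1) < e.
  rewrite -ltr_pdivlMr // !gt_min; apply/orP; right; apply/orP; right.
  by rewrite half // divr_gt0.
pose D (k : nat) : C := eta%:C * 'i ^+ k.
have i2 : ('i : C) ^+ 2 = -1 by rewrite sqrCi.
have ni : nm ('i : C) = 1.
  by apply/eqP; rewrite -(eqrXn2 (n := 2)) ?nm_ge0 // -nmX i2 nmN nm1 expr1n.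
have nD k : nm (D k) = eta by rewrite /D nmM nmX ni expr1n mulr1 nm_real gtr0_norm.
have hm k : nm (g (z + D k)) + e * nm (z + D k) ^+ 2 <= nm (g z) + e * nm z ^+ 2.
  by apply: hmax; rewrite nD.
have hT k : nm (g (z + D k) - (g z + a1 * D k + a2 * D k ^+ 2)) <= B * eta ^+ 3.
  by rewrite -[in leRHS](nD k); apply: hB; rewrite nD.
have par : nm (z + D 0) ^+ 2 + nm (z + D 1) ^+ 2 + nm (z + D 2) ^+ 2 + nm (z + D 3) ^+ 2
   = 4%:R * nm z ^+ 2 + 4%:R * eta ^+ 2.
  have -> : D 0 = eta%:C by rewrite /D expr0 mulr1.
  have -> : D 1 = eta%:C * 'i by rewrite /D expr1.
  have -> : D 2 = - eta%:C by rewrite /D i2 mulrN1.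
  have -> : D 3 = - (eta%:C * 'i) by rewrite /D exprS i2 mulrN1 mulrN.
  rewrite !nm_sqr; case: z {hB hmax hm hT} => a b /=; ring.
have sum4 (y0 y1 y2 y3 : C) :
    nm (y0 + y1 + y2 + y3) <= nm y0 + nm y1 + nm y2 + nm y3.
  do 2 (apply: le_trans (nmD _ _) _; apply: lerD => //); exact: nmD.
have tot : 4%:R * nm (g z) <= nm (g (z + D 0)) + nm (g (z + D 1)) + nm (g (z + D 2)) +
   nm (g (z + D 3)) + 4%:R * (B * eta ^+ 3).
  have -> : 4%:R * nm (g z) = nm (4%:R * g z) by rewrite nmM nm_nat.
  pose r k := g (z + D k) - (g z + a1 * D k + a2 * D k ^+ 2).
  have -> : 4%:R * g z = (g (z + D 0) + g (z + D 1) + g (z + D 2) + g (z + D 3))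
     - (r 0 + r 1 + r 2 + r 3).
    apply: (eq_of_sub (d := ('i ^+ 2 + 1) * (a1 * eta%:C * (1 + 'i) + a2 * eta%:C ^+ 2 * (1 + 'i ^+ 4))) (c := 0)).
      by rewrite i2 addNr mul0r.
    by rewrite /r /D; ring.
  apply: le_trans (nmD _ _) _; rewrite nmN; apply: lerD.
    exact: sum4.
  have -> : 4%:R * (B * eta ^+ 3) = B * eta ^+ 3 + B * eta ^+ 3 + B * eta ^+ 3 + B * eta ^+ 3 by ring.
  by apply: le_trans (sum4 _ _ _ _) _; apply: lerD; [apply: lerD; [apply: lerD|]|]; exact: hT.
have key : e * eta ^+ 2 <= B * eta ^+ 3.
  have := hm 0; have := hm 1; have := hm 2; have := hm 3; nra.
have : e <= B * eta.
  by rewrite -(ler_pM2r (x := eta ^+ 2)) ?exprn_gt0 // -mulrA -exprS.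
by move: etae eta0; move: B0; nra.
Qed.

(* A lattice function f that is holomorphic off the lattice, in the form of
   Taylor expansions, and vanishes to second order at the origin. Extended by 0 to the
   lattice points it is the continuous function F. *)
Section Lattice.
Variable Om : C.
Hypothesis Om0 : Om != 0.
Local Notation om := (om Om).
Local Notation lattice := (lattice Om).

Variable f : C -> C.
Hypothesis f_periodic : forall z n, ~ lattice z -> f (z + om n) = f z.
Hypothesis f_taylor : forall z, ~ lattice z -> exists a1 a2, taylor2 f z a1 a2.
Hypothesis f_zero : exists B d : R, [/\ 0 <= B, 0 < d &
  forall z, z != 0 -> nm z < d -> nm (f z) <= B * nm z ^+ 2].

Let F z : C := if pselect (lattice z) then 0 else f z.

Let F_lattice z : lattice z -> F z = 0.
Proof. by rewrite /F; case: pselect. Qed.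

Let F_off z : ~ lattice z -> F z = f z.
Proof. by rewrite /F; case: pselect. Qed.

Let lattice_zero : lattice 0.
Proof. by exists (0, 0); rewrite -/(om _) om0. Qed.

Let F_periodic z n : F (z + om n) = F z.
Proof.
have [zL|zL] := pselect (lattice z).
  rewrite !F_lattice //; case: zL => m ->.
  by rewrite -[lattice_point _ _ _]/(om m) -omD; exact: lattice_om.
rewrite !F_off ?f_periodic //; exact: off_latticeD.
Qed.

Let F_zero : exists B d : R, [/\ 0 <= B, 0 < d &
  forall h, nm h < d -> forall n, nm (F (om n + h)) <= B * nm h ^+ 2].
Proof.
have [B [d [B0 d0 hB]]] := f_zero; exists B, d; split=> // h hd n.
rewrite addrC F_periodic; have [hL|hL] := pselect (lattice h).
  by rewrite F_lattice // nm0 mulr_ge0 ?exprn_ge0 ?nm_ge0.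
rewrite F_off // hB //; apply/eqP => h0; apply: hL; rewrite h0.
exact: lattice_zero.
Qed.

Let F_taylor z : ~ lattice z -> exists a1 a2, taylor2 F z a1 a2.
Proof.
move=> zL; have [a1 [a2 h]] := f_taylor zL; exists a1, a2.
apply: taylor2_local_ext h; have [d d0 hd] := lattice_ball Om0 zL.
by exists d => // h /hd [zhL _]; rewrite F_off.
Qed.

Let cts_nm (phi : C -> C) : (forall z e, 0 < e ->
    exists2 d : R, 0 < d & forall h, nm h < d -> nm (phi (z + h) - phi z) <= e) ->
  cts (fun z => nm (phi z)).
Proof.
move=> h z e e0; have [d d0 hd] := h z e e0; exists d => // t /hd; apply: le_trans.
rewrite ler_norml lerBlDr; apply/andP; split; last first.
  by rewrite (le_trans _ (nmD _ _)) // subrK.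
by rewrite lerBrDl lerBlDr nm_distC (le_trans _ (nmD _ _)) // addrC subrK.
Qed.

Let taylor2_cts (phi : C -> C) z a1 a2 e : taylor2 phi z a1 a2 -> 0 < e ->
  exists2 d : R, 0 < d & forall h, nm h < d -> nm (phi (z + h) - phi z) <= e.
Proof.
move=> /taylor2_lip [B [d [d0 B0 hd]]] e0; have B1 : 0 < B + 1 by rewrite ltr_pwDr.
exists (Num.min d (e / (B + 1))); first by rewrite lt_min d0 divr_gt0.
move=> h; rewrite lt_min => /andP[/hd h1 h2]; apply: le_trans h1 _.
move: h2; rewrite ltr_pdivlMr // => h2; apply: le_trans _ (ltW h2).
by rewrite mulrC ler_wpM2l ?nm_ge0 // lerDl.
Qed.

Let F_cts : cts (fun z => nm (F z)).
Proof.
apply: cts_nm => z e e0; have [zL|zL] := pselect (lattice z); last first.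
  by have [a1 [a2 h]] := F_taylor zL; exact: taylor2_cts h e0.
have [B [d [B0 d0 hB]]] := F_zero; have B1 : 0 < B + 1 by rewrite ltr_pwDr.
exists (Num.min 1 (Num.min d (e / (B + 1)))).
  by rewrite !lt_min ltr01 d0 divr_gt0.
move=> h; rewrite !lt_min => /and3P[/ltW h1 hd h2]; rewrite (F_lattice zL) subr0.
case: zL => m em; rewrite em; apply: le_trans (hB h hd m) _.
move: h2; rewrite ltr_pdivlMr // => h2; apply: le_trans _ (ltW h2).
have n0 := nm_ge0 h.
apply: (@le_trans _ _ (B * nm h)); last by rewrite mulrC ler_wpM2l // lerDl.
by rewrite ler_wpM2l // expr2 ler_piMl.
Qed.

(* By periodicity it suffices to maximise over a fundamental parallelogram. *)
Let F_bounded : exists2 M : R, 0 <= M & forall z, nm (F z) <= M.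
Proof.
have [x0 [y0 [_ _ hmax]]] := cts_max Om (Om * rho R) ler01 F_cts.
exists (nm (F (x0%:C * Om + y0%:C * (Om * rho R)))); first exact: nm_ge0.
move=> z.
pose s : R := Num.sqrt 3%:R; have s0 : 0 < s by rewrite sqrtr_gt0.
pose w := z / Om; pose y := complex.Im w * 2%:R / s; pose x := complex.Re w - y / 2%:R.
have ew : w = x%:C + y%:C * rho R.
  rewrite /x /y /rho -/s; case: (w) => a b; apply/eqP; rewrite eq_complex /=.
  by apply/andP; split; apply/eqP; field; rewrite gt_eqF.
have ez : z = x%:C * Om + y%:C * (Om * rho R).
  by rewrite -[z](divfK Om0) -/w ew; ring.
pose m : int * int := (Num.floor x, Num.floor y).
have := F_periodic (z - om m) m; rewrite subrK => ->.
have fl (t : R) : 0 <= t - (Num.floor t)%:~R <= 1.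
  rewrite subr_ge0 Num.Theory.floor_le lerBlDr.
  by have := Num.Theory.floorD1_gt t; rewrite intrD addrC => /ltW.
have -> : z - om m = (x - (Num.floor x)%:~R)%:C * Om + (y - (Num.floor y)%:~R)%:C * (Om * rho R).
  rewrite ez omE /hex /m /= !rmorphB /= !rmorph_int; ring.
exact: hmax.
Qed.

(** If f were nonzero at z, then g = F / z would have |g(z)| = k > 0, while |g| is at
    most k / 4 from distance L of the origin on, F being bounded. Over the square of half-side L the
    sum u = |g| + e |w|^2 of functions of w, with e so small that the second term is
    at most k / 4, therefore has an interior maximum off the lattice, which
    [no_local_max] excludes. *)
Lemma lattice_liouville z : ~ lattice z -> f z = 0.
Proof.
move=> z0L; rewrite -F_off //; apply/eqP; rewrite -nm_eq0; apply/eqP.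
have z0 : z != 0 by apply/eqP => e; apply: z0L; rewrite e; exact: lattice_zero.
have nz0 : 0 < nm z by rewrite nm_gt0.
pose g w := F w / w.
have gL w : lattice w -> g w = 0 by move=> wL; rewrite /g F_lattice // mul0r.
have g_taylor w : ~ lattice w -> exists a1 a2, taylor2 g w a1 a2.
  move=> wL; have [a1 [a2 h]] := F_taylor wL.
  have w0 : w != 0 by apply/eqP => e; apply: wL; rewrite e; exact: lattice_zero.
  by do 2 eexists; exact: (taylor2M h (taylor2V w0 (taylor2_id w))).
have g_cts : cts (fun w => nm (g w)).
  apply: cts_nm => w e e0; have [wL|wL] := pselect (lattice w); last first.
    by have [a1 [a2 h]] := g_taylor w wL; exact: taylor2_cts h e0.
  have [B [d [B0 d0 hB]]] := F_zero; have B1 : 0 < B + 1 by rewrite ltr_pwDr.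
  rewrite (gL w wL); case: wL => m em.
  have [w0|w0] := eqVneq w 0.
    exists (Num.min d (e / (B + 1))); first by rewrite lt_min d0 divr_gt0.
    move=> h; rewrite lt_min => /andP[hd]; rewrite ltr_pdivlMr // => h2.
    rewrite subr0 w0 add0r /g nmM nmV; have := hB h hd (0, 0); rewrite om0 add0r => h3.
    have [h0|h0] := eqVneq h 0; first by rewrite h0 nm0 invr0 mulr0 ltW.
    have nh : 0 < nm h by rewrite nm_gt0.
    rewrite ler_pdivrMr //; apply: le_trans h3 _.
    by rewrite expr2 mulrA ler_pM2r // (le_trans _ (ltW h2)) // mulrC ler_pM2l // lerDl.
  have nw : 0 < nm w by rewrite nm_gt0.
  exists (Num.min 1 (Num.min (nm w / 2%:R) (Num.min d (e / (B + 1) * (nm w / 2%:R))))).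
    by rewrite !lt_min ltr01 d0 !divr_gt0 // mulr_gt0 // divr_gt0.
  move=> h; rewrite !lt_min => /and4P[/ltW h1 hw hd h2]; have n0 := nm_ge0 h.
  rewrite subr0 /g nmM nmV; have := hB h hd m; rewrite -[om m](em) => h3.
  have wh : nm w / 2%:R <= nm (w + h).
    by have := nm_sub w (- h); rewrite opprK nmN; lra.
  have wh0 : 0 < nm (w + h) by apply: lt_le_trans wh; rewrite divr_gt0.
  rewrite ler_pdivrMr //; apply: le_trans h3 _.
  apply: (@le_trans _ _ (e * (nm w / 2%:R))); last by rewrite ler_wpM2l // ltW.
  apply: (@le_trans _ _ (nm h * (B + 1))).
    rewrite mulrC expr2 -mulrA ler_wpM2l //; move: B0 n0 h1; nra.
  rewrite -ler_pdivlMr // ltW //; move: h2; by rewrite mulrAC.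
have [M M0 hM] := F_bounded.
apply/eqP; apply/negPn/negP => nF0.
pose k := nm (g z); have k0 : 0 < k.
  by rewrite /k /g nmM nmV mulr_gt0 ?invr_gt0 // lt_def nF0 nm_ge0.
pose L := nm z + 4%:R * M / k + 1.
have Mk : 0 <= 4%:R * M / k by rewrite divr_ge0 ?mulr_ge0 // ltW.
have L0 : 0 < L by rewrite /L; lra.
have zL : nm z <= L by rewrite /L; lra.
have ML : M / L <= k / 4%:R.
  rewrite ler_pdivrMr // mulrAC ler_pdivlMr // mulrC -ler_pdivrMl // mulrC.
  by rewrite /L; move: nz0; lra.
pose e := k / (8%:R * L ^+ 2); have L2 : 0 < L ^+ 2 by rewrite exprn_gt0.
have e0 : 0 < e by rewrite divr_gt0 // mulr_gt0.
have eL : e * (2%:R * L ^+ 2) = k / 4%:R by rewrite /e; field; rewrite gt_eqF.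
pose u w := nm (g w) + e * nm w ^+ 2.
have u_cts : cts u.
  move=> w d d0; have [d1 d10 h1] := g_cts w (d / 2%:R) (divr_gt0 d0 (ltr0Sn _ _)).
  pose q := e * (2%:R * nm w + 1); have q0 : 0 < q by rewrite mulr_gt0 // ltr_pwDr // mulr_ge0 ?nm_ge0.
  exists (Num.min 1 (Num.min d1 (d / 2%:R / q))); first by rewrite !lt_min ltr01 d10 !divr_gt0.
  move=> h; rewrite !lt_min => /and3P[/ltW hh /h1 {}h1]; rewrite ltr_pdivlMr // => h2.
  rewrite /u; have -> : nm (g (w + h)) + e * nm (w + h) ^+ 2 - (nm (g w) + e * nm w ^+ 2) =
    (nm (g (w + h)) - nm (g w)) + e * (nm (w + h) ^+ 2 - nm w ^+ 2) by ring.
  apply: le_trans (ler_normD _ _) _.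
  have -> : d = d / 2%:R + d / 2%:R by lra.
  apply: lerD => //; apply: le_trans _ (ltW h2); rewrite normrM gtr0_norm //.
  rewrite /q mulrCA ler_pM2l //.
  have a1 := nmD w h; have a2 := nm_sub w (- h); rewrite opprK nmN in a2.
  have n0 := nm_ge0 h; have n1 := nm_ge0 w; have n2 := nm_ge0 (w + h).
  by rewrite ler_norml; apply/andP; split; nra.
have LL : - L <= L by rewrite ge0_cp // ltW.
have [x0 [y0 [hx hy hmax]]] := cts_max 1 'i LL u_cts.
set z1 := x0%:C * 1 + y0%:C * 'i in hmax.
have coord (a b : R) : a%:C * 1 + b%:C * 'i = (a +i* b)%C :> C.
  by rewrite mulr1; apply/eqP; rewrite eq_complex /=; apply/andP; split; apply/eqP; ring.
have box w : `|complex.Re w| <= L -> `|complex.Im w| <= L -> u w <= u z1.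
  by rewrite !ler_norml => h1 h2; have := hmax _ _ h1 h2; rewrite coord; case: (w).
have nRe (w : C) : `|complex.Re w| <= nm w.
  by rewrite -(ler_sqr (x := `|_|)) ?nnegrE ?nm_ge0 // nm_sqr real_normK ?num_real // lerDl sqr_ge0.
have nIm (w : C) : `|complex.Im w| <= nm w.
  by rewrite -(ler_sqr (x := `|_|)) ?nnegrE ?nm_ge0 // nm_sqr real_normK ?num_real // lerDr sqr_ge0.
have uz : k < u z1.
  apply: (@lt_le_trans _ _ (u z)); first by rewrite /u -/k ltrDl mulr_gt0 // exprn_gt0.
  by apply: box; [apply: le_trans (nRe z) zL|apply: le_trans (nIm z) zL].
have ez1 : z1 = (x0 +i* y0)%C by rewrite /z1 coord.
have n1 : nm z1 ^+ 2 <= 2%:R * L ^+ 2.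
  rewrite nm_sqr ez1 /=.
  have : x0 ^+ 2 <= L ^+ 2 by rewrite -(real_normK (num_real x0)) lerXn2r ?nnegrE ?ler_norml ?(ltW L0).
  have : y0 ^+ 2 <= L ^+ 2 by rewrite -(real_normK (num_real y0)) lerXn2r ?nnegrE ?ler_norml ?(ltW L0).
  by lra.
have e1 : e * nm z1 ^+ 2 <= k / 4%:R by rewrite -eL ler_pM2l.
have z1L : ~ lattice z1.
  by move=> /gL g1; move: uz; rewrite /u g1 nm0 add0r; lra.
have g1 : k / 4%:R < nm (g z1) by move: uz; rewrite /u; lra.
have nz1 : nm z1 < L.
  rewrite ltNge; apply/negP => Lz; move: g1; rewrite ltNge => /negP[]; apply: le_trans ML.
  rewrite /g nmM nmV; apply: ler_pM => //; rewrite ?nm_ge0 ?invr_ge0 ?nm_ge0 //.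
  by rewrite lef_pV2 ?posrE // (lt_le_trans L0).
have [a1 [a2 ht]] := g_taylor z1 z1L.
apply: (no_local_max e0 ht (d := L - nm z1)); first by rewrite subr_gt0.
move=> h hh; apply: box.
  by apply: le_trans (nRe _) _; apply: le_trans (nmD _ _) _; lra.
by apply: le_trans (nIm _) _; apply: le_trans (nmD _ _) _; lra.
Qed.

End Lattice.

End Liouville.

(** * The differential equation of wp *)

Section Equations.
Variable R : realType.
Local Notation C := (R[i] : numFieldType).
Implicit Types (x y z h w : C).
Variable Om : C.
Hypothesis Om0 : Om != 0.
Local Notation om := (om Om).
Local Notation lattice := (lattice Om).
Local Notation wpz := (wpz Om).
Local Notation eisen := (eisen Om).
Local Notation G := (eisen0 Om 6).

Variable d : R.
Definition bounded_at0 (e : C -> C) := exists2 K : R, 0 <= K &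
  forall z, z != 0 -> nm z < d -> nm (e z) <= K.

Lemma bounded_cst c : bounded_at0 (fun=> c).
Proof. by exists (nm c) => //; exact: nm_ge0. Qed.

Lemma boundedD e1 e2 : bounded_at0 e1 -> bounded_at0 e2 -> bounded_at0 (fun z => e1 z + e2 z).
Proof.
move=> [K K0 h] [K' K0' h']; exists (K + K'); first exact: addr_ge0.
by move=> z z0 zd; apply: le_trans (nmD _ _) _; apply: lerD; [exact: h|exact: h'].
Qed.

Lemma boundedM e1 e2 : bounded_at0 e1 -> bounded_at0 e2 -> bounded_at0 (fun z => e1 z * e2 z).
Proof.
move=> [K K0 h] [K' K0' h']; exists (K * K'); first exact: mulr_ge0.
by move=> z z0 zd; rewrite nmM; apply: ler_pM; rewrite ?nm_ge0 ?h ?h'.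
Qed.

Lemma boundedN e : bounded_at0 e -> bounded_at0 (fun z => - e z).
Proof. by move=> [K K0 h]; exists K => // z z0 zd; rewrite nmN; exact: h. Qed.

Lemma boundedX e k : bounded_at0 e -> bounded_at0 (fun z => e z ^+ k).
Proof.
move=> [K K0 h]; exists (K ^+ k); first exact: exprn_ge0.
by move=> z z0 zd; rewrite nmX lerXn2r ?nnegrE ?nm_ge0 ?h.
Qed.

Lemma bounded_id : bounded_at0 id.
Proof. by exists `|d| => // z _ /ltW zd; rewrite (le_trans zd) // ler_norm. Qed.

(** Turns an asymptotic estimate into an equation with a bounded factor, so that the
    expansions can be multiplied by field arithmetic. *)
Lemma bounded_quot (f g : C -> C) n : (exists2 B : R, 0 <= B & forall z, z != 0 -> nm z < d ->
   nm (f z - g z) <= B * nm z ^+ n) ->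
  exists2 e : C -> C, bounded_at0 e & forall z, z != 0 -> f z = g z + z ^+ n * e z.
Proof.
move=> [B B0 h]; exists (fun z => (f z - g z) / z ^+ n).
  exists B => // z z0 zd; rewrite nmM nmV ler_pdivrMr ?nmX ?exprn_gt0 ?nm_gt0 //.
  exact: h.
by move=> z z0; rewrite mulrC divfK ?expf_neq0 // addrC subrK.
Qed.

End Equations.

Ltac bounded := repeat match goal with
  | |- bounded_at0 _ (fun=> ?c) => exact: (bounded_cst _ c)
  | |- bounded_at0 _ (fun z => z) => exact: bounded_id
  | H : bounded_at0 _ ?s |- bounded_at0 _ (fun z => ?s z) => exact: H
  | |- bounded_at0 _ (fun z => _ + _) => apply: boundedD
  | |- bounded_at0 _ (fun z => - _) => apply: boundedN
  | |- bounded_at0 _ (fun z => _ ^+ _) => apply: boundedX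
  | |- bounded_at0 _ (fun z => _ * _) => apply: boundedM
  end.

Section Weierstrass.
Variable R : realType.
Local Notation C := (R[i] : numFieldType).
Implicit Types (x y z h w : C).
Variable Om : C.
Hypothesis Om0 : Om != 0.
Local Notation om := (om Om).
Local Notation lattice := (lattice Om).
Local Notation wpz := (wpz Om).
Local Notation eisen := (eisen Om).
Local Notation G := (eisen0 Om 6).
Let d := nm Om / 2%:R.
Let d0 : 0 < d. Proof. by rewrite divr_gt0 // nm_gt0. Qed.

(** This is wp'' = 6 wp^2, as wp'' is 6 times [eisen 4]. The difference of the two sides
    is a lattice function and is O(z^2) at the origin by the Laurent expansions. *)
Lemma wpz_eisen4 z : ~ lattice z -> eisen 4 z = wpz z ^+ 2.
Proof.
move=> zL; apply/eqP; rewrite -subr_eq0; apply/eqP.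
apply: (@lattice_liouville R Om Om0 (fun z => eisen 4 z - wpz z ^+ 2)) zL.
- move=> w n wL; rewrite wpz_periodic //.
  by have := eisen_periodic Om0 1 n wL => /= ->.
- move=> w wL; do 2 eexists.
  apply: (taylor2_ext (f := fun z => eisen 4 z + (-1) * (wpz z * wpz z))).
    by move=> u; ring.
  apply: taylor2D (eisen4_taylor Om0 wL) _.
  apply: taylor2M (taylor2_cst _ _) _.
  exact: taylor2M (wpz_taylor Om0 wL) (wpz_taylor Om0 wL).
have [s2 b2 e2] := bounded_quot (wpz_laurent Om0).
have [s4 b4 e4] := bounded_quot (eisen4_laurent Om0).
pose e z := s4 z + - (10%:R * G) + - (2%:R * z ^+ 2 * s2 z)
   + - (z ^+ 6 * (5%:R * G + z ^+ 2 * s2 z) ^+ 2).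
have [K K0 hK] : bounded_at0 d e by rewrite /e; bounded.
exists K, d; split=> // w w0 wd.
have -> : eisen 4 w - wpz w ^+ 2 = w ^+ 2 * e w.
  by rewrite (e2 w w0) (e4 w w0) /e; field.
by rewrite nmM nmX mulrC ler_wpM2r ?exprn_ge0 ?nm_ge0 // hK.
Qed.

(** This is wp'^2 = 4 wp^3 - g3, as wp' is - 2 times [eisen 3]; the proof is the same. *)
Lemma wpz_eisen3 z : ~ lattice z -> eisen 3 z ^+ 2 = wpz z ^+ 3 - 35%:R * G.
Proof.
move=> zL; apply/eqP; rewrite -subr_eq0; apply/eqP.
apply: (@lattice_liouville R Om Om0 (fun z => eisen 3 z ^+ 2 - (wpz z ^+ 3 - 35%:R * G))) zL.
- move=> w n wL; rewrite wpz_periodic //.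
  by have := eisen_periodic Om0 0 n wL => /= ->.
- move=> w wL; do 2 eexists.
  apply: (taylor2_ext (f := fun z => eisen 3 z * eisen 3 z + ((-1) * (wpz z * (wpz z * wpz z))
     + 35%:R * G))).
    by move=> u; ring.
  apply: taylor2D (taylor2M (eisen3_taylor Om0 wL) (eisen3_taylor Om0 wL)) _.
  apply: taylor2D (taylor2_cst _ _).
  apply: taylor2M (taylor2_cst _ _) _.
  have h := wpz_taylor Om0 wL; exact: taylor2M h (taylor2M h h).
have [s2 b2 e2] := bounded_quot (wpz_laurent Om0).
have [s3 b3 e3] := bounded_quot (eisen3_laurent Om0).
pose Y z := 5%:R * G + z ^+ 2 * s2 z.
pose e z := 100%:R * G ^+ 2 * z ^+ 4 + 2%:R * s3 z + - (20%:R * G * z ^+ 6 * s3 z)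
  + z ^+ 8 * s3 z ^+ 2 + - (3%:R * s2 z) + - (3%:R * z ^+ 4 * Y z ^+ 2)
  + - (z ^+ 10 * Y z ^+ 3).
have [K K0 hK] : bounded_at0 d e by rewrite /e /Y; bounded.
exists K, d; split=> // w w0 wd.
have -> : eisen 3 w ^+ 2 - (wpz w ^+ 3 - 35%:R * G) = w ^+ 2 * e w.
  by rewrite (e2 w w0) (e3 w w0) /e /Y; field.
by rewrite nmM nmX mulrC ler_wpM2r ?exprn_ge0 ?nm_ge0 // hK.
Qed.

(** A value missed by wp would make 1 / (wp - x) a holomorphic lattice function, which is
    O(z^2) at the origin by the double pole of wp, hence zero. *)
Lemma wpz_surjective x : exists2 z, ~ lattice z & wpz z = x.
Proof.
have [//|no] := pselect (exists2 z, ~ lattice z & wpz z = x).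
have ne z : ~ lattice z -> wpz z - x != 0.
  by move=> zL; rewrite subr_eq0; apply/eqP => e; apply: no; exists z.
have zL : ~ lattice (Om / 2%:R).
  apply: near0_off_lattice => //; first by rewrite mulf_neq0 // invr_eq0 pnatr_eq0.
  by rewrite nmM nmV nm_nat; move: d0; rewrite /d; lra.
exfalso; apply/negP: (ne _ zL); rewrite negbK -invr_eq0; apply/eqP.
apply: (@lattice_liouville R Om Om0 (fun z => (wpz z - x)^-1)) zL.
- by move=> w n wL; rewrite wpz_periodic.
- move=> w wL; do 2 eexists; apply: (@taylor2V R (fun z => wpz z - x) w _ _ (ne w wL)).
  exact: taylor2D (wpz_taylor Om0 wL) (taylor2_cst _ _).
have [s2 b2 e2] := bounded_quot (wpz_laurent Om0).
pose t z := 5%:R * G * z ^+ 4 + z ^+ 6 * s2 z + - x.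
have [K K0 hK] : bounded_at0 d t by rewrite /t; bounded.
have K1 : 0 < K + 1 by rewrite ltr_pwDr.
exists 2%:R, (Num.min 1 (Num.min d (2^-1 / (K + 1)))).
split=> //; first by rewrite !lt_min ltr01 d0 divr_gt0 // invr_gt0.
move=> w w0; rewrite !lt_min => /and3P[/ltW w1 /(hK w w0) ht w2].
have -> : wpz w - x = w ^- 2 * (1 + w ^+ 2 * t w).
  by rewrite (e2 w w0) /t; field.
have y2 : nm (w ^+ 2 * t w) <= 2^-1.
  move: w2; rewrite ltr_pdivlMr // => /ltW; apply: le_trans.
  rewrite nmM nmX expr2 -mulrA ler_wpM2l ?nm_ge0 //.
  apply: (@le_trans _ _ (1 * K)); first by apply: ler_pM; rewrite ?nm_ge0.
  by rewrite mul1r lerDl.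
have [y0 y1] := half_unit y2.
by rewrite invfM invrK nmM nmX mulrC ler_wpM2r ?exprn_ge0 ?nm_ge0.
Qed.

(** The sign of the derivative is adjusted by replacing z with - z. *)
Lemma wpz_point x y : y ^+ 2 = 4%:R * x ^+ 3 - 140%:R * G ->
  exists z, [/\ ~ lattice z, wpz z = x & - 2%:R * eisen 3 z = y].
Proof.
move=> e; have [z zL zx] := wpz_surjective x.
have : (- 2%:R * eisen 3 z) ^+ 2 == y ^+ 2.
  rewrite e exprMn wpz_eisen3 // zx; apply/eqP; ring.
rewrite eqf_sqr => /orP[/eqP h|/eqP h]; first by exists z.
exists (- z); split; [exact: off_latticeN|by rewrite wpz_opp|].
have := eisen_opp Om0 0 zL => /= ->.
by apply: (eq_of_sub (esym h)); rewrite -[(3 + 0)%N]/3%N; ring.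
Qed.

End Weierstrass.

(** * Uniqueness and continuation of solutions *)

Lemma has_derivative_sub (K : numFieldType) (D E : set K) f t l :
  E `<=` D -> E t -> has_derivative D f t l -> has_derivative E f t l.
Proof.
move=> ED Et /has_derivativeP h; apply/has_derivativeP => // e e0.
have [d d0 hd] := h (ED _ Et) e e0; exists d => // s /ED; exact: hd.
Qed.

Lemma has_derivative_neq0 (K : numFieldType) (D : set K) f t l : D t ->
  has_derivative D f t l -> f t != 0 ->
  exists2 d, 0 < d & forall s, D s -> `|s - t| < d -> f s != 0.
Proof.
move=> Dt /has_derivativeP h ft; have [d d0 hd] := h Dt 1 ltr01.
have n0 : 0 < `|f t| by rewrite normr_gt0.
have k0 : 0 < `|l| + 1 by rewrite ltr_pwDr.
have e0 : 0 < `|f t| / (`|l| + 1) by rewrite divr_gt0.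
have [m m0 /andP[md me]] : exists2 m, 0 < m & (m <= d) && (m <= `|f t| / (`|l| + 1)).
  have := real_leVge (gtr0_real d0) (gtr0_real e0) => /orP[le|le].
    by exists d; rewrite ?lexx.
  by exists (`|f t| / (`|l| + 1)); rewrite ?lexx ?le.
exists m => // s Ds sm; apply/eqP => fs0.
have := hd s Ds (lt_le_trans sm md); rewrite fs0 sub0r mul1r => h1.
have := lt_le_trans sm me; rewrite ltr_pdivlMr // => h2.
suff : `|f t| < `|f t| by rewrite ltxx.
apply: le_lt_trans h2; rewrite mulrDr mulr1.
have -> : f t = - (- f t - l * (s - t)) - l * (s - t) by ring.
apply: le_trans (ler_normB _ _) _; rewrite normrN normrM addrC [X in X + _]mulrC.
by rewrite lerD2l.
Qed.

(* This keeps unification from unfolding a derivative to a statement on filters. *)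
Opaque has_derivative.

Section Rules.
Variables (K : numFieldType) (D : set K).
Implicit Types (f g : K -> K).

Lemma has_derivative_sqr f s l : has_derivative D f s l ->
  has_derivative D (fun s => f s ^+ 2) s (2%:R * f s * l).
Proof.
move=> fl; have -> : 2%:R * f s * l = l * f s + f s * l by ring.
exact: (has_derivativeM fl fl).
Qed.

Lemma has_derivativeZ c f s l : has_derivative D f s l ->
  has_derivative D (fun s => c * f s) s (c * l).
Proof.
move=> fl; have -> : c * l = 0 * f s + c * l by ring.
exact: (has_derivativeM (has_derivative_cst D c s) fl).
Qed.

Lemma has_derivativeB f g s l m : has_derivative D f s l -> has_derivative D g s m ->
  has_derivative D (fun s => f s + (-1) * g s) s (l + (-1) * m).
Proof. move=> fl gm; exact: (has_derivativeD fl (@has_derivativeZ (-1) g s m gm)). Qed.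

End Rules.

Section Uniqueness.
Variable R : realType.
Local Notation C := (R[i] : numFieldType).
Implicit Types (z w t : C) (D : set C).

(** Near t the quotient u / v has derivative zero, since u' v = u v', and so keeps its
    value 0. *)
Lemma quotient_eq0 D (u v u' v' : C -> C) t : good_domain D -> D t ->
  (exists2 d, 0 < d & forall s, D s -> `|s - t| < d ->
     [/\ has_derivative D u s (u' s), has_derivative D v s (v' s) &
         u' s * v s = u s * v' s]) ->
  u t = 0 -> v t != 0 ->
  exists2 d, 0 < d & forall s, D s -> `|s - t| < d -> u s = 0 /\ v s != 0.
Proof.
move=> gD Dt [d1 d10 h1] ut vt; have [_ sD _] := gD.
have tt1 : `|t - t| < d1 by rewrite subrr normr0.
have [_ hv _] := h1 t Dt tt1.
have [d2 d20 h2] := has_derivative_neq0 Dt hv vt.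
have [d3 d30 h3] := sD t Dt.
have [r1 r10 e1] := posC d10; have [r2 r20 e2] := posC d20; have [r3 r30 e3] := posC d30.
exists (Num.min r1 (Num.min r2 r3))%:C; first by rewrite ltcR !lt_min r10 r20.
move=> s Ds st.
pose E := [set w | D w /\ nm (w - t) < Num.min r1 (Num.min r2 r3)].
have st' : nm (s - t) < Num.min r1 (Num.min r2 r3) by rewrite -ltcR -nmE.
have toE w : E w -> [/\ D w, `|w - t| < d1, `|w - t| < d2 & `|w - t| < d3].
  by rewrite /E /= e1 e2 e3 nmE !ltcR !lt_min => -[? /and3P[]].
have [Ds1 s1 s2 s3] := toE s (conj Ds st').
split; last exact: h2.
have seg : segment_in E t s.
  move=> r r01; split; first exact: h3.
  rewrite addrC addKr nmM nm_real; case/andP: r01 => r0 r1'.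
  by rewrite ger0_norm //; apply: le_lt_trans st'; rewrite ler_piMl ?nm_ge0.
have Q : forall w, E w -> has_derivative E (fun w => u w / v w) w 0.
  move=> w Ew.
  have [Dw w1 w2 w3] := toE w Ew; have [hu hv' e] := h1 w Dw w1.
  have vw : v w != 0 := h2 w Dw w2.
  have sub : E `<=` D by move=> x [].
  have E0 x : E x -> v x != 0 by move=> Ex; have [Dx _ x2 _] := toE x Ex; exact: h2.
  have := has_derivativeM (has_derivative_sub sub Ew hu)
     (has_derivativeV Ew E0 (has_derivative_sub sub Ew hv')).
  have -> // : u' w * (v w)^-1 + u w * (- v' w / v w ^+ 2) = 0.
  by apply: (@mulIf _ (v w ^+ 2)); rewrite ?expf_neq0 // mul0r;
    apply: (eq_of_sub e); field.
apply/eqP; have /eqP := segment_cst seg Q; rewrite ut mul0r mulf_eq0 invr_eq0.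
by rewrite (negPf (h2 s Ds s2)) orbF.
Qed.

(** By the addition theorem wp (a - b) is a rational function of (X, Y) = (wp a, wp' a) and
    (W, V) = (wp b, wp' b), and a - b is constant along two solutions. With dX = X - W, dY = Y - V,
    sY = Y + V, the quotient of dX^2 by sY^2 - 4 (X + W) dX^2 is such a
    first integral, vanishing where the solutions agree, which works where Y
    is nonzero. Where Y = 0 both terms vanish; there one multiplies by dY / dX = q / sY
    with q = 4 (X^2 + X W + W^2), the slopes being equal by the equation of the curve, and
    obtains the quotient of dY^2 by q^2 - 4 (X + W) dY^2. *)
Lemma weierstrass_system_unique D (X Y W V : C -> C) (g : C) t :
  good_domain D -> D t -> g != 0 ->
  (exists2 d, 0 < d & forall s, D s -> `|s - t| < d ->
     [/\ has_derivative D X s (Y s), has_derivative D Y s (6%:R * X s ^+ 2),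
         has_derivative D W s (V s), has_derivative D V s (6%:R * W s ^+ 2) &
         Y s ^+ 2 = 4%:R * X s ^+ 3 - g /\ V s ^+ 2 = 4%:R * W s ^+ 3 - g]) ->
  X t = W t -> Y t = V t ->
  exists2 d, 0 < d & forall s, D s -> `|s - t| < d -> X s = W s /\ Y s = V s.
Proof.
move=> gD Dt g0 [d0 d00 h] eX eY.
have [Y0|Y0] := eqVneq (Y t) 0.
  have X0 : X t != 0.
    apply: contraNneq g0 => X0; have tt0 : `|t - t| < d0 by rewrite subrr normr0.
    have [_ _ _ _ [e _]] := h t Dt tt0.
    by move/eqP: e; rewrite X0 Y0 !expr0n mulr0 sub0r eq_sym oppr_eq0.
  pose q s := 4%:R * (X s ^+ 2 + X s * W s + W s ^+ 2).
  have [|||d dpos hd] := @quotient_eq0 D (fun s => (Y s + (-1) * V s) ^+ 2)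
    (fun s => q s ^+ 2 + (-1) * (4%:R * ((X s + W s) * (Y s + (-1) * V s) ^+ 2)))
    (fun s => 2%:R * (Y s + (-1) * V s) * (6%:R * X s ^+ 2 + (-1) * (6%:R * W s ^+ 2)))
    (fun s => 2%:R * q s * (4%:R * (2%:R * X s * Y s + (Y s * W s + X s * V s) + 2%:R * W s * V s))
      + (-1) * (4%:R * ((Y s + V s) * (Y s + (-1) * V s) ^+ 2 + (X s + W s) *
        (2%:R * (Y s + (-1) * V s) * (6%:R * X s ^+ 2 + (-1) * (6%:R * W s ^+ 2)))))) t gD Dt.
  - exists d0 => // s Ds sd; have [hX hY hW hV [e1 e2]] := h s Ds sd.
    have hq : has_derivative D q s (4%:R * (2%:R * X s * Y s + (Y s * W s + X s * V s) + 2%:R * W s * V s)).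
      apply: has_derivativeZ; apply: has_derivativeD (has_derivative_sqr hW).
      by apply: has_derivativeD (has_derivative_sqr hX) _; exact: has_derivativeM.
    have hu := has_derivative_sqr (has_derivativeB hY hV).
    split; first exact: hu.
      apply: (has_derivativeB (has_derivative_sqr hq)); apply: has_derivativeZ.
      exact: (has_derivativeM (has_derivativeD hX hW) hu).
    have e3 : (Y s + (-1) * V s) * (Y s + V s) = (X s + (-1) * W s) * q s.
      by apply: (eq_of_sub (c := Y s ^+ 2 - V s ^+ 2) (d := 4%:R * X s ^+ 3 - g - (4%:R * W s ^+ 3 - g)));
        [rewrite e1 e2 | rewrite /q; ring].
    pose K := 4%:R * (Y s + (-1) * V s) ^+ 3
      - 12%:R * (Y s + (-1) * V s) * q s * (X s + W s).
    apply: (eq_of_sub (c := K * ((Y s + (-1) * V s) * (Y s + V s)))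
       (d := K * ((X s + (-1) * W s) * q s))); first by rewrite e3.
    by rewrite /K /q; ring.
  - by rewrite eY mulN1r subrr expr0n.
  - rewrite eY !mulN1r subrr expr0n /= !mulr0 oppr0 addr0 expf_neq0 // /q -eX.
    have -> : X t ^+ 2 + X t * X t + X t ^+ 2 = 3%:R * X t ^+ 2 by ring.
    by rewrite !mulf_neq0 ?expf_neq0 // pnatr_eq0.
  have [r r0 ed] := posC dpos; have [r1 r10 ed1] := posC d00.
  exists (Num.min r r1)%:C; first by rewrite ltcR lt_min r0.
  move=> s Ds; rewrite nmE ltcR lt_min => /andP[s1 s2].
  have s2' : `|s - t| < d0 by rewrite nmE ed1 ltcR.
  have [_ _ _ _ [e1 e2]] := h s Ds s2'.
  have [|eu ev] := hd s Ds _; first by rewrite nmE ed ltcR.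
  have eYV : Y s = V s.
    by apply/eqP; rewrite -subr_eq0 -mulN1r -sqrf_eq0; apply/eqP; exact: eu.
  have q0 : q s != 0.
    by apply: contraNneq ev => ->; rewrite eu !mulr0 expr0n addr0.
  split=> //; apply/eqP; rewrite -subr_eq0 -[_ == 0](inj_eq (mulIf q0)) mul0r.
  apply/eqP; apply: (eq_of_sub (c := V s ^+ 2 - Y s ^+ 2)
    (d := 4%:R * W s ^+ 3 - g - (4%:R * X s ^+ 3 - g))); first by rewrite e1 e2.
  by rewrite eYV /q; ring.
have [|||d dpos hd] := @quotient_eq0 D (fun s => (X s + (-1) * W s) ^+ 2)
  (fun s => (Y s + V s) ^+ 2 + (-1) * (4%:R * ((X s + W s) * (X s + (-1) * W s) ^+ 2)))
  (fun s => 2%:R * (X s + (-1) * W s) * (Y s + (-1) * V s))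
  (fun s => 2%:R * (Y s + V s) * (6%:R * X s ^+ 2 + 6%:R * W s ^+ 2)
    + (-1) * (4%:R * ((Y s + V s) * (X s + (-1) * W s) ^+ 2 + (X s + W s) *
      (2%:R * (X s + (-1) * W s) * (Y s + (-1) * V s))))) t gD Dt.
- exists d0 => // s Ds sd; have [hX hY hW hV [e1 e2]] := h s Ds sd.
  have hu := has_derivative_sqr (has_derivativeB hX hW).
  split; first exact: hu.
    apply: (has_derivativeB (has_derivative_sqr (has_derivativeD hY hV))).
    apply: has_derivativeZ; exact: (has_derivativeM (has_derivativeD hX hW) hu).
  pose K := 2%:R * (X s + (-1) * W s) * (Y s + V s).
  apply: (eq_of_sub (c := K * (Y s ^+ 2 - V s ^+ 2))
     (d := K * (4%:R * X s ^+ 3 - g - (4%:R * W s ^+ 3 - g)))); first by rewrite e1 e2.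
  by rewrite /K; ring.
- by rewrite eX mulN1r subrr expr0n.
- rewrite eX !mulN1r subrr expr0n /= !mulr0 oppr0 addr0 expf_neq0 // -eY -mulr2n.
  by rewrite -mulr_natl mulf_neq0 // pnatr_eq0.
have [r r0 ed] := posC dpos; have [r1 r10 ed1] := posC d00.
exists (Num.min r r1)%:C; first by rewrite ltcR lt_min r0.
move=> s Ds; rewrite nmE ltcR lt_min => /andP[s1 s2].
have s2' : `|s - t| < d0 by rewrite nmE ed1 ltcR.
have [_ _ _ _ [e1 e2]] := h s Ds s2'.
have [|eu ev] := hd s Ds _; first by rewrite nmE ed ltcR.
have eXW : X s = W s.
  by apply/eqP; rewrite -subr_eq0 -mulN1r -sqrf_eq0; apply/eqP; exact: eu.
have s0 : Y s + V s != 0.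
  by apply: contraNneq ev => ->; rewrite eu !mulr0 expr0n addr0.
split=> //; apply/eqP; rewrite -subr_eq0 -[_ == 0](inj_eq (mulIf s0)) mul0r.
apply/eqP; apply: (eq_of_sub (c := Y s ^+ 2 - V s ^+ 2)
  (d := 4%:R * X s ^+ 3 - g - (4%:R * W s ^+ 3 - g))); first by rewrite e1 e2.
by rewrite eXW; ring.
Qed.

End Uniqueness.

Section Continuation.
Variable R : realType.
Local Notation C := (R[i] : numFieldType).
Implicit Types (z w t h : C) (D : set C).

Lemma taylor2_shift (f : C -> C) c z a1 a2 :
  taylor2 f (z + c) a1 a2 -> taylor2 (fun w => f (w + c)) z a1 a2.
Proof.
by move=> [B [d [d0 B0 hf]]]; exists B, d; split=> // h hd; rewrite addrAC; exact: hf.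
Qed.

Lemma has_derivative_bounded D (f : C -> C) t l : D t -> has_derivative D f t l ->
  exists2 d : R, 0 < d & forall s, D s -> nm (s - t) < d -> nm (f s) <= nm (f t) + 1.
Proof.
move=> Dt /has_derivativeP hf; have [d /posC[d' d0 ->] hd] := hf Dt 1 ltr01.
have k0 : 0 < nm l + 1 by rewrite ltr_pwDr // nm_ge0.
exists (Num.min d' (nm l + 1)^-1); first by rewrite lt_min d0 invr_gt0.
move=> s Ds; rewrite lt_min => /andP[s1 s2].
have := hd s Ds; rewrite nmE ltcR => /(_ s1); rewrite mul1r !nmE lecR => e1.
have -> : f s = f t + (f s - f t - l * (s - t)) + l * (s - t) by ring.
have := nmD (f t + (f s - f t - l * (s - t))) (l * (s - t)).
have := nmD (f t) (f s - f t - l * (s - t)).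
have : nm (s - t) * (nm l + 1) <= 1 by rewrite -ler_pdivlMr // div1r ltW.
rewrite nmM; lra.
Qed.

Variable Om : C.
Hypothesis Om0 : Om != 0.
Local Notation om := (om Om).
Local Notation lattice := (lattice Om).
Local Notation wpz := (wpz Om).
Local Notation eisen := (eisen Om).
Local Notation g := (140%:R * eisen0 Om 6).

(** By the expansion at the origin wp differs from z^-2 by a bounded amount. *)
Lemma wpz_pole (M : R) : exists2 d : R, 0 < d &
  forall z, z != 0 -> nm z < d -> M < nm (wpz z).
Proof.
have [B B0 hB] := wpz_laurent Om0; have o0 : 0 < nm Om by rewrite nm_gt0.
pose a := nm (5%:R * eisen0 Om 6); have a0 : 0 <= a := nm_ge0 _.
pose L := `|M| + a + B + 1; have M0 : 0 <= `|M| := normr_ge0 M.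
have L0 : 0 < L by rewrite /L; lra.
exists (Num.min 1 (Num.min (nm Om / 2%:R) L^-1)).
  by rewrite !lt_min ltr01 divr_gt0 // invr_gt0.
move=> z z0; rewrite !lt_min => /and3P[z1 z2 z3].
have n0 : 0 < nm z by rewrite nm_gt0.
have := hB z z0 z2; set r := wpz z - _ => hr.
have e : z ^- 2 = wpz z - r - 5%:R * eisen0 Om 6 * z ^+ 4 by rewrite /r; ring.
have : nm (z ^- 2) <= nm (wpz z) + nm r + a * nm z ^+ 4.
  have := nmD (wpz z - r) (- (5%:R * eisen0 Om 6 * z ^+ 4)).
  have := nmD (wpz z) (- r); rewrite -e !nmN nmM nmX -/a; lra.
have p1 k : nm z ^+ k <= 1 by rewrite exprn_ile1 // ltW.
have p4 : a * nm z ^+ 4 <= a by rewrite ler_piMr.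
have p6 : B * nm z ^+ 6 <= B by rewrite ler_piMr.
have : L < nm (z ^- 2).
  rewrite nmV nmX; apply: (@lt_le_trans _ _ (nm z)^-1).
    by rewrite -[L]invrK ltf_pV2 // posrE invr_gt0.
  by rewrite lef_pV2 ?posrE ?exprn_gt0 // expr2 ler_piMr ?ltW.
have := ler_norm M; rewrite /L; lra.
Qed.

Lemma wpz_shift_derivative D c t : D t -> ~ lattice (t + c) ->
  has_derivative D (fun w => wpz (w + c)) t (- 2%:R * eisen 3 (t + c)).
Proof.
move=> Dt tL; apply: (taylor2_has_derivative Dt (taylor2_shift (wpz_taylor Om0 tL))).
Qed.

Lemma eisen3_shift_derivative D c t : D t -> ~ lattice (t + c) ->
  has_derivative D (fun w => - 2%:R * eisen 3 (w + c)) t (6%:R * wpz (t + c) ^+ 2).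
Proof.
move=> Dt tL; rewrite -(wpz_eisen4 Om0 tL).
have -> : 6%:R * eisen 4 (t + c) = - 2%:R * (- 3%:R * eisen 4 (t + c)) by ring.
apply: has_derivativeZ.
exact: (taylor2_has_derivative Dt (taylor2_shift (eisen3_taylor Om0 tL))).
Qed.

(** The solution wp (t + c) is continued along D: the set where it agrees with
    (X, Y) is open by uniqueness, and closed because X stays bounded where wp
    would have a pole. *)
Lemma wpz_continuation D (X Y : C -> C) t0 z0 : good_domain D -> g != 0 ->
  (forall t, D t -> [/\ has_derivative D X t (Y t),
     has_derivative D Y t (6%:R * X t ^+ 2) & Y t ^+ 2 = 4%:R * X t ^+ 3 - g]) ->
  D t0 -> ~ lattice z0 -> wpz z0 = X t0 -> - 2%:R * eisen 3 z0 = Y t0 ->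
  forall t, D t -> ~ lattice (t + (z0 - t0)) /\ X t = wpz (t + (z0 - t0)).
Proof.
move=> gD g0 XY Dt0 z0L eX eY; set c := z0 - t0.
have tc : t0 + c = z0 by rewrite addrC subrK.
pose P t := [/\ ~ lattice (t + c), X t = wpz (t + c) & Y t = - 2%:R * eisen 3 (t + c)].
suff main : forall t, D t -> P t by move=> t /main[].
case: (gD) => ind _ _; apply: (ind P); last 1 first.
  by exists t0; [exact: Dt0|split; rewrite tc].
- move=> t Dt [tL eXt eYt]; have [d d0 hd] := lattice_ball Om0 tL.
  have near s : nm (s - t) < d -> ~ lattice (s + c).
    by move=> /hd[+ _]; have -> : t + c + (s - t) = s + c by ring.
  have [|d1 /posC[d1' d10 ->] hd1] := @weierstrass_system_unique R D X Y
      (fun w => wpz (w + c)) (fun w => - 2%:R * eisen 3 (w + c)) g t gD Dt g0 _ eXt eYt.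
    exists d%:C; first by rewrite ltcR.
    move=> s Ds; rewrite nmE ltcR => /near sL; have [X1 Y1 e1] := XY s Ds.
    split; [exact: X1|exact: Y1|exact: wpz_shift_derivative|exact: eisen3_shift_derivative|].
    by split; [exact: e1|rewrite exprMn (wpz_eisen3 Om0 sL); ring].
  exists (Num.min d d1')%:C; first by rewrite ltcR lt_min d0.
  move=> s Ds; rewrite nmE ltcR lt_min => /andP[s1 s2].
  have [|eX1 eY1] := hd1 s Ds; first by rewrite nmE ltcR.
  by split; [exact: near|exact: eX1|exact: eY1].
- move=> t Dt ht; have [X1 Y1 _] := XY t Dt.
  have tL : ~ lattice (t + c).
    move=> [n en]; have o0 : 0 < nm Om by rewrite nm_gt0.
    have [d d0 hd] := has_derivative_bounded Dt X1.
    have [d1 d10 hd1] := wpz_pole (nm (X t) + 1).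
    have [|w [Dw]] := ht (Num.min d (Num.min d1 (nm Om)))%:C.
      by rewrite ltcR !lt_min d0 d10.
    rewrite nmE ltcR !lt_min => /and3P[w1 w2 w3] [wL eXw _].
    have wt : w + c = w - t + om n.
      by rewrite /om /hex -[lattice_point _ _ _]en; ring.
    have wt0 : w - t != 0.
      by apply: contra_notN wL => /eqP e; rewrite wt e add0r; exact: lattice_om.
    have wtL := near0_off_lattice Om0 wt0 w3.
    have := hd w Dw w1; rewrite eXw wt (wpz_periodic Om0 n wtL).
    by rewrite leNgt (hd1 _ wt0 w2).
  have clos (f : C -> C) (l : C) : (forall w, P w -> f w = 0) -> has_derivative D f t l -> f t = 0.
    move=> f0 hf; apply/eqP; apply: contraT => ft.
    have [d d0 hd] := has_derivative_neq0 Dt hf ft.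
    by have [x [Dx xd /f0 fx]] := ht d d0; have := hd x Dx xd; rewrite fx eqxx.
  have W1 := wpz_shift_derivative Dt tL; have V1 := eisen3_shift_derivative Dt tL.
  have eqX : X t + (-1) * wpz (t + c) = 0.
    apply: (clos _ _ _ (has_derivativeB X1 W1)) => w [_ -> _].
    by rewrite mulN1r subrr.
  have eqY : Y t + (-1) * (- 2%:R * eisen 3 (t + c)) = 0.
    apply: (clos _ _ _ (has_derivativeB Y1 V1)) => w [_ _ ->].
    by rewrite mulN1r subrr.
  by split; [exact: tL|move: eqX|move: eqY]; rewrite mulN1r => /subr0_eq.
Qed.

End Continuation.

(** * Hamilton curves *)

(** [weierstrass_wp_along] for a scalar field embedded in the complex numbers
    by an arbitrary [iota]. *)
Definition wp_along_embedding (R : realType) (K : numFieldType) (iota : K -> R[i])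
    (D : set K) (p q : K -> K) (F G2 G3 : bipoly K) : Prop :=
  exists w1 w2 : R[i],
    [/\ lattice_basis w1 w2,
        lattice_g2 w1 w2 ^+ 3 - 27%:R * lattice_g3 w1 w2 ^+ 2 != 0,
        forall t, D t ->
          iota (along p q G2 t) = lattice_g2 w1 w2 /\
          iota (along p q G3 t) = lattice_g3 w1 w2 &
        exists c : R[i], forall t, D t ->
          ~ in_lattice w1 w2 (iota t + c) /\
          iota (along p q F t) = wp w1 w2 (iota t + c)].

Section Assembly.
Variable R : realType.
Local Notation C := (R[i] : numFieldType).
Variables (K : numFieldType) (iota : {rmorphism K -> C}) (kappa : C -> K).
Hypothesis iotaK : cancel iota kappa.
Hypothesis iota_norm : forall x, `|iota x| = iota `|x|.
Hypothesis iota_lt : forall x y, (iota x < iota y) = (x < y).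
Hypothesis iota_pos : forall e : C, 0 < e -> exists2 e', 0 < e' & e = iota e'.
Variables (N : nat) (U : bipoly K) (D : set K) (p q : K -> K).
Hypothesis N4 : (4 < N)%N.
Hypothesis hU : quantic N U.
Hypothesis gD : good_domain [set iota s | s in D].
Hypothesis hpq : hamilton_curve D p q U.
Hypothesis U0 : forall t, D t -> along p q U t <> 0.

Let transfer := has_derivative_transfer iotaK iota_norm iota_lt iota_pos.

Lemma accumulating_preimage : accumulating D.
Proof.
move=> t d Dt d0; case: gD => _ _ aD.
have [||_ [[s Ds <-] st sd]] := aD (iota t) (iota d); first by exists t.
  by rewrite -(rmorph0 iota) iota_lt.
exists s; split => //; first by apply: contra_neq st => ->.
by rewrite -iota_lt -iota_norm rmorphB.
Qed.

(** Transferred to the complex plane, a function with derivative zero is constant. *)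
Lemma constant_alongP V : constant_along D p q V <-> vanishes_along D p q (jacobian U V).
Proof.
split=> [[c hc] t Dt|J0].
  apply: (has_derivative_unique accumulating_preimage Dt (has_derivative_along (V := V) hpq Dt)).
  apply: (has_derivative_ext Dt _ (has_derivative_cst D c t)) => s Ds.
  by rewrite hc.
have [[t0 Dt0]|nD] := pselect (exists t, D t); last first.
  by exists 0 => t Dt; case: nD; exists t.
exists (along p q V t0) => t Dt; apply: (can_inj iotaK).
have h := @has_derivative0_cst R _ (fun z => iota (along p q V (kappa z))) gD _
  (iota t0) (iota t).
move: h; rewrite !iotaK; apply; [|by exists t0|by exists t].
move=> _ [s Ds <-]; rewrite -(rmorph0 iota); apply: transfer => //.
by rewrite -(J0 s Ds); exact: has_derivative_along.
Qed.

Let k : K := N%:R ^+ 2 * (N%:R - 2%:R) ^+ 2.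
Let k0 : k != 0.
Proof.
have N2 : (N%:R : K) - 2%:R != 0 by apply: natr_sub_neq0; exact: leq_trans N4.
by rewrite mulf_neq0 ?expf_neq0 // pnatr_eq0 -lt0n (leq_trans _ N4).
Qed.

Lemma kU_neq0 t n : D t -> along p q ((k *: U) ^+ n) t != 0.
Proof. by move=> Dt; rewrite !alongE expf_neq0 // mulf_neq0 //; apply/eqP; exact: U0. Qed.

Lemma constant_along_coef n V : constant_along D p q ((k *: U) ^+ n * V) <->
  vanishes_along D p q (jacobian U V).
Proof.
rewrite constant_alongP; split=> h t Dt; have := h t Dt; rewrite jacobian_expZ alongM.
  by move=> /eqP; rewrite mulf_eq0 (negPf (kU_neq0 n Dt)) => /eqP.
by move=> ->; rewrite mulr0.
Qed.

Lemma weierstrass_along t : D t -> exists2 dPhi,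
  has_derivative D (along p q (Phi N U)) t dPhi &
  dPhi ^+ 2 = 4%:R * along p q (Phi N U) t ^+ 3
              - along p q (g2 N U) t * along p q (Phi N U) t
              - along p q (g3 N U) t.
Proof.
move=> Dt; exists (along p q (jacobian U (Phi N U)) t); first exact: has_derivative_along.
exact: (along_weierstrass _ _ _ (weierstrass_syzygy (ltnW N4) hU)).
Qed.

(* From here on the equation is proper and Phi is nonconstant. *)
Hypothesis proper2 : vanishes_along D p q (jacobian U (covS N U)).
Hypothesis proper3 : vanishes_along D p q (jacobian U (covT N U)).
Hypothesis Phi_var : ~ constant_along D p q (Phi N U).

Lemma domain_inhabited : exists t, D t.
Proof. by apply: contra_notP Phi_var => nD; exists 0 => t Dt; case: nD; exists t. Qed.

Lemma form_eq0_along d V : quantic d V -> vanishes_along D p q V -> V = 0.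
Proof.
apply: (quantic_vanish _ hU domain_inhabited U0); first exact: leq_trans N4.
move=> W W0; apply/constant_alongP; exists 0; exact: W0.
Qed.

Lemma jacobian_covT : jacobian U (covT N U) = 0.
Proof. exact: form_eq0_along (quantic_jacobian hU (quantic_covT hU)) proper3. Qed.

(** In the other case of the dichotomy Phi would be constant. *)
Lemma covS_eq0 : covS N U = 0.
Proof.
have JS := form_eq0_along (quantic_jacobian hU (quantic_covS hU)) proper2.
have [//|J0] := covS_dichotomy iota N4 hU JS jacobian_covT.
by case: Phi_var; apply/constant_alongP => t _; rewrite J0 along0.
Qed.

Let P := Phi N U.
Let Psi := jacobian U P.

Lemma Psi_sqr : Psi ^+ 2 = 4%:R * P ^+ 3 - g3 N U.
Proof.
rewrite /Psi /P (weierstrass_syzygy (ltnW N4) hU).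
by rewrite /g2 covS_eq0 mulr0 mul0r subr0.
Qed.

Lemma jacobian_Psi : jacobian U Psi = 6%:R * P ^+ 2.
Proof.
have Psi0 : Psi != 0.
  apply/eqP => h; apply: Phi_var; apply/constant_alongP => t _.
  by rewrite -/P -/Psi h along0.
have J3 : jacobian U (g3 N U) = 0 by rewrite /g3 jacobian_expZ jacobian_covT mulr0.
exact: (jacobian_weierstrass Psi_sqr J3 Psi0).
Qed.

(** The lattice is chosen to have the constant value of g3, and the shift c so that wp and
    its derivative take the values of Phi and its derivative at one time t0. *)
Lemma wp_along : (forall t, D t -> along p q (covT N U) t <> 0) ->
  wp_along_embedding iota D p q (Phi N U) (g2 N U) (g3 N U).
Proof.
move=> T0; have [t0 Dt0] := domain_inhabited.
have [c3 hc3] : constant_along D p q (g3 N U) by apply/constant_along_coef.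
pose g := iota c3; have g0 : g != 0.
  rewrite fmorph_eq0 -(hc3 t0 Dt0) /g3 alongM mulf_neq0 ?kU_neq0 //.
  by apply/eqP; exact: T0.
have [Om Om0 Og] := hexagonal_lattice_g3 g0.
pose X z := iota (along p q P (kappa z)); pose Y z := iota (along p q Psi (kappa z)).
have eXY t : D t -> Y (iota t) ^+ 2 = 4%:R * X (iota t) ^+ 3 - 140%:R * eisen0 Om 6.
  have syz V W G : V ^+ 2 = 4%:R * W ^+ 3 - G -> iota (along p q V t) ^+ 2 =
      4%:R * iota (along p q W t) ^+ 3 - iota (along p q G t).
    move=> e; rewrite -rmorphXn -alongX e !alongE.
    by rewrite rmorphB rmorphM rmorphXn rmorph_nat.
  move=> Dt; rewrite Og /g -(hc3 t Dt) /X /Y iotaK; exact: syz Psi_sqr.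
have [z0 [z0L eX eY]] := wpz_point Om0 (eXY t0 Dt0).
have Og0 : 140%:R * eisen0 Om 6 != 0 by rewrite Og.
have g2_0 : lattice_g2 Om (Om * rho R) = 0 by rewrite lattice_g2E eisen0_4 // mulr0.
have g3_g : lattice_g3 Om (Om * rho R) = g by rewrite lattice_g3E.
exists Om, (Om * rho R); split.
- move=> x y /eqP; have -> : x%:C * Om + y%:C * (Om * rho R) = Om * (x%:C + y%:C * rho R) by ring.
  rewrite mulf_eq0 (negPf Om0) /= eq_complex /= => /andP[/eqP e1 /eqP e2].
  have s3 : 0 < Num.sqrt 3%:R :> R by rewrite sqrtr_gt0.
  have y0 : y = 0.
    move: e2; rewrite !mul0r addr0 add0r => /eqP.
    by rewrite mulf_eq0 (gt_eqF (divr_gt0 s3 _)) ?orbF // => /eqP.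
  by split=> //; move: e1; rewrite y0 !mul0r subr0 addr0.
- by rewrite g2_0 g3_g expr0n sub0r oppr_eq0 mulf_neq0 ?pnatr_eq0 // expf_neq0.
- by move=> t Dt; rewrite g2_0 g3_g hc3 // /g2 covS_eq0 mulr0 along0 rmorph0.
exists (z0 - iota t0) => t Dt.
have [|||tL eXt] := @wpz_continuation R Om Om0 _ X Y (iota t0) z0 gD Og0 _ _ z0L eX eY (iota t).
- move=> _ [s Ds <-]; split; last exact: eXY.
    by rewrite /Y iotaK; apply: transfer => //; exact: has_derivative_along.
  have -> : 6%:R * X (iota s) ^+ 2 = iota (along p q (jacobian U Psi) s).
    have syz V W : V = 6%:R * W ^+ 2 -> iota (along p q V s) = 6%:R * iota (along p q W s) ^+ 2.
      by move=> ->; rewrite !alongE rmorphM rmorphXn rmorph_nat.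
    by rewrite /X iotaK (syz _ _ jacobian_Psi).
  by apply: transfer => //; exact: has_derivative_along.
- by exists t0.
- by exists t.
by split; [exact: tL|rewrite -[RHS]eXt /X iotaK].
Qed.

End Assembly.

Section Generic.
Variable R : realType.
Local Notation C := (R[i] : numFieldType).

(** One proof serves both scalar fields, as only an isometric embedding in the
    complex numbers and the image of the time domain matter. *)
Lemma hamilton_weierstrass (K : numFieldType) (iota : {rmorphism K -> C}) (kappa : C -> K)
  (N : nat) (U : bipoly K) (D : set K) (p q : K -> K) :
  cancel iota kappa -> (forall x, `|iota x| = iota `|x|) ->
  (forall x y, (iota x < iota y) = (x < y)) ->
  (forall e : C, 0 < e -> exists2 e', 0 < e' & e = iota e') ->
  (4 < N)%N -> quantic N U -> good_domain [set iota s | s in D] ->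
  hamilton_curve D p q U -> (forall t, D t -> along p q U t <> 0) ->
  let proper :=
    constant_along D p q (g2 N U) /\ constant_along D p q (g3 N U) in
  [/\ forall t, D t -> exists2 dPhi,
        has_derivative D (along p q (Phi N U)) t dPhi &
        dPhi ^+ 2 = 4%:R * along p q (Phi N U) t ^+ 3
                    - along p q (g2 N U) t * along p q (Phi N U) t
                    - along p q (g3 N U) t,
      proper <-> vanishes_along D p q (jacobian U (covS N U)) /\
                 vanishes_along D p q (jacobian U (covT N U)) &
      proper -> ~ constant_along D p q (Phi N U) ->
        [/\ vanishes_along D p q (covS N U),
            vanishes_along D p q (g2 N U) &
            (forall t, D t -> along p q (covT N U) t <> 0) ->
            wp_along_embedding iota D p q (Phi N U) (g2 N U) (g3 N U)]].
Proof.
move=> iotaK iota_norm iota_lt iota_pos N4 hU gD hpq U0 proper.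
have proper_iff : proper <-> vanishes_along D p q (jacobian U (covS N U)) /\
    vanishes_along D p q (jacobian U (covT N U)).
  have coef := constant_along_coef iotaK iota_norm iota_lt iota_pos N4 gD hpq U0.
  have c2 := coef 2%N (covS N U); have c3 := coef 3%N (covT N U).
  by split=> -[h2 h3]; split; [exact: c2.1|exact: c3.1|exact: c2.2|exact: c3.2].
split=> //; first exact: weierstrass_along.
move=> /proper_iff[p2 p3] Phi_var.
have S0 := covS_eq0 iotaK iota_norm iota_lt iota_pos N4 hU gD hpq U0 p2 p3 Phi_var.
split=> [t _|t _|]; first by rewrite S0 along0.
  by rewrite /g2 S0 mulr0 along0.
exact: wp_along.
Qed.
End Generic.

Theorem mainTheorem2 (R : realType) (k : scalars) (N : nat) (hN : (4 < N)%N)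
    (U : bipoly (field_of R k)) (hU : quantic N U)
    (D : set (field_of R k)) (hD : time_domain D)
    (p q : field_of R k -> field_of R k) (hpq : hamilton_curve D p q U)
    (hU0 : forall t, D t -> along p q U t <> 0) :
  let proper :=
    constant_along D p q (g2 N U) /\ constant_along D p q (g3 N U) in
  [/\ forall t, D t -> exists2 dPhi,
        has_derivative D (along p q (Phi N U)) t dPhi &
        dPhi ^+ 2 = 4%:R * along p q (Phi N U) t ^+ 3
                    - along p q (g2 N U) t * along p q (Phi N U) t
                    - along p q (g3 N U) t,
      proper <-> vanishes_along D p q (jacobian U (covS N U)) /\
                 vanishes_along D p q (jacobian U (covT N U)) &
      proper -> ~ constant_along D p q (Phi N U) ->
        [/\ vanishes_along D p q (covS N U),
            vanishes_along D p q (g2 N U) &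
            (forall t, D t -> along p q (covT N U) t <> 0) ->
            weierstrass_wp_along D p q (Phi N U) (g2 N U) (g3 N U)]].
Proof.
case: k U hU D hD p q hpq hU0 => /= U hU D [D1 D2] p q hpq hU0.
- apply: (@hamilton_weierstrass R R (real_complex R : {rmorphism R -> R[i]}) (@complex.Re R)) => //.
  + by move=> x; rewrite normc_def /= expr0n addr0 sqrtr_sqr.
  + exact: ltcR.
  + exact: posC.
  + exact: good_domain_interval.
apply: (@hamilton_weierstrass R R[i] (idfun : {rmorphism R[i] -> R[i]}) id) => //.
- by move=> e e0; exists e.
have -> : [set idfun s | s in D] = D by apply/seteqP; split=> [z [s Ds <-]|z Dz] //; exists z.
exact: good_domain_open.
Qed.
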